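(* Let $K(\alpha)$, $\alpha\in I$, be a $\mathcal{C}^{r,r'}$ billiard deformation with $r\ge2$, $r'\ge1$. For any finite admissible sequence $\xi\in\Sigma_n$, let $p_j=\varphi_j(u_j(\alpha),\alpha)$ be the periodic points corresponding to $\xi$. Then the parameters $u_j(\alpha)$ are $\mathcal{C}^{\min\{r-1,\,r'\}}$ with respect to the deformation parameter $\alpha$.
   Context: Deformations. A function $f(x,y)$ is $\mathcal{C}^{A,B}$ if $\partial^{a+b}f/\partial x^a\partial y^b$ is continuous for all $a\le A$, $b\le B$. Let $m\ge3$ and let $I\subseteq[-\infty,\infty]$ be a closed interval. $K(\alpha)=\bigcup_{i=1}^m K_i(\alpha)\subset\mathbb{R}^2$, $\alpha\in I$, is a $\mathcal{C}^{r,r'}$ billiard deformation if for each $\alpha$: the $K_i(\alpha)$ are pairwise disjoint, compact, strictly convex (boundary curvature everywhere positive) with $\mathcal{C}^r$ boundary of length $L_i(\alpha)$; the no-eclipse condition holds (for distinct $i,j,k$ the convex hull of $K_i(\alpha)\cup K_j(\alpha)$ is disjoint from $K_k(\alpha)$); $\partial K_i(\alpha)$ is parametrized counterclockwise by arclength by a $\mathcal{C}^{r,r'}$ function $\tilde\varphi_i(\tilde u,\alpha)$, $\tilde u\in[0,L_i(\alpha)]$; and for all $0\le q\le r$, $0\le q'\le r'$, $(q,q')\ne(0,0)$, there are constants $C^{(q,q')}_\varphi$ (depending on $\alpha$) with $\left\|\partial^{q+q'}\tilde\varphi_i/\partial\tilde u^q\partial\alpha^{q'}\right\|\le C^{(q,q')}_\varphi$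 for all $i$. Only one of the obstacles depends on $\alpha$. The parametrizations are extended $L_i(\alpha)$-periodically in $\tilde u$, and smoothness of a parameter in $\alpha$ refers to a continuous choice of representative. Periodic points. $\Sigma_n$ is the set of $\xi=(\xi_0,\dots,\xi_{n-1})$ with $\xi_i\in\{1,\dots,m\}$, $\xi_i\ne\xi_{i+1}$, $\xi_{n-1}\ne\xi_0$; indices are mod $n$ and $\varphi_j=\tilde\varphi_{\xi_j}$. For $\xi\in\Sigma_n$ and $\alpha\in I$, the length function $G_\xi(u,\alpha)=\sum_{j=1}^n\|\varphi_j(u_j,\alpha)-\varphi_{j-1}(u_{j-1},\alpha)\|$ has exactly one minimizer $u(\alpha)=(u_0(\alpha),\dots,u_{n-1}(\alpha))$; the points $p_j=\varphi_j(u_j(\alpha),\alpha)$ are the successive reflection points of the periodic billiard trajectory (with elastic reflections) with itinerary $\xi$, and are called the periodic points corresponding to $\xi$. *)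

(* Defs.v *)
From HB Require Import structures.
From mathcomp Require Import all_boot all_order all_algebra.
From mathcomp Require Import all_classical all_reals all_analysis.

Set Implicit Arguments.
Unset Strict Implicit.
Unset Printing Implicit Defensive.

Import Order.TTheory GRing.Theory Num.Theory.
Import numFieldNormedType.Exports.

Local Open Scope classical_set_scope.
Local Open Scope ring_scope.

(* ['rV[R]_2] carries the sup norm in the library, hence an explicit
   Euclidean norm. The two norms induce the same topology. *)
Definition enorm (R : realType) (p : 'rV[R]_2) : R :=
  Num.sqrt (p 0 0 ^+ 2 + p 0 1 ^+ 2).

(* Oriented area spanned by [p] and [q]: positive when [q] points to the left
   of [p]. *)
Definition cross (R : realType) (p q : 'rV[R]_2) : R :=
  p 0 0 * q 0 1 - p 0 1 * q 0 0.

(* The derivative of [f] at [x] relative to [D]: one-sided at an end point of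
   an interval, and no condition at an isolated point of [D]. *)
Definition has_derive_within (R : realType) (V : normedModType R)
    (D : set R) (f : R -> V) (x : R) (l : V) : Prop :=
  (fun y => (y - x)^-1 *: (f y - f x)) @ within D x^' --> l.

Definition Ck_on (R : realType) (V : normedModType R) (D : set R) (k : nat)
    (f : R -> V) : Prop :=
  exists F : nat -> R -> V,
    [/\ forall x, D x -> F 0%N x = f x,
        forall j x, (j < k)%N -> D x ->
          has_derive_within D (F j) x (F j.+1 x)
      & forall j, (j <= k)%N -> {within D, continuous (F j)}].

(* [F a b] is d^(a+b) f / dx^a dy^b on [D], for a <= A and b <= B, and is
   continuous on [D]: [f] is C^{A,B} on [D] iff it has such partials. The
   partial derivatives are taken along the horizontal and vertical slices of
   [D]; at a boundary point of [D] which is isolated in its slice, continuity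
   determines the value. *)
Definition mixed_partials (R : realType) (V : normedModType R)
    (D : set (R * R)) (A B : nat) (f : R * R -> V)
    (F : nat -> nat -> R * R -> V) : Prop :=
  [/\ forall z, D z -> F 0%N 0%N z = f z,
      forall a b x y, (a < A)%N -> (b <= B)%N -> D (x, y) ->
        has_derive_within [set s | D (s, y)] (fun s => F a b (s, y)) x
          (F a.+1 b (x, y)),
      forall a b x y, (a <= A)%N -> (b < B)%N -> D (x, y) ->
        has_derive_within [set s | D (x, s)] (fun s => F a b (x, s)) y
          (F a b.+1 (x, y))
    & forall a b, (a <= A)%N -> (b <= B)%N -> {within D, continuous (F a b)}].

Definition convex_hull (R : realType) (A : set 'rV[R]_2) : set 'rV[R]_2 :=
  smallest (@convex_set R 'rV[R]_2) A.

Definition strictly_convex (R : realType) (A : set 'rV[R]_2) : Prop :=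
  forall p q t, A p -> A q -> p != q -> 0 < t < 1 ->
    A° ((1 - t) *: p + t *: q).

Definition topological_boundary (R : realType) (A : set 'rV[R]_2) :
  set 'rV[R]_2 := closure A `\` A°.

(* The real parameters of a closed interval of the extended real line. *)
Definition param_interval (R : realType) (lo hi : \bar R) : set R :=
  [set a | (lo <= a%:E)%E /\ (a%:E <= hi)%E].

(* [phi i u a] is the [L i a]-periodic extension in [u] of the parametrization
   of the boundary of [K i a] on [0, L i a]. Joint regularity in (u, a) and the
   bounds are required on 0 <= u <= L i a only: the derivatives in [a] of the
   extension need not be periodic, nor bounded on the whole line. *)
Record billiard_deformation (R : realType) (m r r' : nat) (I : set R)
    (K : 'I_m -> R -> set 'rV[R]_2) (L : 'I_m -> R -> R)
    (phi : 'I_m -> R -> R -> 'rV[R]_2) : Prop := {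
  bd_disjoint : forall a i j, I a -> i != j -> K i a `&` K j a = set0;
  bd_compact : forall a i, I a -> compact (K i a);
  bd_strictly_convex : forall a i, I a -> strictly_convex (K i a);
  bd_no_eclipse : forall a i j k, I a -> i != j -> j != k -> i != k ->
    convex_hull (K i a `|` K j a) `&` K k a = set0;
  bd_length_gt0 : forall a i, I a -> 0 < L i a;
  bd_periodic : forall a i u, I a -> phi i (u + L i a) a = phi i u a;
  bd_image : forall a i, I a ->
    (fun u => phi i u a) @` [set u | 0 <= u <= L i a] =
    topological_boundary (K i a);
  bd_simple : forall a i u v, I a -> 0 <= u < L i a -> 0 <= v < L i a ->
    phi i u a = phi i v a -> u = v;
  (* the boundary curve is C^r, also across the base point u = 0 *)
  bd_boundary_Cr : forall a i, I a ->
    Ck_on [set: R] r (fun u => phi i u a);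
  bd_arclength : forall a i u, I a -> enorm (derive1 (phi i ^~ a) u) = 1;
  (* the obstacle lies to the left of its oriented tangent lines *)
  bd_counterclockwise : forall a i u p, I a -> K i a p ->
    0 <= cross (derive1 (phi i ^~ a) u) (p - phi i u a);
  (* the signed curvature of an arclength parametrization is
     cross(phi', phi'') *)
  bd_curvature_gt0 : forall a i u, I a ->
    0 < cross (derive1 (phi i ^~ a) u) (derive1n 2 (phi i ^~ a) u);
  bd_smooth : exists F : 'I_m -> nat -> nat -> R * R -> 'rV[R]_2,
    (forall i, mixed_partials [set z | I z.2 /\ 0 <= z.1 <= L i z.2] r r'
                 (fun z => phi i z.1 z.2) (F i)) /\
    (forall a q q', I a -> (q <= r)%N -> (q' <= r')%N -> (0 < q + q')%N ->
       exists C : R, forall i u, 0 <= u <= L i a ->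
         enorm (F i q q' (u, a)) <= C);
  bd_one_moving : exists i0 : 'I_m, forall i a b, i != i0 -> I a -> I b ->
    K i a = K i b
}.

(* Indices in ['I_n] are cyclic: [ordS] and [ord_pred] are j + 1 and j - 1
   mod n. *)
Definition admissible (m n : nat) (xi : 'I_n -> 'I_m) : Prop :=
  forall j, xi j != xi (ordS j).

Definition length_function (R : realType) (m n : nat)
    (phi : 'I_m -> R -> R -> 'rV[R]_2) (xi : 'I_n -> 'I_m)
    (u : 'I_n -> R) (a : R) : R :=
  \sum_(j < n) enorm (phi (xi j) (u j) a -
                      phi (xi (ord_pred j)) (u (ord_pred j)) a).

(* The parameters u_j(a) of the periodic points are defined modulo
   [L (xi j) a]; this is a choice of real representatives continuous in a. *)
Definition continuous_minimizer (R : realType) (m n : nat) (I : set R)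
    (phi : 'I_m -> R -> R -> 'rV[R]_2) (xi : 'I_n -> 'I_m)
    (u : 'I_n -> R -> R) : Prop :=
  (forall a, I a -> forall v : 'I_n -> R,
     length_function phi xi (u ^~ a) a <= length_function phi xi v a) /\
  (forall j, {within I, continuous (u j)}).

(* Main.v *)
Require Import Defs.
From mathcomp Require Import all_boot all_order all_algebra.
From mathcomp Require Import all_classical all_reals all_analysis.
From mathcomp Require Import ring lra.
Set Implicit Arguments.
Unset Strict Implicit.
Unset Printing Implicit Defensive.
Import Order.TTheory GRing.Theory Num.Theory.
Import numFieldNormedType.Exports.
Local Open Scope classical_set_scope.
Local Open Scope ring_scope.

(* The minimizer of the length function is critical, and the Hessian at it is
   the sum of a positive semidefinite form and of a diagonal form whose entries
   are products of a curvature and of the size of the bend of the trajectory,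
   which no eclipse makes nonzero: it is positive definite. Differentiating the
   critical equation gives u' = - H^-1 b, where H and b involve one derivative
   in u of the unit tangents, and u gains one derivative at a time.

   The parametrizations are regular on 0 <= u <= L(a) only, and u_j is a real
   representative, so the perimeter L has to be as regular as u_j. It is
   continuous by convexity, and L' is then read off the closing relation
   phi(L(a), a) = phi(0, a). The periodic extensions of the partial derivatives
   are glued along the curves u = j L(a).

   The minimizer over the boundaries is also one over the convex obstacles;
   there it is unique, since the midpoint of two of them would have an interior
   point, which could be moved to shorten the loop. Uniqueness and compactness
   make the points continuous in a; their parameters are then lifted from the
   circle to the real line. *)

(** * First-order expansions and derivatives within a set *)

(** The minimizer is continuous in the parameter from the start; only its differentiability is at
    stake, and it comes from a linearization. The critical equation is expanded in all the [u j] and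
    in [a] at once, with an error small relative to the sum of all increments; inverting the Hessian
    then bounds that sum by a multiple of the increment of [a] alone. This is why expansions are
    taken along an arbitrary filter with an arbitrary gauge [N]: the same rules serve functions of
    one variable, functions of two variables and this linearization, at end points as well as
    inside.

    The obstacle is the domain 0 <= u <= L(a). Its upper edge moves, no regularity of L is given,
    and L may oscillate, so a straight or broken path between two points of the domain can leave it.
    Two-variable increments are estimated only along paths kept below the graph of L, which requires
    control of L beforehand. The derivative lost in [r - 1] is the one spent on the unit tangents,
    from which the critical equation is built. *)

Section Expansions.
Context {R : realType} {T : Type} (Fl : set_system T) {FF : Filter Fl}.
Variable N : T -> R.
Implicit Types X Y dX dY : T -> R.

Definition small X := forall e, 0 < e -> \forall t \near Fl, `|X t| <= e * N t.

Definition big X := exists C, \forall t \near Fl, `|X t| <= C * N t.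

(* [X] has value [x0] at the base point of the filter, and first-order
   increment [dX] with respect to the gauge [N]. *)
Definition expansion X x0 dX := big dX /\ small (fun t => X t - x0 - dX t).

Hypothesis N_ge0 : forall t, 0 <= N t.

Lemma small_big X : small X -> big X.
Proof. by move=> sX; exists 1; exact: sX. Qed.

Lemma smallD X Y : small X -> small Y -> small (fun t => X t + Y t).
Proof.
move=> sX sY e e0; have h : 0 < e / 2 by lra.
near=> t.
have hX : `|X t| <= e / 2 * N t by near: t; exact: sX.
have hY : `|Y t| <= e / 2 * N t by near: t; exact: sY.
by apply: (le_trans (ler_normD _ _)); lra.
Unshelve. all: by end_near. Qed.

Lemma bigD X Y : big X -> big Y -> big (fun t => X t + Y t).
Proof.
move=> [C hX] [C' hY]; exists (C + C'); near=> t.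
have hX' : `|X t| <= C * N t by near: t; exact: hX.
have hY' : `|Y t| <= C' * N t by near: t; exact: hY.
by apply: (le_trans (ler_normD _ _)); lra.
Unshelve. all: by end_near. Qed.

Lemma bigZ c X : big X -> big (fun t => c * X t).
Proof.
move=> [C hX]; exists (`|c| * C); near=> t.
have hX' : `|X t| <= C * N t by near: t; exact: hX.
by rewrite normrM -mulrA ler_wpM2l.
Unshelve. all: by end_near. Qed.

Lemma smallZ c X : small X -> small (fun t => c * X t).
Proof.
move=> sX e e0; have c0 : 0 < `|c| + 1 by rewrite ltr_pwDr.
near=> t.
have hX : `|X t| <= e / (`|c| + 1) * N t by near: t; apply: sX; rewrite divr_gt0.
rewrite normrM (@le_trans _ _ ((`|c| + 1) * (e / (`|c| + 1) * N t))) //.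
  by rewrite ler_pM // lerDl.
by rewrite !mulrA (mulrC _ e) mulfK // gt_eqF.
Unshelve. all: by end_near. Qed.

Lemma small_vanish X Y : (forall e, 0 < e -> \forall t \near Fl, `|X t| <= e) ->
  big Y -> small (fun t => X t * Y t).
Proof.
move=> hX [C hY] e e0; have c0 : 0 < `|C| + 1 by rewrite ltr_pwDr.
near=> t.
have hX' : `|X t| <= e / (`|C| + 1) by near: t; apply: hX; rewrite divr_gt0.
have hY' : `|Y t| <= (`|C| + 1) * N t.
  have h : `|Y t| <= C * N t by near: t.
  apply: (le_trans h); rewrite ler_wpM2r //.
  by rewrite (le_trans (ler_norm _)) // lerDl.
rewrite normrM (@le_trans _ _ (e / (`|C| + 1) * ((`|C| + 1) * N t))) //.
  by rewrite ler_pM.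
by rewrite mulrA divfK // gt_eqF.
Unshelve. all: by end_near. Qed.

Lemma expansion_eq X x0 dX X' x0' dX' : expansion X x0 dX ->
  X =1 X' -> x0 = x0' -> dX =1 dX' -> expansion X' x0' dX'.
Proof. by move=> h /funext<- <- /funext<-. Qed.

Lemma expansion_cst c : expansion (fun=> c) c (fun=> 0).
Proof.
split; first by exists 0; near=> t; rewrite normr0 mul0r.
by move=> e e0; near=> t; rewrite subrr subr0 normr0 mulr_ge0 // ltW.
Unshelve. all: by end_near. Qed.

Lemma expansionD X x dX Y y dY : expansion X x dX -> expansion Y y dY ->
  expansion (fun t => X t + Y t) (x + y) (fun t => dX t + dY t).
Proof.
move=> [bX sX] [bY sY]; split; first exact: bigD.
have := smallD sX sY; congr small; apply/funext => t; ring.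
Qed.

Lemma expansionZ c X x dX : expansion X x dX ->
  expansion (fun t => c * X t) (c * x) (fun t => c * dX t).
Proof.
move=> [bX sX]; split; first exact: bigZ.
have := smallZ c sX; congr small; apply/funext => t; ring.
Qed.

Lemma expansionB X x dX Y y dY : expansion X x dX -> expansion Y y dY ->
  expansion (fun t => X t - Y t) (x - y) (fun t => dX t - dY t).
Proof.
move=> hX /(expansionZ (-1)) hY; apply: (expansion_eq (expansionD hX hY)) => [t||t]; ring.
Qed.

Hypothesis N_to0 : forall e, 0 < e -> \forall t \near Fl, N t <= e.

Lemma big_vanish X : big X -> forall e, 0 < e -> \forall t \near Fl, `|X t| <= e.
Proof.
move=> [C hX] e e0; have c0 : 0 < `|C| + 1 by rewrite ltr_pwDr.
near=> t.
have h : `|X t| <= C * N t by near: t.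
have hN : N t <= e / (`|C| + 1) by near: t; apply: N_to0; rewrite divr_gt0.
apply: (le_trans h); rewrite (@le_trans _ _ ((`|C| + 1) * N t)) //.
  by rewrite ler_wpM2r // (le_trans (ler_norm _)) // lerDl.
by rewrite mulrC -ler_pdivlMr.
Unshelve. all: by end_near. Qed.

Lemma expansion_big X x dX : expansion X x dX -> big (fun t => X t - x).
Proof.
move=> [bX /small_big sX]; have := bigD bX sX; congr big.
by apply/funext => t; ring.
Qed.

Lemma expansion_vanish X x dX : expansion X x dX ->
  forall e, 0 < e -> \forall t \near Fl, `|X t - x| <= e.
Proof. by move=> /expansion_big; exact: big_vanish. Qed.

Lemma expansion_cvg X x dX : expansion X x dX -> X @ Fl --> x.
Proof.
move=> h; apply/cvgrPdist_le => e e0; near=> t; rewrite distrC; near: t.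
exact: (expansion_vanish h).
Unshelve. all: by end_near. Qed.

(** The second-order term (X - x)(Y - y) is a vanishing factor times one of the order of [N]. *)
Lemma expansionM X x dX Y y dY : expansion X x dX -> expansion Y y dY ->
  expansion (fun t => X t * Y t) (x * y) (fun t => dX t * y + x * dY t).
Proof.
move=> hX hY; have hXv := expansion_vanish hX; have hYb := expansion_big hY.
case: hX => bX sX; case: hY => bY sY; split.
  by apply: bigD; [have := bigZ y bX; congr big; apply/funext => t; ring
                  |exact: bigZ].
have := smallD (smallD (smallZ y sX) (smallZ x sY)) (small_vanish hXv hYb).
by congr small; apply/funext => t; ring.
Qed.

End Expansions.

Section Derivatives.
Context {R : realType}.
Implicit Types (D : set R) (S : set (R * R)) (h : R * R -> R).

(** The filter keeps the base point, where the estimate reads 0 <= 0. At an isolated point of [D]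
    every [l] qualifies, hence the accumulation hypothesis of [deriv_in_uniq]. *)
Definition deriv_in D (f : R -> R) (x l : R) :=
  expansion (within D (nbhs x)) (fun y => `|y - x|) f (f x) (fun y => l * (y - x)).

Definition frechet_in S h (z : R * R) (hu ha : R) :=
  expansion (within S (nbhs z)) (fun w => `|w.1 - z.1| + `|w.2 - z.2|) h (h z)
    (fun w => hu * (w.1 - z.1) + ha * (w.2 - z.2)).

Lemma near_dist_le D (x e : R) : 0 < e -> \forall y \near within D (nbhs x), `|y - x| <= e.
Proof.
move=> e0; rewrite near_withinE; near=> y => _.
by rewrite distrC; near: y; exact: (cvgr_dist_le _ _ (@cvg_id _ (nbhs x))).
Unshelve. all: by end_near. Qed.

Lemma near_dist2_le S (z : R * R) (e : R) : 0 < e ->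
  \forall w \near within S (nbhs z), `|w.1 - z.1| + `|w.2 - z.2| <= e.
Proof.
move=> e0; have e2 : 0 < e / 2 by lra.
have /cvgrPdist_le/(_ _ e2) h1 : (fun w : R * R => w.1) @ nbhs z --> z.1 by exact: cvg_fst.
have /cvgrPdist_le/(_ _ e2) h2 : (fun w : R * R => w.2) @ nbhs z --> z.2 by exact: cvg_snd.
rewrite near_withinE; near=> w => _.
have : `|z.1 - w.1| <= e / 2 by near: w.
have : `|z.2 - w.2| <= e / 2 by near: w.
rewrite (distrC w.1) (distrC w.2); lra.
Unshelve. all: by end_near. Qed.

Section Composition.
Context {T : Type} (Fl : set_system T) {FF : Filter Fl} (N : T -> R).
Hypothesis N_ge0 : forall t, 0 <= N t.
Hypothesis N_to0 : forall e, 0 < e -> \forall t \near Fl, N t <= e.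

Lemma expansion_hd D f y l Y dY : deriv_in D f y l -> expansion Fl N Y y dY ->
  (\forall t \near Fl, D (Y t)) ->
  expansion Fl N (fun t => f (Y t)) (f y) (fun t => l * dY t).
Proof.
move=> [_ sf] hY hD; split; first by apply: bigZ => //; case: hY.
have [C hC] := expansion_big hY.
have C0 : 0 < `|C| + 1 by rewrite ltr_pwDr.
have : small Fl N (fun t => f (Y t) - f y - l * (Y t - y)).
  move=> e e0; have e1 : 0 < e / (`|C| + 1) by rewrite divr_gt0.
  have := sf _ e1; rewrite near_withinE => hh.
  near=> t.
  have hYt : `|Y t - y| <= (`|C| + 1) * N t.
    have h : `|Y t - y| <= C * N t by near: t.
    apply: (le_trans h); rewrite ler_wpM2r //.
    by rewrite (le_trans (ler_norm _)) // lerDl.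
  have h : `|f (Y t) - f y - l * (Y t - y)| <= e / (`|C| + 1) * `|Y t - y|.
    have DY : D (Y t) by near: t.
    by move: DY; near: t; exact: (expansion_cvg N_ge0 N_to0 hY hh).
  apply: (le_trans h); rewrite -ler_pdivlMl ?divr_gt0 //.
  apply: (le_trans hYt); rewrite invf_div mulrA.
  by rewrite -[_ / e * e]mulrA mulVf ?mulr1 ?gt_eqF.
case: hY => bY sY /(smallD (smallZ l sY)).
by congr small; apply/funext => t; ring.
Unshelve. all: by end_near. Qed.

Lemma expansion_fr S h z hu ha X dX Y dY : frechet_in S h z hu ha ->
  expansion Fl N X z.1 dX -> expansion Fl N Y z.2 dY ->
  (\forall t \near Fl, S (X t, Y t)) ->
  expansion Fl N (fun t => h (X t, Y t)) (h z) (fun t => hu * dX t + ha * dY t).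
Proof.
move=> [_ sf] hX hY hS; split.
  by apply: bigD => //; apply: bigZ => //; [case: hX|case: hY].
have [C hC] := expansion_big hX.
have [C' hC'] := expansion_big hY.
set B := `|C| + `|C'| + 1.
have B0 : 0 < B by rewrite ltr_pwDr // addr_ge0.
have : small Fl N (fun t => h (X t, Y t) - h z - (hu * (X t - z.1) + ha * (Y t - z.2))).
  have hXY : (fun t => (X t, Y t)) @ Fl --> z.
    exact: (cvg_pair (G := nbhs z.1) (H := nbhs z.2) (expansion_cvg N_ge0 N_to0 hX)
      (expansion_cvg N_ge0 N_to0 hY)).
  move=> e e0; have e1 : 0 < e / B by rewrite divr_gt0.
  have := sf _ e1; rewrite near_withinE => hh.
  near=> t.
  have hYt : `|X t - z.1| + `|Y t - z.2| <= B * N t.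
    have h1 : `|X t - z.1| <= C * N t by near: t.
    have h2 : `|Y t - z.2| <= C' * N t by near: t.
    apply: (@le_trans _ _ (C * N t + C' * N t)); first by rewrite lerD.
    rewrite -mulrDl ler_wpM2r // /B.
    have := ler_norm C; have := ler_norm C'; lra.
  have h0 : `|h (X t, Y t) - h z - (hu * (X t - z.1) + ha * (Y t - z.2))|
      <= e / B * (`|X t - z.1| + `|Y t - z.2|).
    have DY : S (X t, Y t) by near: t.
    by move: DY; near: t; exact: (hXY _ hh).
  apply: (le_trans h0); rewrite -ler_pdivlMl ?divr_gt0 //.
  apply: (le_trans hYt); rewrite invf_div mulrA.
  by rewrite -[_ / e * e]mulrA mulVf ?mulr1 ?gt_eqF.
case: hX => bX sX; case: hY => bY sY.
move=> /(smallD (smallD (smallZ hu sX) (smallZ ha sY))).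
by congr small; apply/funext => t; ring.
Unshelve. all: by end_near. Qed.

End Composition.

Lemma expansion_id_within D (x : R) :
  expansion (within D (nbhs x)) (fun y => `|y - x|) id x (fun y => y - x).
Proof.
split; first by exists 1; near=> y; rewrite mul1r.
by move=> e e0; near=> y; rewrite subrr normr0 mulr_ge0 // ltW.
Unshelve. all: by end_near. Qed.

Lemma expansion_fst_within S (z : R * R) :
  expansion (within S (nbhs z)) (fun w => `|w.1 - z.1| + `|w.2 - z.2|) fst z.1
    (fun w => w.1 - z.1).
Proof.
split; first by exists 1; near=> y; rewrite mul1r lerDl.
by move=> e e0; near=> y; rewrite subrr normr0 mulr_ge0 ?addr_ge0 // ltW.
Unshelve. all: by end_near. Qed.

Lemma expansion_snd_within S (z : R * R) :
  expansion (within S (nbhs z)) (fun w => `|w.1 - z.1| + `|w.2 - z.2|) snd z.2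
    (fun w => w.2 - z.2).
Proof.
split; first by exists 1; near=> y; rewrite mul1r lerDr.
by move=> e e0; near=> y; rewrite subrr normr0 mulr_ge0 ?addr_ge0 // ltW.
Unshelve. all: by end_near. Qed.

Let n1_ge0 (x : R) : forall y : R, 0 <= `|y - x|. Proof. by []. Qed.
Let n2_ge0 (z : R * R) : forall w : R * R, 0 <= `|w.1 - z.1| + `|w.2 - z.2|.
Proof. by move=> w; rewrite addr_ge0. Qed.

Lemma deriv_inP D f x l : deriv_in D f x l <->
  small (within D (nbhs x)) (fun y => `|y - x|) (fun y => f y - f x - l * (y - x)).
Proof.
split=> [[]//|s]; split=> //.
by apply: bigZ => //; case: (expansion_id_within D x).
Qed.

Lemma frechet_inP S h z hu ha : frechet_in S h z hu ha <->
  small (within S (nbhs z)) (fun w => `|w.1 - z.1| + `|w.2 - z.2|)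
    (fun w => h w - h z - (hu * (w.1 - z.1) + ha * (w.2 - z.2))).
Proof.
split=> [[]//|s]; split=> //.
apply: bigD.
  by apply: bigZ => //; case: (expansion_fst_within S z).
by apply: bigZ => //; case: (expansion_snd_within S z).
Qed.

Lemma deriv_in_cvg D f x l : deriv_in D f x l -> f @ within D (nbhs x) --> f x.
Proof. by move=> h; apply: (expansion_cvg _ _ h) => // e; exact: near_dist_le. Qed.

Lemma frechet_in_cvg S h z hu ha : frechet_in S h z hu ha -> h @ within S (nbhs z) --> h z.
Proof.
by move=> H; apply: (expansion_cvg _ _ H); [exact: n2_ge0 | move=> e; exact: near_dist2_le].
Qed.

Lemma deriv_in_eq D f f' x l :
  D x -> (forall y, D y -> f y = f' y) -> deriv_in D f x l -> deriv_in D f' x l.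
Proof.
move=> Dx ff' /deriv_inP s; apply/deriv_inP => e /s; rewrite !near_withinE; apply: filterS => y h Dy.
by rewrite -!ff' //; exact: h.
Qed.

Lemma frechet_in_eq S h h' z hu ha : S z -> (forall w, S w -> h w = h' w) ->
  frechet_in S h z hu ha -> frechet_in S h' z hu ha.
Proof.
move=> Sz hh' /frechet_inP s; apply/frechet_inP => e /s; rewrite !near_withinE; apply: filterS => y k Sy.
by rewrite -!hh' //; exact: k.
Qed.

Lemma within_subset {T : topologicalType} (A B : set T) (z : T) P : A `<=` B ->
  (\forall w \near within B (nbhs z), P w) -> \forall w \near within A (nbhs z), P w.
Proof.
by move=> AB; rewrite !near_withinE; apply: filterS => w h /AB; exact: h.
Qed.

Lemma frechet_in_sub S S' h z hu ha :
  S' `<=` S -> frechet_in S h z hu ha -> frechet_in S' h z hu ha.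
Proof. by move=> SS /frechet_inP s; apply/frechet_inP => e /s; exact: within_subset. Qed.

Lemma deriv_in_sub D D' f z l : D' `<=` D -> deriv_in D f z l -> deriv_in D' f z l.
Proof. by move=> SS /deriv_inP s; apply/deriv_inP => e /s; exact: within_subset. Qed.

Lemma deriv_in_uniq D f x l l' :
  (forall d, 0 < d -> exists y, [/\ D y, y != x & `|y - x| < d]) ->
  deriv_in D f x l -> deriv_in D f x l' -> l = l'.
Proof.
move=> acc /deriv_inP s /deriv_inP s'; apply/eqP; rewrite -subr_eq0 -normr_le0.
apply/ler_addgt0Pr => e e0; rewrite add0r.
have e2 : 0 < e / 2 by lra.
have := s _ e2; have := s' _ e2; rewrite !near_withinE.
move=> /nbhs_ballP[d /= d0 hd'] /nbhs_ballP[d' /= d'0 hd1].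
have [|y [Dy yx ydd]] := acc (Num.min d d'); first by rewrite lt_min d0.
have {}hd' := hd' y _ Dy; have {}hd1 := hd1 y _ Dy.
move: ydd; rewrite lt_min distrC => /andP[/hd' {}hd' /hd1 {}hd1].
have yx0 : 0 < `|y - x| by rewrite normr_gt0 subr_eq0.
rewrite -(ler_pM2r yx0) -normrM.
have -> : (l - l') * (y - x) = (f y - f x - l' * (y - x)) - (f y - f x - l * (y - x)).
  by ring.
apply: (le_trans (ler_normB _ _)); lra.
Qed.

Definition cont {T : topologicalType} (S : set T) (h : T -> R) :=
  forall z, S z -> h @ within S (nbhs z) --> h z.

Lemma contP {T : topologicalType} (S : set T) (h : T -> R) :
  cont S h <-> {within S, continuous h}.
Proof. by split=> /subspace_continuousP. Qed.

Lemma cont_eq {T : topologicalType} (S : set T) (h h' : T -> R) :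
  (forall w, S w -> h w = h' w) -> cont S h -> cont S h'.
Proof.
move=> hh c z Sz; have := c z Sz; rewrite -(hh z Sz) => /cvgrPdist_le k.
apply/cvgrPdist_le => e /k; rewrite !near_withinE; apply: filterS => w {}k Sw.
by rewrite -hh //; exact: k.
Qed.

Lemma cont_sub {T : topologicalType} (S S' : set T) (h : T -> R) :
  S' `<=` S -> cont S h -> cont S' h.
Proof.
move=> SS c z Sz; have /cvgrPdist_le k := c z (SS _ Sz).
by apply/cvgrPdist_le => e /k; exact: within_subset.
Qed.

Lemma contD {T : topologicalType} (S : set T) (h h' : T -> R) :
  cont S h -> cont S h' -> cont S (fun z => h z + h' z).
Proof. by move=> c c' z Sz; apply: cvgD; [exact: c|exact: c']. Qed.

Lemma contM {T : topologicalType} (S : set T) (h h' : T -> R) :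
  cont S h -> cont S h' -> cont S (fun z => h z * h' z).
Proof. by move=> c c' z Sz; apply: cvgM; [exact: c|exact: c']. Qed.

Lemma cont_comp {T U : topologicalType} (A : set T) (B : set U) (c : T -> U) (h : U -> R) :
  cont B h -> (forall x, A x -> B (c x)) ->
  (forall x, A x -> c @ within A (nbhs x) --> c x) ->
  cont A (fun x => h (c x)).
Proof.
move=> ch AB cc z Az; apply/cvgrPdist_le => e e0.
have /cvgrPdist_le /(_ e e0) := ch _ (AB _ Az); rewrite !near_withinE => k.
have := cc z Az _ k; rewrite /nbhs /= /within /=; apply: filterS => w kw Aw.
by apply: kw => //; exact: AB.
Qed.

(** A counterpart of [Ck_on] made for induction on [k]. The derivative is a witness rather than an
    operator, since an isolated point of [D] leaves it undetermined. *)
Fixpoint Ck_in D k (f : R -> R) : Prop :=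
  if k is k'.+1 then
    exists2 f', (forall x, D x -> deriv_in D f x (f' x)) & Ck_in D k' f'
  else cont D f.

Lemma Ck_in_cont D k f : Ck_in D k f -> cont D f.
Proof. by case: k => //= k [f' h _] x Dx; apply: deriv_in_cvg (h x Dx). Qed.

Lemma Ck_inS D k f : Ck_in D k.+1 f -> Ck_in D k f.
Proof.
elim: k f => [|k IH] f; first exact: Ck_in_cont.
by move=> [f' h c]; exists f' => //; exact: IH.
Qed.

Lemma Ck_in_eq D k f f' : (forall x, D x -> f x = f' x) -> Ck_in D k f -> Ck_in D k f'.
Proof.
case: k => [|k] ff'; first exact: cont_eq.
move=> [g h c]; exists g => // x Dx; apply: deriv_in_eq (h x Dx) => //.
Qed.

Lemma Ck_in_cst D k (c : R) : Ck_in D k (fun=> c).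
Proof.
elim: k c => [|k IH] c; first by move=> x _; exact: cvg_cst.
exists (fun=> 0) => // x Dx; apply/deriv_inP => e e0; near=> y.
by rewrite subrr mul0r subrr normr0 mulr_ge0 // ltW.
Unshelve. all: by end_near. Qed.

Lemma Ck_inD D k f g : Ck_in D k f -> Ck_in D k g -> Ck_in D k (fun x => f x + g x).
Proof.
elim: k f g => [|k IH] f g; first exact: contD.
move=> [f' hf cf] [g' hg cg]; exists (fun x => f' x + g' x); last exact: IH.
move=> x Dx; apply: (expansion_eq (expansionD (hf x Dx) (hg x Dx))) => // y; ring.
Qed.

Lemma Ck_inM D k f g : Ck_in D k f -> Ck_in D k g -> Ck_in D k (fun x => f x * g x).
Proof.
elim: k f g => [|k IH] f g; first exact: contM.
move=> F G; have {}F' := Ck_inS F; have G' := Ck_inS G.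
case: F G => f' hf cf [g' hg cg]; exists (fun x => f' x * g x + f x * g' x).
  move=> x Dx.
  apply: (expansion_eq (expansionM (n1_ge0 x) (@near_dist_le D x) (hf x Dx) (hg x Dx)))
    => // y; ring.
by apply: Ck_inD; apply: IH.
Qed.

Lemma Ck_inN D k f : Ck_in D k f -> Ck_in D k (fun x => - f x).
Proof.
move=> /(Ck_inM (Ck_in_cst D k (-1))); apply: Ck_in_eq => x _; by rewrite mulN1r.
Qed.

Lemma Ck_inB D k f g : Ck_in D k f -> Ck_in D k g -> Ck_in D k (fun x => f x - g x).
Proof. by move=> hf /Ck_inN; exact: Ck_inD. Qed.

Lemma Ck_in_sum D k (I : Type) (s : seq I) (P : pred I) (F : I -> R -> R) :
  (forall i, Ck_in D k (F i)) -> Ck_in D k (fun x => \sum_(i <- s | P i) F i x).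
Proof.
move=> h; elim: s => [|i s IH].
  by apply: Ck_in_eq (Ck_in_cst D k 0) => x _; rewrite big_nil.
case: (boolP (P i)) => Pi.
  by apply: Ck_in_eq (Ck_inD (h i) IH) => x _; rewrite big_cons Pi.
by apply: Ck_in_eq IH => x _; rewrite big_cons (negbTE Pi).
Qed.

Lemma Ck_in_prod D k (I : Type) (s : seq I) (P : pred I) (F : I -> R -> R) :
  (forall i, Ck_in D k (F i)) -> Ck_in D k (fun x => \prod_(i <- s | P i) F i x).
Proof.
move=> h; elim: s => [|i s IH].
  by apply: Ck_in_eq (Ck_in_cst D k 1) => x _; rewrite big_nil.
case: (boolP (P i)) => Pi.
  by apply: Ck_in_eq (Ck_inM (h i) IH) => x _; rewrite big_cons Pi.
by apply: Ck_in_eq IH => x _; rewrite big_cons (negbTE Pi).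
Qed.

Lemma Ck_in_det D k n (A : R -> 'M[R]_n) :
  (forall i j, Ck_in D k (fun x => A x i j)) -> Ck_in D k (fun x => \det (A x)).
Proof.
move=> h; rewrite /determinant; apply: Ck_in_sum => s.
by apply: Ck_inM; [exact: Ck_in_cst | apply: Ck_in_prod => i].
Qed.

End Derivatives.

(** * Jets of functions of two variables *)

Section TwoVariables.
Context {R : realType}.
Implicit Types (D I : set R) (S : set (R * R)) (h g : nat -> R * R -> R).

Let n2_ge0 (z : R * R) : forall w : R * R, 0 <= `|w.1 - z.1| + `|w.2 - z.2|.
Proof. by move=> w; rewrite addr_ge0. Qed.

(* [h q] plays the role of d^q h_0 / du^q; the witness [g q] is then
   d^(q+1) h_0 / du^q da, so that mixed partials commute by construction. *)
Fixpoint Ck_jet S k h : Prop :=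
  if k is k'.+1 then
    exists g, [/\ forall q z, (q <= k')%N -> S z -> frechet_in S (h q) z (h q.+1 z) (g q z),
                  Ck_jet S k' g & Ck_jet S k' (fun q => h q.+1)]
  else cont S (h 0%N).

Lemma Ck_jet_cont S k h : Ck_jet S k h -> cont S (h 0%N).
Proof.
by case: k => //= k [g [H _ _]] z Sz; apply: frechet_in_cvg (H 0%N z _ Sz).
Qed.

Lemma Ck_jetS S k h : Ck_jet S k.+1 h -> Ck_jet S k h.
Proof.
elim: k h => [|k IH] h; first exact: Ck_jet_cont.
move=> [g [H Hg Hh]]; exists g; split=> [q z qk||]; [|exact: IH|exact: IH].
by apply: H; apply: leqW.
Qed.

Lemma Ck_jet_eq S k h h' : (forall q z, (q <= k)%N -> S z -> h q z = h' q z) ->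
  Ck_jet S k h -> Ck_jet S k h'.
Proof.
elim: k h h' => [|k IH] h h' hh; first by apply: cont_eq => z; exact: hh.
move=> [g [H Hg Hh]]; exists g; split=> //; last first.
  by apply: IH Hh => q z qk; exact: hh.
move=> q z qk Sz; rewrite -hh //; apply: frechet_in_eq (H q z qk Sz) => // w Sw.
by apply: hh => //; exact: leqW.
Qed.

Lemma Ck_jet_sub S S' k h : S' `<=` S -> Ck_jet S k h -> Ck_jet S' k h.
Proof.
move=> SS; elim: k h => [|k IH] h; first exact: cont_sub.
move=> [g [H Hg Hh]]; exists g; split; [|exact: IH|exact: IH].
by move=> q z qk Sz; apply: (frechet_in_sub SS); apply: H => //; exact: SS.
Qed.

Lemma Ck_jetD S k h h' : Ck_jet S k h -> Ck_jet S k h' -> Ck_jet S k (fun q z => h q z + h' q z).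
Proof.
elim: k h h' => [|k IH] h h'; first exact: contD.
move=> [g [H Hg Hh]] [g' [H' Hg' Hh']]; exists (fun q z => g q z + g' q z).
split; [|exact: IH|exact: IH].
move=> q z qk Sz; apply: (expansion_eq (expansionD (H q z qk Sz) (H' q z qk Sz))) => // w; ring.
Qed.

Lemma Ck_jet_scale I S k (c : R -> R) h : (forall z, S z -> I z.2) ->
  Ck_in I k c -> Ck_jet S k h -> Ck_jet S k (fun q z => c z.2 * h q z).
Proof.
move=> SI; elim: k c h => [|k IH] c h.
  move=> cc ch; apply: contM => //; apply: (cont_comp cc SI) => z Sz.
  exact: (expansion_cvg (n2_ge0 z) (@near_dist2_le _ S z) (expansion_snd_within S z)).
move=> C; have C' := Ck_inS C; case: C => c' hc cc'.
move=> H; have H' := Ck_jetS H; case: H => g [H Hg Hh].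
exists (fun q z => c' z.2 * h q z + c z.2 * g q z); split; last exact: IH.
  move=> q z qk Sz.
  have hz : \forall w \near within S (nbhs z), I w.2.
    by rewrite near_withinE; near=> w; exact: SI.
  have dc : expansion (within S (nbhs z)) (fun w => `|w.1 - z.1| + `|w.2 - z.2|)
      (fun w => c w.2) (c z.2) (fun w => c' z.2 * (w.2 - z.2)).
    exact: (expansion_hd (n2_ge0 z) (@near_dist2_le _ S z) (hc _ (SI _ Sz))
      (expansion_snd_within S z) hz).
  apply: (expansion_eq (expansionM (n2_ge0 z) (@near_dist2_le _ S z) dc (H q z qk Sz))) => // w.
  by ring.
by apply: Ck_jetD; exact: IH.
Unshelve. all: by end_near. Qed.

(** This carries the fundamental domain to the other periods, with [c] a multiple of the perimeter.
    Translation commutes with the derivative in u, but the derivative in [a] acquires the term c'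
    times the next entry of the jet: the regularity of [c] limits that of the result. *)
Lemma Ck_jet_translate I S k (c : R -> R) h : (forall z, S z -> I z.2) ->
  Ck_in I k c -> Ck_jet S k h ->
  Ck_jet [set z | S (z.1 + c z.2, z.2)] k (fun q z => h q (z.1 + c z.2, z.2)).
Proof.
move=> SI; elim: k h c => [|k IH] h c.
  move=> cc ch; apply: (cont_comp ch (A := [set z | S (z.1 + c z.2, z.2)])) => // z Sz.
  set S' := [set _ | _] in Sz *.
  have SI' : forall w, S' w -> I w.2 by move=> w /SI.
  apply: (cvg_pair (G := nbhs (z.1 + c z.2)) (H := nbhs z.2)).
    apply: cvgD.
      exact: (expansion_cvg (n2_ge0 z) (@near_dist2_le _ S' z) (expansion_fst_within S' z)).
    apply: (cont_comp cc SI') => // w _.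
    exact: (expansion_cvg (n2_ge0 w) (@near_dist2_le _ S' w) (expansion_snd_within S' w)).
  exact: (expansion_cvg (n2_ge0 z) (@near_dist2_le _ S' z) (expansion_snd_within S' z)).
move=> C; have C' := Ck_inS C; case: C => c' hc cc'.
move=> [g [H Hg Hh]].
exists (fun q z => c' z.2 * h q.+1 (z.1 + c z.2, z.2) + g q (z.1 + c z.2, z.2)).
split; last exact: IH Hh.
  set S' := [set _ | _].
  move=> q z qk Sz; have Iz := SI _ Sz.
  have hz : \forall w \near within S' (nbhs z), I w.2.
    by rewrite near_withinE; near=> w => /SI.
  have dc : expansion (within S' (nbhs z)) (fun w => `|w.1 - z.1| + `|w.2 - z.2|)
      (fun w => c w.2) (c z.2) (fun w => c' z.2 * (w.2 - z.2)).
    exact: (expansion_hd (n2_ge0 z) (@near_dist2_le _ S' z) (hc _ Iz)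
      (expansion_snd_within S' z) hz).
  have hS : \forall w \near within S' (nbhs z), S (w.1 + c w.2, w.2).
    by rewrite near_withinE; near=> w.
  apply: (expansion_eq (expansion_fr (n2_ge0 z) (@near_dist2_le _ S' z) (H q _ qk Sz)
    (expansionD (expansion_fst_within S' z) dc) (expansion_snd_within S' z) hS)) => // w /=; ring.
apply: (IH (fun q z => c' z.2 * h q.+1 z + g q z)) => //.
by apply: Ck_jetD => //; apply: Ck_jet_scale SI cc' Hh.
Unshelve. all: by end_near. Qed.

Lemma Ck_in_jet_comp I S k (u : R -> R) h : (forall a, I a -> S (u a, a)) ->
  Ck_in I k u -> Ck_jet S k h -> Ck_in I k (fun a => h 0%N (u a, a)).
Proof.
move=> uS; elim: k h => [|k IH] h.
  move=> cu ch; apply: (cont_comp ch uS) => a Ia.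
  apply: (cvg_pair (G := nbhs (u a)) (H := nbhs a)); first exact: cu.
  exact: cvg_within.
move=> C; have C' := Ck_inS C; case: C => u' hu cu' [g [H Hg Hh]].
exists (fun a => u' a * h 1%N (u a, a) + g 0%N (u a, a)); last first.
  by apply: Ck_inD; [apply: Ck_inM => //; exact: IH Hh | exact: IH].
move=> a Ia.
have hS : \forall b \near within I (nbhs a), S (u b, b).
  by rewrite near_withinE; near=> b; exact: uS.
have N0 (y : R) : 0 <= `|y - a| by [].
apply: (expansion_eq (expansion_fr N0 (@near_dist_le _ I a) (H 0%N _ isT (uS _ Ia)) (hu a Ia)
  (expansion_id_within I a) hS)) => // w /=; ring.
Unshelve. all: by end_near. Qed.

(** * Gluing along the curves u = j L(a) *)

Section Gluing.
Variables (I : set R) (L : R -> R).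
Hypothesis L_gt0 : forall a, I a -> 0 < L a.
Hypothesis L_cont : cont I L.

Definition strip : set (R * R) := [set z | I z.2].
Definition piece (j : int) : set (R * R) :=
  [set z | I z.2 /\ j%:~R * L z.2 <= z.1 <= (j + 1)%:~R * L z.2].

Lemma strip_pos (c : R) z : strip z -> c * L z.2 < z.1 ->
  \forall w \near within strip (nbhs z), c * L w.2 < w.1.
Proof.
move=> Iz cz.
have h1 : (fun w : R * R => w.1 - c * L w.2) @ within strip (nbhs z) --> z.1 - c * L z.2.
  apply: cvgB.
    exact: (expansion_cvg (n2_ge0 z) (@near_dist2_le _ strip z) (expansion_fst_within strip z)).
  apply: cvgM; first exact: cvg_cst.
  apply: (cont_comp L_cont (A := strip)) => // w _.
  exact: (expansion_cvg (n2_ge0 w) (@near_dist2_le _ strip w) (expansion_snd_within strip w)).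
have h0 : 0 < z.1 - c * L z.2 by rewrite subr_gt0.
have : \forall w \near within strip (nbhs z), 0 < w.1 - c * L w.2.
  exact: (cvgr_gt _ h1 _ h0).
by apply: filterS => w; rewrite subr_gt0.
Qed.

Lemma strip_neg (c : R) z : strip z -> z.1 < c * L z.2 ->
  \forall w \near within strip (nbhs z), w.1 < c * L w.2.
Proof.
move=> Iz cz.
have h1 : (fun w : R * R => c * L w.2 - w.1) @ within strip (nbhs z) --> c * L z.2 - z.1.
  apply: cvgB; last first.
    exact: (expansion_cvg (n2_ge0 z) (@near_dist2_le _ strip z) (expansion_fst_within strip z)).
  apply: cvgM; first exact: cvg_cst.
  apply: (cont_comp L_cont (A := strip)) => // w _.
  exact: (expansion_cvg (n2_ge0 w) (@near_dist2_le _ strip w) (expansion_snd_within strip w)).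
have h0 : 0 < c * L z.2 - z.1 by rewrite subr_gt0.
have : \forall w \near within strip (nbhs z), 0 < c * L w.2 - w.1.
  exact: (cvgr_gt _ h1 _ h0).
by apply: filterS => w; rewrite subr_gt0.
Qed.

Lemma floor_piece z : strip z -> piece (Num.floor (z.1 / L z.2)) z.
Proof.
move=> Iz; split=> //; have L0 := L_gt0 Iz.
rewrite -ler_pdivlMr // floor_le /= -ler_pdivrMr //.
by apply: ltW; exact: floorD1_gt.
Qed.

(** As [L] is continuous, a piece that misses [z] misses a neighbourhood of [z], and the piece
    selected by the floor covers a neighbourhood together with its two neighbours. Only finitely
    many local conditions are thus combined. *)
Lemma strip_near z (P : R * R -> Prop) : strip z ->
  (forall j, piece j z -> \forall w \near within (piece j) (nbhs z), P w) ->
  \forall w \near within strip (nbhs z), P w.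
Proof.
move=> Iz hP.
have {}hP j : \forall w \near within strip (nbhs z), piece j w -> P w.
  have [pz|npz] := pselect (piece j z).
    have := hP j pz; rewrite !near_withinE; apply: filterS => w h _; exact: h.
  have [h|h] := leP (j%:~R * L z.2) z.1.
    have h' : (j + 1)%:~R * L z.2 < z.1.
      by rewrite ltNge; apply/negP => h'; apply: npz; split; rewrite //= h.
    have := strip_pos Iz h'; apply: filterS => w hw [_ /andP[_ hw']].
    by move: hw; rewrite ltNge hw'.
  have := strip_neg Iz h; apply: filterS => w hw [_ /andP[hw' _]].
  by move: hw; rewrite ltNge hw'.
have [_ /andP[f1 f2]] := floor_piece Iz.
set j := Num.floor _ in f1 f2; have L0 := L_gt0 Iz.
have h1 : (j - 1)%:~R * L z.2 < z.1.
  by rewrite rmorphB /= mulrBl mul1r; lra.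
have h2 : z.1 < (j + 2)%:~R * L z.2.
  move: f2; rewrite !rmorphD /= !mulrDl; lra.
have sI : \forall w \near within strip (nbhs z), strip w.
  by rewrite near_withinE; near=> w.
near=> w.
have Iw : strip w by near: w.
have g1 : (j - 1)%:~R * L w.2 < w.1 by near: w; exact: strip_pos.
have g2 : w.1 < (j + 2)%:~R * L w.2 by near: w; exact: strip_neg.
have p1 : piece (j - 1) w -> P w by near: w; exact: hP.
have p2 : piece j w -> P w by near: w; exact: hP.
have p3 : piece (j + 1) w -> P w by near: w; exact: hP.
have [k1|k1] := leP (w.1) (j%:~R * L w.2).
  by apply: p1; split=> //=; rewrite (ltW g1) subrK.
have [k2|k2] := leP (w.1) ((j + 1)%:~R * L w.2).
  by apply: p2; split=> //=; rewrite (ltW k1).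
by apply: p3; split=> //=; rewrite (ltW k2) -addrA ltW.
Unshelve. all: by end_near. Qed.

Lemma cont_glue (f : R * R -> R) : (forall j, cont (piece j) f) -> cont strip f.
Proof.
move=> H z Iz; apply/cvgrPdist_le => e e0.
apply: strip_near => // j pz.
by have /cvgrPdist_le := H j z pz; apply.
Qed.

Variable L' : R -> R.
Hypothesis L_hd : forall a, I a -> deriv_in I L a (L' a).
Hypothesis I_acc : forall a, I a ->
  forall d, 0 < d -> exists y, [/\ I y, y != a & `|y - a| < d].

(** The derivatives in u are common to all pieces, but each piece brings its own witness for the
    derivative in [a]. On a shared curve the total derivative along the curve is intrinsic, and so
    is its u-part; the a-parts must therefore agree. *)
Lemma Ck_jet_glue k h : (forall j, Ck_jet (piece j) k h) -> Ck_jet strip k h.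
Proof.
elim: k h => [|k IH] h H.
  exact: cont_glue.
have [G HG] := choice H.
pose g q z := G (Num.floor (z.1 / L z.2)) q z.
(* The curve u = (j + 1) L(a) lies in both pieces: differentiate [h q] along it. *)
have match_ j q a : (q <= k)%N -> I a ->
    G j q ((j + 1)%:~R * L a, a) = G (j + 1) q ((j + 1)%:~R * L a, a).
  move=> qk Ia; set u := fun b => (j + 1)%:~R * L b.
  have du : deriv_in I u a ((j + 1)%:~R * L' a).
    by apply: (expansion_eq (expansionZ (j + 1)%:~R (L_hd Ia))) => // b; rewrite mulrA.
  have N0 (y : R) : 0 <= `|y - a| by [].
  have p1 b : I b -> piece j (u b, b).
    move=> Ib; split=> //=; rewrite lexx andbT; apply: ler_wpM2r; first exact/ltW/L_gt0.
    by rewrite ler_int lerDl.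
  have p2 b : I b -> piece (j + 1) (u b, b).
    move=> Ib; split=> //=; rewrite lexx /=; apply: ler_wpM2r; first exact/ltW/L_gt0.
    by rewrite ler_int lerDl.
  have e1 : deriv_in I (fun b => h q (u b, b)) a
      ((j + 1)%:~R * L' a * h q.+1 (u a, a) + G j q (u a, a)).
    have hS : \forall b \near within I (nbhs a), piece j (u b, b).
      by rewrite near_withinE; near=> b; exact: p1.
    have [K _ _] := HG j.
    apply: (expansion_eq (expansion_fr N0 (@near_dist_le _ I a)
      (K q _ qk (p1 _ Ia)) du
      (expansion_id_within I a) hS)) => // w /=; ring.
  have e2 : deriv_in I (fun b => h q (u b, b)) a
      ((j + 1)%:~R * L' a * h q.+1 (u a, a) + G (j + 1) q (u a, a)).
    have hS : \forall b \near within I (nbhs a), piece (j + 1) (u b, b).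
      by rewrite near_withinE; near=> b; exact: p2.
    have [K _ _] := HG (j + 1).
    apply: (expansion_eq (expansion_fr N0 (@near_dist_le _ I a)
      (K q _ qk (p2 _ Ia)) du
      (expansion_id_within I a) hS)) => // w /=; ring.
  exact: addrI (deriv_in_uniq (I_acc Ia) e1 e2).
have gG j q z : (q <= k)%N -> piece j z -> G j q z = g q z.
  move=> qk [Iz /andP[z1 z2]]; rewrite /g; have L0 := L_gt0 Iz.
  move: z2; rewrite le_eqVlt => /orP[/eqP z2|z2].
    (* A point of the upper edge of piece [j] is assigned by the floor to piece [j + 1]; this is the
       case that needs [match_]. *)
    have -> : Num.floor (z.1 / L z.2) = j + 1.
      by rewrite z2 mulfK ?gt_eqF // intrKfloor.
    have zE : z = ((j + 1)%:~R * L z.2, z.2) by rewrite -z2; case: (z).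
    rewrite zE.
    exact: match_.
  have -> : Num.floor (z.1 / L z.2) = j; last by [].
  by apply/floor_def; rewrite ler_pdivlMr // z1 ltr_pdivrMr.
exists g; split.
- move=> q z qk Iz; apply/frechet_inP => e e0; apply: strip_near => // j pz.
  rewrite -(gG j) //; have [K _ _] := HG j.
  by have /frechet_inP := K q z qk pz; apply.
- apply: IH => j; have [_ K _] := HG j.
  by apply: Ck_jet_eq K => q z; exact: gG.
- by apply: IH => j; have [_ _] := HG j.
Unshelve. all: by end_near. Qed.

End Gluing.
End TwoVariables.

(** * Functions of one variable *)

Section OneVariable.
Context {R : realType}.
Implicit Types (D : set R) (f : R -> R).

Lemma cvg_shift0 (V : normedModType R) (g : R -> V) (x : R) (l : V) :
  g @ x^' --> l <-> (fun h => g (h + x)) @ 0^' --> l.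
Proof.
split=> /cvgrPdist_le H; apply/cvgrPdist_le => e /H; rewrite !near_withinE.
  move=> /nbhs_ballP[d /= d0 deriv_in]; apply/nbhs_ballP; exists d => //= h hh h0.
  apply: deriv_in; last by rewrite -subr_eq0 addrK.
  by move: hh; rewrite /ball /= sub0r opprD addrCA subrr addr0.
move=> /nbhs_ballP[d /= d0 deriv_in]; apply/nbhs_ballP; exists d => //= y hy yx.
have := deriv_in (y - x); rewrite subrK; apply; last by rewrite subr_eq0.
by move: hy; rewrite /ball /= sub0r opprB.
Qed.

Lemma has_derive_within_setT (V : normedModType R) (f : R -> V) x l :
  has_derive_within [set: R] f x l <->
  (fun h => h^-1 *: (f (h + x) - f x)) @ 0^' --> l.
Proof.
rewrite /has_derive_within.
rewrite withinET.
have -> : (fun h => h^-1 *: (f (h + x) - f x)) =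
          (fun h => ((h + x) - x)^-1 *: (f (h + x) - f x)).
  by apply/funext => h; rewrite addrK.
exact: (cvg_shift0 (fun y => (y - x)^-1 *: (f y - f x)) x l).
Qed.

Lemma has_derive_within_derive1 (V : normedModType R) (f : R -> V) x l :
  has_derive_within [set: R] f x l -> derive1 f x = l.
Proof. by move=> /has_derive_within_setT; rewrite /derive1; exact: cvg_lim. Qed.

Lemma has_derive_withinE D f x l : has_derive_within D f x l <-> deriv_in D f x l.
Proof.
have E y : y != x ->
    f y - f x - l * (y - x) = - ((l - (y - x)^-1 *: (f y - f x)) * (y - x)).
  by rewrite -subr_eq0 => yx; rewrite /GRing.scale /=; field.
split=> [/cvgrPdist_le H|/deriv_inP H].
  apply/deriv_inP => e /H; rewrite !near_withinE; apply: filterS => y h Dy.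
  have [->|yx] := eqVneq y x; first by rewrite !subrr mulr0 subr0 normr0 mulr0.
  by rewrite E // normrN normrM ler_wpM2r //; exact: h.
apply/cvgrPdist_le => e /H; rewrite !near_withinE; apply: filterS => y h yx Dy.
by move: (h Dy); rewrite E // normrN normrM ler_pM2r // normr_gt0 subr_eq0.
Qed.

Lemma has_derive_within_coord D n (f : R -> 'rV[R]_n) x l c :
  has_derive_within D f x l -> deriv_in D (fun y => f y 0 c) x (l 0 c).
Proof.
move=> H; apply/has_derive_withinE; rewrite /has_derive_within.
have cc : {for l, continuous (fun M : 'rV[R]_n => M 0 c)} by exact: coord_continuous.
have -> : (fun y => (y - x)^-1 *: (f y 0 c - f x 0 c)) =
    (fun M : 'rV[R]_n => M 0 c) \o (fun y => (y - x)^-1 *: (f y - f x)).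
  by apply/funext => y; rewrite /= !mxE.
exact: (continuous_cvg _ cc H).
Qed.

Lemma deriv_in_is_derive f x l : deriv_in [set: R] f x l <-> is_derive x 1 f l.
Proof.
have E : (fun h => h^-1 *: (f (h + x) - f x)) =
         (fun h => h^-1 *: ((f \o shift x) (h *: (1 : R)) - f x)).
  by apply/funext => h; rewrite /= /GRing.scale /= mulr1.
rewrite -has_derive_withinE has_derive_within_setT E; split=> H.
  by apply: DeriveDef; [apply/cvg_ex; exists l | exact: cvg_lim].
by case: H => d <-; exact: d.
Qed.

Lemma deriv_in_interior D f x l : nbhs x D -> deriv_in D f x l -> deriv_in [set: R] f x l.
Proof.
move=> nD /deriv_inP H; apply/deriv_inP => e /H; rewrite !near_withinE => h.
by apply: filterS2 nD h => y Dy h _; exact: h.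
Qed.

Lemma deriv_in_mvt_le D f f' x y c e : x <= y -> (forall s, x <= s <= y -> D s) ->
  (forall s, x <= s <= y -> deriv_in D f s (f' s)) ->
  (forall s, x <= s <= y -> `|f' s - c| <= e) ->
  `|f y - f x - c * (y - x)| <= e * `|y - x|.
Proof.
move=> xy hD hf hb.
have [||s] := @MVT_segment R f f' x y xy.
- move=> s; rewrite in_itv /= => /andP[xs sy].
  apply/deriv_in_is_derive; apply: (@deriv_in_interior `[x, y]%classic).
    have : s \in `]x, y[ by rewrite in_itv /= xs.
    move=> /near_in_itvoo; apply: filterS => t; rewrite /= !in_itv /= => /andP[? ?].
    by rewrite !ltW.
  apply: deriv_in_sub (hf s _) => [t|]; last by rewrite !ltW.
  by rewrite /= in_itv /= => /hD.
- apply/contP => s; rewrite /= in_itv /= => hs.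
  apply: (@deriv_in_cvg _ _ _ _ (f' s)); apply: deriv_in_sub (hf s hs) => t.
  by rewrite /= in_itv /= => /hD.
rewrite in_itv /= => hs ->; rewrite -mulrBl normrM ler_wpM2r //; exact: hb.
Qed.

Lemma deriv_in_mvt D f f' x y c e : (forall s, Num.min x y <= s <= Num.max x y -> D s) ->
  (forall s, Num.min x y <= s <= Num.max x y -> deriv_in D f s (f' s)) ->
  (forall s, Num.min x y <= s <= Num.max x y -> `|f' s - c| <= e) ->
  `|f y - f x - c * (y - x)| <= e * `|y - x|.
Proof.
have [xy|yx] := leP x y; first exact: deriv_in_mvt_le.
move=> h1 h2 h3; have := deriv_in_mvt_le (ltW yx) h1 h2 h3.
have -> : f y - f x - c * (y - x) = - (f x - f y - c * (x - y)) by ring.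
by rewrite normrN (distrC y x).
Qed.

Lemma Ck_in_Ck_on D k f : Ck_in D k f -> Ck_on D k f.
Proof.
elim: k f => [|k IH] f.
  move=> cf; exists (fun=> f); split=> // j.
  by rewrite leqn0 => /eqP _; apply/contP.
move=> H; have cf := Ck_in_cont H; case: H => f' hf /IH [F [F0 F1 F2]].
exists (fun j => if j is j'.+1 then F j' else f); split=> //.
  move=> [|j] x /= jk Dx; last exact: F1.
  by rewrite F0 //; apply/has_derive_withinE; exact: hf.
by move=> [|j] jk; [apply/contP|exact: F2].
Qed.

Lemma deriv_in_inv (x : R) : x != 0 -> deriv_in [set: R] (fun y => y^-1) x (- x ^- 2).
Proof.
move=> x0; apply/deriv_in_is_derive.
have := @is_deriveV _ id x 1 1 x0 (is_derive_id _ _).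
by rewrite /GRing.scale /= mulr1.
Qed.

Lemma deriv_in_sqrt (x : R) : 0 < x -> deriv_in [set: R] Num.sqrt x (2 * Num.sqrt x)^-1.
Proof. by move=> x0; apply/deriv_in_is_derive; exact: is_derive1_sqrt. Qed.

Section DifComp.
Context {T : Type} (Fl : set_system T) {FF : Filter Fl} (N : T -> R).
Hypothesis N_ge0 : forall t, 0 <= N t.
Hypothesis N_to0 : forall e, 0 < e -> \forall t \near Fl, N t <= e.

Lemma expansionV X x dX : x != 0 -> expansion Fl N X x dX ->
  expansion Fl N (fun t => (X t)^-1) x^-1 (fun t => - x ^- 2 * dX t).
Proof.
move=> x0 hX; apply: (expansion_hd N_ge0 N_to0 (deriv_in_inv x0) hX).
by near=> t.
Unshelve. all: by end_near. Qed.

Lemma expansion_sqrt X x dX : 0 < x -> expansion Fl N X x dX ->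
  expansion Fl N (fun t => Num.sqrt (X t)) (Num.sqrt x) (fun t => (2 * Num.sqrt x)^-1 * dX t).
Proof.
move=> x0 hX; apply: (expansion_hd N_ge0 N_to0 (deriv_in_sqrt x0) hX).
by near=> t.
Unshelve. all: by end_near. Qed.

End DifComp.

Let n1_ge0 (x : R) : forall y : R, 0 <= `|y - x|. Proof. by []. Qed.

Lemma Ck_inV D k f : (forall x, D x -> f x != 0) -> Ck_in D k f -> Ck_in D k (fun x => (f x)^-1).
Proof.
move=> f0; elim: k => [|k IH].
  by move=> cf x Dx; apply: cvgV; [exact: f0|exact: cf].
move=> H; have {}IH := IH (Ck_inS H); case: H => f' hf cf.
exists (fun x => - ((f x)^-1 * (f x)^-1) * f' x); last first.
  by apply: Ck_inM => //; apply: Ck_inN; exact: Ck_inM.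
move=> x Dx.
apply: (expansion_eq (expansionV (n1_ge0 x) (@near_dist_le _ D x) (f0 _ Dx) (hf x Dx))) => // y.
by rewrite -exprVn expr2 mulrA.
Qed.

Lemma Ck_in_sqrt D k f : (forall x, D x -> 0 < f x) -> Ck_in D k f ->
  Ck_in D k (fun x => Num.sqrt (f x)).
Proof.
move=> f0; elim: k => [|k IH].
  by move=> cf x Dx; apply: continuous_cvg (cf x Dx); exact: sqrt_continuous.
move=> H; have {}IH := IH (Ck_inS H); case: H => f' hf cf.
exists (fun x => (2 * Num.sqrt (f x))^-1 * f' x); last first.
  apply: Ck_inM => //; apply: Ck_inV; last by apply: Ck_inM => //; exact: Ck_in_cst.
  by move=> x Dx; rewrite mulf_neq0 ?gt_eqF ?sqrtr_gt0 ?f0.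
move=> x Dx.
apply: (expansion_eq (expansion_sqrt (n1_ge0 x) (@near_dist_le _ D x) (f0 _ Dx) (hf x Dx))) => // y.
by rewrite mulrA.
Qed.

Lemma ivt_cont f x y v : x <= y -> cont `[x, y] f -> f x <= v <= f y ->
  exists2 s, x <= s <= y & f s = v.
Proof.
move=> xy cf /andP[v1 v2].
have [||s] := @IVT _ f x y v xy; first exact/contP.
  by rewrite ge_min v1 le_max v2 orbT.
by rewrite in_itv /= => hs <-; exists s.
Qed.

Lemma near2_ex S (z : R * R) (P : R * R -> Prop) :
  (\forall w \near within S (nbhs z), P w) ->
  exists2 h : R, 0 < h & forall x a, `|x - z.1| <= h -> `|a - z.2| <= h ->
    S (x, a) -> P (x, a).
Proof.
rewrite near_withinE => /nbhs_ballP[d /= d0 H]; exists (d / 2); first by lra.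
move=> x a hx ha Sxa; apply: H => //; rewrite /ball /= /prod_ball /ball /=.
by split; rewrite distrC; lra.
Qed.

Lemma near1_ex S (z : R) (P : R -> Prop) :
  (\forall w \near within S (nbhs z), P w) ->
  exists2 h : R, 0 < h & forall a, `|a - z| <= h -> S a -> P a.
Proof.
rewrite near_withinE => /nbhs_ballP[d /= d0 H]; exists (d / 2); first by lra.
by move=> a ha Sxa; apply: H => //; rewrite /ball /= distrC; lra.
Qed.

Lemma near1_of_ex S (z h : R) (P : R -> Prop) : 0 < h ->
  (forall a, `|a - z| <= h -> S a -> P a) ->
  \forall w \near within S (nbhs z), P w.
Proof.
move=> h0 H; rewrite near_withinE; apply/nbhs_ballP; exists h => //= a.
by rewrite /ball /= distrC => /ltW /H.
Qed.

Lemma near2_of_ex S (z : R * R) h (P : R * R -> Prop) : 0 < h ->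
  (forall x a, `|x - z.1| <= h -> `|a - z.2| <= h -> S (x, a) -> P (x, a)) ->
  \forall w \near within S (nbhs z), P w.
Proof.
move=> h0 H; rewrite near_withinE; apply/nbhs_ballP; exists h => //= -[x a].
rewrite /ball /= /prod_ball /ball /= => -[/ltW h1 /ltW h2] Sw.
by apply: H => //; rewrite distrC.
Qed.

Lemma cont_box S (f : R * R -> R) z e : cont S f -> S z -> 0 < e ->
  exists2 h : R, 0 < h & forall x a, `|x - z.1| <= h -> `|a - z.2| <= h ->
    S (x, a) -> `|f (x, a) - f z| <= e.
Proof.
move=> cf Sz e0; have /cvgrPdist_le/(_ _ e0)/near2_ex [h h0 H] := cf z Sz.
by exists h => // x a hx ha Sxa; rewrite distrC; exact: H.
Qed.

End OneVariable.

(** * The boundary of one moving obstacle *)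

Lemma I2P (c : 'I_2) : c = 0 \/ c = 1.
Proof. by case: c => [[|[|//]] i]; [left|right]; exact/val_inj. Qed.

(* [u] and [v] are the tangents at two points on a common normal of the line
   spanned by [e]; each point lies to the left of the tangent at the other. *)
Lemma convex_touch (R : realFieldType) (e0 e1 u0 u1 v0 v1 d0 d1 d0' d1' : R) :
  e0 ^+ 2 + e1 ^+ 2 = 1 -> 0 < e0 * u0 + e1 * u1 -> 0 < e0 * v0 + e1 * v1 ->
  e0 * (d0 - d0') + e1 * (d1 - d1') = 0 ->
  0 <= u0 * (d1 - d1') - u1 * (d0 - d0') -> 0 <= v0 * (d1' - d1) - v1 * (d0' - d0) ->
  d0 - d0' = 0 /\ d1 - d1' = 0.
Proof.
move=> ee hu hv; rewrite -[d1' - d1]opprB -[d0' - d0]opprB.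
move: (d0 - d0') (d1 - d1') => {d0 d1 d0' d1'} x0 x1 p c1 c2.
pose y := e0 * x1 - e1 * x0.
have E0 : x0 = - (e1 * y).
  have -> : x0 = (e0 ^+ 2 + e1 ^+ 2) * x0 by rewrite ee mul1r.
  have -> : - (e1 * y) = - (e1 * y) + e0 * (e0 * x0 + e1 * x1) by rewrite p mulr0 addr0.
  by rewrite /y; ring.
have E1 : x1 = e0 * y.
  have -> : x1 = (e0 ^+ 2 + e1 ^+ 2) * x1 by rewrite ee mul1r.
  have -> : e0 * y = e0 * y + e1 * (e0 * x0 + e1 * x1) by rewrite p mulr0 addr0.
  by rewrite /y; ring.
have y0 : y = 0.
  apply/eqP; rewrite eq_le; apply/andP; split.
    rewrite -(pmulr_rle0 _ hv); move: c2; rewrite {1}E1 {1}E0; clear; lra.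
  by rewrite -(pmulr_rge0 _ hu); move: c1; rewrite {1}E1 {1}E0; clear; lra.
by rewrite E0 E1 y0 !mulr0 oppr0.
Qed.

Ltac lra_goal := repeat match goal with
  | H : is_true (_ <= _) |- _ => clear H
  | H : is_true (_ < _) |- _ => clear H
  | H : is_true (_ && _) |- _ => clear H
  end; lra.

Lemma dist_between (R : realDomainType) (u v w t k : R) :
  Num.min u v <= t <= Num.max u v -> `|u - w| <= k -> `|v - w| <= k -> `|t - w| <= k.
Proof.
rewrite !ler_norml ge_min le_max.
by case/andP => /orP[?|?] /orP[?|?] /andP[? ?] /andP[? ?]; apply/andP; split; lra.
Qed.

(** Here [x] and [t] are the increments of the length and of the parameter, and [G] is the increment
    of the closing point, computed once along the moving end (e x + A t) and once at the base point
    (B t). Projecting on the unit vector [e] gives x = l t up to 2d(|x| + 2|t|). Since d <= 1/4, the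
    |x| on the right is absorbed, so |x| <= 2(|l| + 1)|t|, whence the factor 4(|l| + 1) + 4. *)
Lemma length_estimate (R : realFieldType) (e0 e1 A0 A1 B0 B1 G0 G1 x t d e l : R) :
  e0 ^+ 2 + e1 ^+ 2 = 1 -> l = e0 * (B0 - A0) + e1 * (B1 - A1) ->
  0 < d -> d <= 1 / 4 -> d * (4 * (`|l| + 1) + 4) <= e ->
  `|G0 - (e0 * x + A0 * t)| <= d * (`|x| + `|t|) ->
  `|G1 - (e1 * x + A1 * t)| <= d * (`|x| + `|t|) ->
  `|G0 - B0 * t| <= d * `|t| -> `|G1 - B1 * t| <= d * `|t| ->
  `|x - l * t| <= e * `|t|.
Proof.
move=> ee lE d0 d4 dK H0 H1 H2 H3.
have le1 (a b : R) : a ^+ 2 + b ^+ 2 = 1 -> `|a| <= 1.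
  by move=> ab; rewrite -(expr_le1 (n := 2)) // real_normK ?num_real // -ab lerDl sqr_ge0.
have l0 := le1 _ _ ee; have l1 : `|e1| <= 1 by apply: (le1 _ e0); rewrite addrC.
have M (g a b v : R) : `|v| <= 1 -> `|g - (v * x + a * t)| <= d * (`|x| + `|t|) ->
    `|g - b * t| <= d * `|t| ->
    `|v * (v * x - (b - a) * t)| <= d * (`|x| + 2 * `|t|).
  move=> v1 h1 h2; have -> : v * x - (b - a) * t = (g - b * t) - (g - (v * x + a * t)) by ring.
  rewrite normrM -[leRHS]mul1r ler_pM //.
  apply: (le_trans (ler_normB _ _)); lra.
have {}H0 := M _ _ _ _ l0 H0 H2; have {}H1 := M _ _ _ _ l1 H1 H3.
have E : `|x - l * t| <= 2 * d * (`|x| + 2 * `|t|).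
  have -> : x - l * t = e0 * (e0 * x - (B0 - A0) * t) + e1 * (e1 * x - (B1 - A1) * t).
    have -> : x - l * t = (e0 ^+ 2 + e1 ^+ 2) * x - l * t by rewrite ee mul1r.
    by rewrite lE; ring.
  apply: (le_trans (ler_normD _ _)); lra.
have xb : `|x| <= `|x - l * t| + `|l| * `|t|.
  by rewrite -normrM -{1}(subrK (l * t) x) ler_normD.
have X0 := normr_ge0 x; have T0 := normr_ge0 t; have L0 := normr_ge0 l.
have dx : d * `|x| <= 1 / 4 * `|x| by rewrite ler_wpM2r.
have dt : d * `|t| <= 1 / 4 * `|t| by rewrite ler_wpM2r.
have xK : `|x| <= 2 * (`|l| + 1) * `|t|.
  move: E xb dx dt; rewrite !(mulrDr, mulrDl); lra.
have : d * (4 * (`|l| + 1) + 4) * `|t| <= e * `|t| by rewrite ler_wpM2r.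
have : d * `|x| <= d * (2 * (`|l| + 1) * `|t|) by rewrite ler_wpM2l // ltW.
by move: E; rewrite !(mulrDr, mulrDl); lra.
Qed.

Lemma between_l (R : realDomainType) (a b s t : R) :
  Num.min a b <= s <= Num.max a b -> Num.min a s <= t <= Num.max a s ->
  Num.min a b <= t <= Num.max a b.
Proof.
move=> /andP[s1 s2] /andP[t1 t2]; apply/andP; split.
  by apply: le_trans t1; rewrite le_min s1 ge_min lexx.
by apply: (le_trans t2); rewrite ge_max s2 le_max lexx.
Qed.

Lemma between_r (R : realDomainType) (a b s t : R) :
  Num.min a b <= s <= Num.max a b -> Num.min s b <= t <= Num.max s b ->
  Num.min a b <= t <= Num.max a b.
Proof.
move=> /andP[s1 s2] /andP[t1 t2]; apply/andP; split.
  by apply: le_trans t1; rewrite le_min s1 ge_min lexx orbT.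
by apply: (le_trans t2); rewrite ge_max s2 le_max lexx orbT.
Qed.

Section Oval.
Context {R : realType}.
Variables (I : set R) (L : R -> R) (r r' : nat).
(** [F c q q'] stands for coordinate [c] of a mixed partial on the fundamental domain, and [X c q]
    for the q-th derivative in u of the periodic extension. They are compared only for q' = 0, by
    [X_F]: the extension has no a-derivative to begin with. *)
Variables (F : 'I_2 -> nat -> nat -> R * R -> R) (X : 'I_2 -> nat -> R -> R -> R).
Local Notation D := [set z : R * R | I z.2 /\ 0 <= z.1 <= L z.2].

Hypothesis r_ge2 : (2 <= r)%N.
Hypothesis r'_ge1 : (1 <= r')%N.
Hypothesis I_itv : forall a b s, I a -> I b -> a <= s <= b -> I s.
Hypothesis L_gt0 : forall a, I a -> 0 < L a.
Hypothesis F_u : forall c q q' x a, (q < r)%N -> (q' <= r')%N -> D (x, a) ->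
  deriv_in [set s | D (s, a)] (fun s => F c q q' (s, a)) x (F c q.+1 q' (x, a)).
Hypothesis F_a : forall c q q' x a, (q <= r)%N -> (q' < r')%N -> D (x, a) ->
  deriv_in [set s | D (x, s)] (fun s => F c q q' (x, s)) a (F c q q'.+1 (x, a)).
Hypothesis F_cont : forall c q q', (q <= r)%N -> (q' <= r')%N -> cont D (F c q q').
Hypothesis X_F : forall c q z, (q <= r)%N -> D z -> X c q z.1 z.2 = F c q 0%N z.
Hypothesis X_per : forall c q u a, (q <= r)%N -> I a -> X c q (u + L a) a = X c q u a.
Hypothesis X_unit : forall u a, I a -> X 0 1%N u a ^+ 2 + X 1 1%N u a ^+ 2 = 1.
Hypothesis X_simple : forall u v a : R, I a -> 0 <= u < L a -> 0 <= v < L a ->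
  (forall c, X c 0%N u a = X c 0%N v a) -> u = v.
Hypothesis X_ccw : forall u v a, I a ->
  0 <= X 0 1%N u a * (X 1 0%N v a - X 1 0%N u a) - X 1 1%N u a * (X 0 0%N v a - X 0 0%N u a).

Lemma D0 a : I a -> D (0, a). Proof. by move=> Ia; split=> //=; rewrite lexx ltW ?L_gt0. Qed.
Lemma DL a : I a -> D (L a, a). Proof. by move=> Ia; split=> //=; rewrite lexx ltW ?L_gt0. Qed.

Lemma F_closed c q a : (q <= r)%N -> I a -> F c q 0%N (L a, a) = F c q 0%N (0, a).
Proof.
by move=> qr Ia; rewrite -!X_F //=; [rewrite -[L a]add0r X_per|exact: D0|exact: DL].
Qed.

Lemma F_unit z : D z -> F 0 1%N 0%N z ^+ 2 + F 1 1%N 0%N z ^+ 2 = 1.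
Proof.
by move=> Dz; have r1 : (1 <= r)%N := ltnW r_ge2; rewrite -!X_F // X_unit //; case: Dz.
Qed.

(* The component of the curve along its tangent [e] at the base point of the
   parameter [a0]: it increases at a rate close to 1 near both ends. *)
Let pr a0 q z := F 0 1%N 0%N (0, a0) * F 0 q 0%N z + F 1 1%N 0%N (0, a0) * F 1 q 0%N z.

Lemma pr_cont a0 q : (q <= r)%N -> cont D (pr a0 q).
Proof.
by move=> qr; rewrite /pr; apply: contD; (apply: contM; [move=> z _; exact: cvg_cst|exact: F_cont]).
Qed.

Lemma pr_hd a0 x a : D (x, a) ->
  deriv_in [set s | D (s, a)] (fun s => pr a0 0%N (s, a)) x (pr a0 1%N (x, a)).
Proof.
move=> Dxa; have r0 : (0 < r)%N by apply: leq_trans r_ge2.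
apply: (expansion_eq (expansionD (expansionZ (F 0 1%N 0%N (0, a0)) (F_u 0 r0 (leq0n _) Dxa))
  (expansionZ (F 1 1%N 0%N (0, a0)) (F_u 1 r0 (leq0n _) Dxa)))) => // y; rewrite /pr; ring.
Qed.

Lemma pr_mvt a0 (h c x y a : R) : 0 < h -> x <= y -> D (x, a) -> D (y, a) ->
  (forall s, x <= s <= y -> `|pr a0 1%N (s, a) - 1| <= c) ->
  `|pr a0 0%N (y, a) - pr a0 0%N (x, a) - (y - x)| <= c * (y - x).
Proof.
move=> h0 xy [Ia /= /andP[x0 _]] [_ /= /andP[_ yL]] H.
have Ds s : x <= s <= y -> D (s, a).
  by move=> /andP[xs sy]; split=> //=; rewrite (le_trans x0 xs) (le_trans sy yL).
have hf s : x <= s <= y -> deriv_in [set s | D (s, a)] (fun s => pr a0 0%N (s, a)) s (pr a0 1%N (s, a)).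
  by move=> hs; apply: pr_hd; exact: Ds.
have := @deriv_in_mvt_le R [set s | D (s, a)] _ _ x y 1 c xy Ds hf H.
by rewrite mul1r (ger0_norm (x := y - x)) // subr_ge0.
Qed.

Lemma pr_F a0 x y a b : I a0 -> (forall c, F c 0%N 0%N (x, a) = F c 0%N 0%N (y, b)) ->
  pr a0 0%N (x, a) = pr a0 0%N (y, b).
Proof. by move=> Ia0 H; rewrite /pr !H. Qed.

Lemma pr_base a0 : I a0 -> pr a0 1%N (0, a0) = 1 /\ pr a0 1%N (L a0, a0) = 1.
Proof.
move=> Ia0; have r1 : (1 <= r)%N := ltnW r_ge2.
by rewrite /pr !F_closed // -!expr2 F_unit //; exact: D0.
Qed.

(** No [l] in [0, L a0 - d] is a limit of lengths, and compactness makes this uniform. For l > 0 the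
    closing relation would pass to the limit and contradict the simplicity of the curve at [a0]. For
    l = 0 a very short curve would run forward along its tangent all the way, and could not
    close. *)
Lemma L_lsc a0 (d : R) : I a0 -> 0 < d -> \forall a \near within I (nbhs a0), L a0 - d <= L a.
Proof.
move=> Ia0 d0; have r1 : (1 <= r)%N := ltnW r_ge2.
have : \forall a \near within I (nbhs a0), (`[0, L a0 - d]%classic : set R) `<=` (fun l => L a <> l).
  apply: (proj1 (compact_near_coveringP _) (@segment_compact R 0 (L a0 - d)) R
    (within I (nbhs a0)) (fun a l => L a <> l)) => l.
  rewrite /= in_itv /= => /andP[l0 lL].
  suff [h h0 H] : exists2 h : R, 0 < h & forall l' a, `|l' - l| <= h -> `|a - a0| <= h ->
      I a -> L a <> l'.
    exists ([set l' | `|l' - l| <= h], [set a | I a /\ `|a - a0| <= h]) => /=; last first.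
      by move=> [l' a] /= [h1 [h2 h3]]; exact: H.
    split; first by have := @near_dist_le R setT l h h0; rewrite withinET.
    by apply: near1_of_ex h0 _ => a.
  have Dl : D (l, a0) by split=> //=; rewrite l0 /=; lra.
  have [l00|lp] : l = 0 \/ 0 < l by case: (ltgtP 0 l) l0 => //; [right|left].
    have [b1 _] := pr_base Ia0.
    have h2 : (0 : R) < 1 / 2 by lra.
    have [h h0 H] := cont_box (@pr_cont a0 _ r1) (D0 Ia0) h2.
    exists h => // l' a; rewrite l00 subr0 => hl' ha Ia Ll'; subst l'.
    have := @pr_mvt a0 h (1 / 2) 0 (L a) a h0 (ltW (L_gt0 Ia)) (D0 Ia) (DL Ia).
    rewrite (@pr_F a0 (L a) 0 a a) //; last by move=> c; rewrite F_closed.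
    have L0 := L_gt0 Ia; rewrite subrr sub0r normrN subr0 (ger0_norm (ltW L0)).
    move=> K; have : L a <= 1 / 2 * L a; last by lra.
    apply: K => s /andP[s0 sL]; rewrite -[X in _ - X]b1; apply: H => //=.
      by rewrite subr0 ger0_norm // (le_trans sL) // (le_trans _ hl') // ler_norm.
    by split=> //=; rewrite s0.
  have [c hc] : exists c, F c 0%N 0%N (l, a0) != F c 0%N 0%N (0, a0).
    apply/not_existsP => H; have := @X_simple l 0 a0 Ia0; rewrite l0 lexx L_gt0 //=.
    have -> : l < L a0 by lra.
    suff: forall c, X c 0%N l a0 = X c 0%N 0 a0 by move=> H0 K; have := K isT isT H0; lra.
    move=> c; have /negP := H c; rewrite negbK => /eqP.
    by rewrite -(@X_F c 0%N (l, a0)) // -(@X_F c 0%N (0, a0)) //; exact: D0.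
  (* A third of the gap: the two continuity errors together cannot bridge it. *)
  set e := `|F c 0%N 0%N (l, a0) - F c 0%N 0%N (0, a0)| / 3.
  have e0 : 0 < e by rewrite divr_gt0 // normr_gt0 subr_eq0.
  have [h h0 H] := cont_box (@F_cont c 0%N 0%N (leq0n _) (leq0n _)) Dl e0.
  have [h' h'0 H'] := cont_box (@F_cont c 0%N 0%N (leq0n _) (leq0n _)) (D0 Ia0) e0.
  exists (Num.min h h'); first by rewrite lt_min h0.
  move=> l' a; rewrite !le_min => /andP[hl1 hl2] /andP[ha1 ha2] Ia Ll'; subst l'.
  have K := H _ _ hl1 ha1 (DL Ia).
  have K' := H' 0 a; rewrite /= subrr normr0 in K'.
  have {}K' := K' (ltW h'0) ha2 (D0 Ia).
  rewrite F_closed // in K.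
  have : `|F c 0%N 0%N (l, a0) - F c 0%N 0%N (0, a0)| <= e + e; last by move: e0; rewrite /e; lra.
  rewrite -(subrKA (F c 0%N 0%N (0, a))) (le_trans (ler_normD _ _)) //.
  by rewrite lerD // distrC.
have IaN : \forall a \near within I (nbhs a0), I a by exact: withinT.
apply: filterS2 IaN => a Ia H; rewrite leNgt; apply/negP => La.
apply: (H (L a)) => //=; rewrite in_itv /= !ltW ?L_gt0 //.
Qed.

(* If the curve for a parameter near [a0] were longer by [d], it would retrace
   its beginning after one turn: two of its points would have the same component
   along [e], hence coincide by [convex_touch]. *)
Lemma L_usc a0 (d : R) : I a0 -> 0 < d -> \forall a \near within I (nbhs a0), L a <= L a0 + d.
Proof.
move=> Ia0 d0; have r1 : (1 <= r)%N := ltnW r_ge2; have L0 := L_gt0 Ia0.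
have [b1 b2] := pr_base Ia0.
have h2 : (0 : R) < 1 / 2 by lra.
have [h1 h10 H1] := cont_box (@pr_cont a0 _ r1) (D0 Ia0) h2.
have [h1' h1'0 H1'] := cont_box (@pr_cont a0 _ r1) (DL Ia0) h2.
(* On the windows [0, h] and [L a0, L a0 + h] the projected speed is within 1/2 of 1; the bounds by
   [L a0 / 2] and [d] keep the windows disjoint and inside one period of the longer curve. *)
pose h := Num.min (Num.min h1 h1') (Num.min d (L a0 / 2)).
have h0 : 0 < h by rewrite /h !lt_min h10 h1'0 d0 /= divr_gt0.
have [hh1 hh1' hd_ hL] : [/\ h <= h1, h <= h1', h <= d & h <= L a0 / 2].
  by split; rewrite /h !ge_min ?lexx ?orbT.
(* Both windows start within h/8 of the same projected value and advance by at least h/2, so the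
   projected ranges overlap. *)
have h8 : 0 < h / 8 by lra.
have [k k0 K] := cont_box (@pr_cont a0 _ (leq0n r)) (D0 Ia0) h8.
have [k' k'0 K'] := cont_box (@pr_cont a0 _ (leq0n r)) (DL Ia0) h8.
pose kk := Num.min (Num.min k k') h.
have kk0 : 0 < kk by rewrite /kk lt_min h0 lt_min k0 k'0.
have m1 (x y : R) : Num.min x y <= x by rewrite ge_min lexx.
have m2 (x y : R) : Num.min x y <= y by rewrite ge_min lexx orbT.
have [kk1 kk2 kk3] : [/\ kk <= k, kk <= k' & kk <= h].
  by split; [exact: le_trans (m1 _ _) (m1 _ _)|exact: le_trans (m1 _ _) (m2 _ _)|exact: m2].
apply: (near1_of_ex kk0) => a ha Ia; rewrite leNgt; apply/negP => La.
have Dl s : 0 <= s <= h -> D (s, a).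
  move=> /andP[s0 sh]; split=> //=; rewrite s0 /=.
  by move: sh hL L0 La d0; lra_goal.
have Dr s : L a0 <= s <= L a0 + h -> D (s, a).
  move=> /andP[s0 sh]; split=> //=.
  by move: s0 sh hd_ L0 La; lra_goal.
have T1 s : 0 <= s <= h -> `|pr a0 1%N (s, a) - 1| <= 1 / 2.
  move=> hs; rewrite -[X in _ - X]b1; apply: H1; last exact: Dl.
    by move: hs hh1; move=> /andP[s0 sh] hh; rewrite /= subr0 ger0_norm //; exact: (le_trans sh hh).
  by move: ha kk3 hh1; lra_goal.
have T2 s : L a0 <= s <= L a0 + h -> `|pr a0 1%N (s, a) - 1| <= 1 / 2.
  move=> hs; rewrite -[X in _ - X]b2; apply: H1'; last exact: Dr.
    by move: hs hh1'; move=> /andP[s0 sh] hh; rewrite /= ger0_norm; move: s0 sh hh; lra_goal.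
  by move: ha kk3 hh1'; lra_goal.
have hl : L a0 <= L a0 <= L a0 + h by rewrite lexx lerDl ltW.
have hr : L a0 <= L a0 + h <= L a0 + h by rewrite lexx andbT lerDl ltW.
have A0 : `|pr a0 0%N (0, a) - pr a0 0%N (0, a0)| <= h / 8.
  by apply: K; [rewrite /= subrr normr0 ltW|exact: le_trans ha kk1|exact: D0].
have B0 : `|pr a0 0%N (L a0, a) - pr a0 0%N (0, a0)| <= h / 8.
  have <- : pr a0 0%N (L a0, a0) = pr a0 0%N (0, a0).
    by apply: pr_F => // c; exact: F_closed.
  by apply: K'; [rewrite /= subrr normr0 ltW|exact: le_trans ha kk2|exact: Dr].
have A1 : `|pr a0 0%N (h, a) - pr a0 0%N (0, a) - (h - 0)| <= 1 / 2 * (h - 0).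
  by apply: (pr_mvt h0) => //; [exact: ltW|apply: Dl; rewrite lexx ltW|apply: Dl; rewrite lexx ltW].
have B1 : `|pr a0 0%N (L a0 + h, a) - pr a0 0%N (L a0, a) - (L a0 + h - L a0)|
    <= 1 / 2 * (L a0 + h - L a0).
  by apply: (pr_mvt h0) => //; [rewrite lerDl ltW|exact: Dr|exact: Dr].
rewrite !ler_norml in A0 B0 A1 B1.
have cp x y : (forall s, x <= s <= y -> D (s, a)) -> cont `[x, y] (fun s => pr a0 0%N (s, a)).
  move=> Dxy s; rewrite /= in_itv /= => hs.
  apply: (@deriv_in_cvg _ _ _ _ (pr a0 1%N (s, a))).
  apply: (deriv_in_sub _ (pr_hd a0 (Dxy s hs))) => t.
  by rewrite /= in_itv /= => /Dxy.
(* The smaller of the two final values is reached on the other window, by the intermediate value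
   theorem. *)
have [s [t [hs ht st]]] : exists s t, [/\ 0 <= s <= h, L a0 <= t <= L a0 + h &
    pr a0 0%N (s, a) = pr a0 0%N (t, a)].
  have [le|lt] := leP (pr a0 0%N (L a0 + h, a)) (pr a0 0%N (h, a)).
    have [||s hs E] := @ivt_cont _ (fun s => pr a0 0%N (s, a)) 0 h
      (pr a0 0%N (L a0 + h, a)) (ltW h0); first exact: cp.
      by rewrite le andbT; move: A0 B0 A1 B1 h0; lra_goal.
    by exists s, (L a0 + h).
  have [|||t ht E] := @ivt_cont _ (fun s => pr a0 0%N (s, a)) (L a0) (L a0 + h)
    (pr a0 0%N (h, a)); first by rewrite lerDl ltW.
  - exact: cp.
  - by rewrite (ltW lt) andbT; move: A0 B0 A1 B1 h0; lra_goal.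
  by exists h, t; split=> //; rewrite lexx ltW.
have Ts := T1 s hs; have Tt := T2 t ht; rewrite !ler_norml in Ts Tt.
have cs := @X_ccw s t a Ia; have ct := @X_ccw t s a Ia.
have Xs c q : (q <= r)%N -> X c q s a = F c q 0%N (s, a).
  by move=> qr; rewrite -X_F //=; exact: Dl.
have Xt c q : (q <= r)%N -> X c q t a = F c q 0%N (t, a).
  by move=> qr; rewrite -X_F //=; exact: Dr.
have ee := F_unit (D0 Ia0).
rewrite !Xs ?Xt // in cs ct.
have [E0 E1] : F 0 0%N 0%N (t, a) - F 0 0%N 0%N (s, a) = 0 /\
    F 1 0%N 0%N (t, a) - F 1 0%N 0%N (s, a) = 0.
  apply: (convex_touch ee _ _ _ cs ct).
  - by move: Ts; rewrite /pr; lra_goal.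
  - by move: Tt; rewrite /pr; lra_goal.
  - by move: st; rewrite /pr; lra_goal.
have E c : X c 0%N s a = X c 0%N t a.
  by rewrite Xs // Xt //; case: (I2P c) => ->; apply/esym/eqP; rewrite -subr_eq0; apply/eqP.
have : s = t.
  apply: (@X_simple s t a) => //.
    by move: hs hL L0 La d0; lra_goal.
  by move: ht hd_ La L0; lra_goal.
by move: hs ht hL L0; lra_goal.
Qed.

Lemma L_cont : cont I L.
Proof.
move=> a Ia; apply/cvgrPdist_le => e e0.
have h1 := L_lsc Ia e0; have h2 := L_usc Ia e0.
near=> b; have k1 : L a - e <= L b by near: b.
have k2 : L b <= L a + e by near: b.
by rewrite ler_norml; apply/andP; split; lra.
Unshelve. all: by end_near. Qed.

(* Two points of [D] joined inside [D] by one vertical and one horizontal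
   segment. *)
Lemma F_expand c q q' z0 e : (q < r)%N -> (q' < r')%N -> D z0 -> 0 < e ->
  exists2 h : R, 0 < h & forall x a y b, D (x, a) -> D (y, b) ->
    `|x - z0.1| <= h -> `|a - z0.2| <= h -> `|y - z0.1| <= h -> `|b - z0.2| <= h ->
    (forall s, Num.min a b <= s <= Num.max a b -> Num.min x y <= L s) ->
    `|F c q q' (y, b) - F c q q' (x, a) -
      (F c q.+1 q' z0 * (y - x) + F c q q'.+1 z0 * (b - a))|
    <= e * (`|y - x| + `|b - a|).
Proof.
move=> qr qr' Dz0 e0.
have [h1 h10 H1] := cont_box (F_cont (c := c) qr (ltnW qr')) Dz0 e0.
have [h2 h20 H2] := cont_box (F_cont (c := c) (ltnW qr) qr') Dz0 e0.
exists (Num.min h1 h2); first by rewrite lt_min h10.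
move=> x a y b Dxa Dyb; rewrite !le_min.
move=> /andP[x1 x2] /andP[a1 a2] /andP[y1 y2] /andP[b1 b2] hL.
have [Ia /= /andP[x0 xL]] := Dxa; have [Ib /= /andP[y0 yL]] := Dyb.
have Is s : Num.min a b <= s <= Num.max a b -> I s.
  by have [_|_] := leP a b; exact: I_itv.
have horiz t u v : D (u, t) -> D (v, t) ->
    `|t - z0.2| <= h1 -> `|u - z0.1| <= h1 -> `|v - z0.1| <= h1 ->
    `|F c q q' (v, t) - F c q q' (u, t) - F c q.+1 q' z0 * (v - u)| <= e * `|v - u|.
  move=> [It /= /andP[u0 uL]] [_ /= /andP[v0 vL]] ht hu hv.
  have Ds s : Num.min u v <= s <= Num.max u v -> D (s, t).
    rewrite ge_min le_max => /andP[s1 s2]; split=> //=; apply/andP; split.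
      by case/orP: s1 => s1; [exact: le_trans u0 s1|exact: le_trans v0 s1].
    by case/orP: s2 => s2; [exact: le_trans s2 uL|exact: le_trans s2 vL].
  apply: (deriv_in_mvt (D := [set s | D (s, t)]) (f := fun s => F c q q' (s, t))
    (f' := fun s => F c q.+1 q' (s, t))) => s hs; first exact: Ds.
    by apply: F_u (Ds _ hs) => //; exact: ltnW.
  by apply: H1 (Ds _ hs) => //=; exact: dist_between hs _ _.
have vert u : 0 <= u <= Num.min x y -> `|u - z0.1| <= h2 ->
    `|F c q q' (u, b) - F c q q' (u, a) - F c q q'.+1 z0 * (b - a)| <= e * `|b - a|.
  move=> /andP[u0 uxy] hu.
  have Ds s : Num.min a b <= s <= Num.max a b -> D (u, s).
    by move=> hs; split=> /=; [exact: Is|rewrite u0 (le_trans uxy) // hL].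
  apply: (deriv_in_mvt (D := [set s | D (u, s)]) (f := fun s => F c q q' (u, s))
    (f' := fun s => F c q q'.+1 (u, s))) => s hs; first exact: Ds.
    by apply: F_a (Ds _ hs) => //; exact: ltnW.
  by apply: H2 (Ds _ hs) => //=; exact: dist_between hs _ _.
(* The vertical segment is put at the smaller of the two abscissas, where the last premise keeps it
   below [L]. *)
have [xy|yx] := leP x y.
  have Dxb : D (x, b) by split=> //=; rewrite x0 (le_trans xy).
  have V : `|F c q q' (x, b) - F c q q' (x, a) - F c q q'.+1 z0 * (b - a)| <= e * `|b - a|.
    by apply: vert => //; rewrite x0 le_min lexx.
  have H := horiz b x y Dxb Dyb b1 x1 y1.
  have -> : F c q q' (y, b) - F c q q' (x, a) -
      (F c q.+1 q' z0 * (y - x) + F c q q'.+1 z0 * (b - a)) =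
    (F c q q' (y, b) - F c q q' (x, b) - F c q.+1 q' z0 * (y - x)) +
    (F c q q' (x, b) - F c q q' (x, a) - F c q q'.+1 z0 * (b - a)) by ring.
  by apply: (le_trans (ler_normD _ _)); rewrite [e * _]mulrDr lerD.
have Dya : D (y, a) by split=> //=; rewrite y0 (le_trans (ltW yx)).
have V : `|F c q q' (y, b) - F c q q' (y, a) - F c q q'.+1 z0 * (b - a)| <= e * `|b - a|.
  by apply: vert => //; rewrite y0 le_min lexx ltW.
have H := horiz a x y Dxa Dya a1 x1 y1.
have -> : F c q q' (y, b) - F c q q' (x, a) -
      (F c q.+1 q' z0 * (y - x) + F c q q'.+1 z0 * (b - a)) =
    (F c q q' (y, a) - F c q q' (x, a) - F c q.+1 q' z0 * (y - x)) +
    (F c q q' (y, b) - F c q q' (y, a) - F c q q'.+1 z0 * (b - a)) by ring.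
by apply: (le_trans (ler_normD _ _)); rewrite [e * _]mulrDr lerD.
Qed.

(** Differentiating phi(L(a), a) = phi(0, a) gives L' phi_u + phi_a(L(a), a) = phi_a(0, a); this is
    its scalar product with the unit tangent phi_u at the base point. *)
Let L' a := \sum_(c < 2) F c 1%N 0%N (0, a) * (F c 0%N 1%N (0, a) - F c 0%N 1%N (L a, a)).

(** The increments of phi(0, a) and of phi(L(a), a) coincide. The first is expanded at (0, a0), the
    second at (L a0, a0), and [length_estimate] solves for the increment of [L]. The last premise
    keeps the path of [F_expand] inside the domain. *)
Lemma L_expand a0 e : I a0 -> 0 < e ->
  exists2 h : R, 0 < h & forall a b, I a -> I b ->
    `|a - a0| <= h -> `|b - a0| <= h ->
    (forall s, Num.min a b <= s <= Num.max a b -> Num.min (L a) (L b) <= L s) ->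
    `|L b - L a - L' a0 * (b - a)| <= e * `|b - a|.
Proof.
move=> Ia0 e0; have r0 : (0 < r)%N := ltnW r_ge2; have r1 : (1 <= r)%N := r0.
pose K := `|L' a0| + 1; have K0 : 0 < K by rewrite ltr_pwDr.
(* Both bounds are the thresholds of [length_estimate]. *)
pose d := Num.min (1 / 4) (e / (4 * K + 4)).
have d0 : 0 < d by rewrite lt_min divr_gt0 //= divr_gt0 //; lra.
have d4 : d <= 1 / 4 by rewrite /d ge_min lexx.
have dK : d * (4 * K + 4) <= e.
  by rewrite -ler_pdivlMr; [rewrite /d ge_min lexx orbT | lra].
pose ex c z0 (Dz0 : D z0) := F_expand c r0 r'_ge1 Dz0 d0.
have [h1 h10 H1] := ex 0 _ (DL Ia0); have [h2 h20 H2] := ex 1 _ (DL Ia0).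
have [h3 h30 H3] := ex 0 _ (D0 Ia0); have [h4 h40 H4] := ex 1 _ (D0 Ia0).
have [h5 [h50 k1 k2 k3 k4]] : exists h5,
    [/\ 0 < h5, h5 <= h1, h5 <= h2, h5 <= h3 & h5 <= h4].
  exists (Num.min (Num.min h1 h2) (Num.min h3 h4)).
  by split; rewrite ?lt_min ?h10 ?h20 ?h30 // !ge_min lexx ?orbT.
have /cvgrPdist_le/(_ _ h50)/near1_ex [h6 h60 H6] := L_cont Ia0.
exists (Num.min h5 h6) => [|a b Ia Ib]; first by rewrite lt_min h50.
rewrite !le_min => /andP[a5 a6] /andP[b5 b6] hL.
have La : `|L a - L a0| <= h5 by rewrite distrC; exact: H6.
have Lb : `|L b - L a0| <= h5 by rewrite distrC; exact: H6.
have zz : `|0 - 0 : R| <= h5 by rewrite subrr normr0 ltW.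
have min0 s : Num.min a b <= s <= Num.max a b -> Num.min 0 0 <= L s.
  rewrite minxx => hs; apply/ltW/L_gt0.
  by move: hs; have [_|_] := leP a b; exact: I_itv.
have := H1 _ _ _ _ (DL Ia) (DL Ib) (le_trans La k1) (le_trans a5 k1) (le_trans Lb k1)
  (le_trans b5 k1) hL.
have := H2 _ _ _ _ (DL Ia) (DL Ib) (le_trans La k2) (le_trans a5 k2) (le_trans Lb k2)
  (le_trans b5 k2) hL.
have := H3 _ _ _ _ (D0 Ia) (D0 Ib) (le_trans zz k3) (le_trans a5 k3) (le_trans zz k3)
  (le_trans b5 k3) min0.
have := H4 _ _ _ _ (D0 Ia) (D0 Ib) (le_trans zz k4) (le_trans a5 k4) (le_trans zz k4)
  (le_trans b5 k4) min0.
rewrite !F_closed // subrr !mulr0 !add0r normr0 !add0r.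
rewrite ?[0 + _]add0r => G1 G0 E1 E0.
apply: (length_estimate (F_unit (D0 Ia0)) _ d0 d4 dK E0 E1 G0 G1).
by rewrite /L' big_ord_recl big_ord1 [lift _ _](_ : _ = 1) //; exact/val_inj.
Qed.

(* The slices of [D] need not be intervals, so the path from (L a0, a0) to
   (L a, a) goes through a point where [L] is minimal between [a0] and [a]. *)
Lemma L_hd a0 : I a0 -> deriv_in I L a0 (L' a0).
Proof.
move=> Ia0; apply/deriv_inP => e e0.
have [h h0 H] := L_expand Ia0 e0.
apply: (near1_of_ex h0) => a ha Ia.
have Is s : Num.min a0 a <= s <= Num.max a0 a -> I s.
  by have [_|_] := leP a0 a; exact: I_itv.
have cL : {within `[Num.min a0 a, Num.max a0 a], continuous L}.
  by apply/contP; apply: cont_sub L_cont => s; rewrite /= in_itv /= => /Is.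
have mM : Num.min a0 a <= Num.max a0 a by rewrite ge_min !le_max lexx.
have [s] := EVT_min mM cL; rewrite in_itv /= => hs sL.
have {}sL t : Num.min a0 a <= t <= Num.max a0 a -> L s <= L t.
  by move=> ht; apply: sL; rewrite in_itv.
have hs' : `|s - a0| <= h by apply: dist_between hs _ _; rewrite // subrr normr0 ltW.
have K1 : `|L s - L a0 - L' a0 * (s - a0)| <= e * `|s - a0|.
  apply: H => //; [exact: Is|by rewrite subrr normr0 ltW|] => t ht.
  by rewrite ge_min sL ?orbT //; exact: between_l hs ht.
have K2 : `|L a - L s - L' a0 * (a - s)| <= e * `|a - s|.
  apply: H => //; first exact: Is.
  by move=> t ht; rewrite ge_min sL //; exact: between_r hs ht.
have -> : L a - L a0 - L' a0 * (a - a0) =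
  (L s - L a0 - L' a0 * (s - a0)) + (L a - L s - L' a0 * (a - s)) by ring.
apply: (le_trans (ler_normD _ _)).
have -> : `|a - a0| = `|s - a0| + `|a - s|.
  move: hs; have [aa|aa] := leP a0 a => /andP[s1 s2].
    by rewrite !ger0_norm ?subr_ge0 //; ring.
  by rewrite !ler0_norm ?subr_le0 //; [ring|exact: ltW].
by rewrite [e * _]mulrDr lerD.
Qed.

(** A cone below the graph of [L], under which the vertical segments of [F_fr] are placed. *)
Lemma L_lower a0 : I a0 -> exists2 h : R, 0 < h & forall s, I s -> `|s - a0| <= h ->
  L a0 - (`|L' a0| + 1) * `|s - a0| <= L s.
Proof.
move=> Ia0; have /deriv_inP /(_ 1 ltr01) /near1_ex [h h0 H] := L_hd Ia0.
exists h => // s Is /H /(_ Is); rewrite mul1r mulrDl mul1r -normrM.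
rewrite ler_norml => /andP[+ _]; have := ler_norm (- (L' a0 * (s - a0))).
rewrite normrN; lra.
Qed.

(** The detour goes from [z0] to abscissa [m] at height [a], then horizontally to the target. Its
    vertical part stays below [L] by [L_lower], and its total length is at most 2K + 2 times the
    increment, which the tolerance e / (2K + 2) compensates. *)
Lemma F_fr c q q' z0 : (q < r)%N -> (q' < r')%N -> D z0 ->
  frechet_in D (F c q q') z0 (F c q.+1 q' z0) (F c q q'.+1 z0).
Proof.
case: z0 => x0 a0 qr qr' Dz0; apply/frechet_inP => e e0.
have [Ia0 /= /andP[x00 x0L]] := Dz0.
pose K := `|L' a0| + 1; have K1 : 1 <= K by rewrite lerDr.
have [h1 h10 H1] := L_lower Ia0.
have d0 : 0 < e / (2 * K + 2) by rewrite divr_gt0 //; lra.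
have [h2 h20 H2] := F_expand c qr qr' Dz0 d0.
(* Chosen so that h3 + K h3 = h2: the abscissa [m] then stays within [h2] of [x0]. *)
pose h3 := h2 / (1 + K); have h30 : 0 < h3 by rewrite divr_gt0 //; lra.
have h3E : h3 + K * h3 = h2 by rewrite /h3; field; lra.
have K0 : 0 < K by apply: lt_le_trans K1.
have Kh3 : 0 <= K * h3 by rewrite mulr_ge0 ?ltW.
apply: (near2_of_ex (h := Num.min h1 h3)) => [|x a /=]; first by rewrite lt_min h10.
rewrite !le_min => /andP[_ x3] /andP[a1 a3] Dxa; have [Ia /= /andP[xx0 xL]] := Dxa.
(* Far enough to the left to pass under the cone of [L_lower], and cut off at 0, where positivity of
   [L] suffices. *)
pose m := Num.max 0 (Num.min x0 x - K * `|a - a0|).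
have Ka : 0 <= K * `|a - a0| by rewrite mulr_ge0 // ltW.
have m0 : 0 <= m by rewrite le_max lexx.
have mlo : Num.min x0 x - K * `|a - a0| <= m by rewrite /m le_max lexx orbT.
have mx0 : m <= x0.
  by rewrite ge_max x00 /= lerBlDr (le_trans (y := x0)) ?lerDl // ge_min lexx.
have mx : m <= x.
  by rewrite ge_max xx0 /= lerBlDr (le_trans (y := x)) ?lerDl // ge_min lexx orbT.
have lo0 : x0 - m <= `|x - x0| + K * `|a - a0|.
  move: mlo (normr_ge0 (x - x0)) (ler_norm (x0 - x)); rewrite (distrC x0).
  by have [?|?] := leP x0 x; lra_goal.
have lo1 : x - m <= `|x - x0| + K * `|a - a0|.
  move: mlo (normr_ge0 (x - x0)) (ler_norm (x - x0)).
  by have [?|?] := leP x0 x; lra_goal.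
have Is s : Num.min a0 a <= s <= Num.max a0 a -> I s.
  by have [_|_] := leP a0 a; exact: I_itv.
have mL s : Num.min a0 a <= s <= Num.max a0 a -> m <= L s.
  move=> hs; rewrite ge_max ltW ?L_gt0 //=; last exact: Is.
  have hs1 : `|s - a0| <= `|a - a0| by apply: dist_between hs _ _; rewrite // subrr normr0.
  have := H1 s (Is _ hs) (le_trans hs1 a1); rewrite -/K.
  have : K * `|s - a0| <= K * `|a - a0| by rewrite ler_wpM2l // ltW.
  have : Num.min x0 x <= x0 by rewrite ge_min lexx.
  by move: x0L; lra_goal.
have Dm : D (m, a) by split=> //=; rewrite m0 (le_trans mx).
have Kx : K * `|a - a0| <= K * h3 by rewrite ler_wpM2l // ltW.
have h32 : h3 <= h2 by move: h3E Kh3; lra_goal.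
have mh : `|m - x0| <= h2.
  by rewrite distrC ger0_norm ?subr_ge0 //; apply: (le_trans lo0); rewrite -h3E lerD.
have z1 : `|x0 - x0| <= h2 by rewrite subrr normr0 ltW.
have z2 : `|a0 - a0| <= h2 by rewrite subrr normr0 ltW.
have xh : `|x - x0| <= h2 by apply: le_trans h32.
have ah : `|a - a0| <= h2 by apply: le_trans h32.
have S1 := H2 x0 a0 m a Dz0 Dm z1 z2 mh ah.
have S2 := H2 m a x a Dm Dxa mh ah xh ah.
have {}S1 := S1 (fun s hs => eq_ind_r (fun t => t <= L s) (mL s hs) (min_r mx0)).
have {}S2 : `|F c q q' (x, a) - F c q q' (m, a) -
   (F c q.+1 q' (x0, a0) * (x - m) + F c q q'.+1 (x0, a0) * (a - a))|
   <= e / (2 * K + 2) * (`|x - m| + `|a - a|).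
  apply: S2 => s; rewrite minxx maxxx => /andP[s1 s2].
  have -> : s = a by apply/eqP; rewrite eq_le s1 s2.
  by rewrite ge_min (le_trans mx).
have -> : F c q q' (x, a) - F c q q' (x0, a0) -
   (F c q.+1 q' (x0, a0) * (x - x0) + F c q q'.+1 (x0, a0) * (a - a0)) =
   (F c q q' (m, a) - F c q q' (x0, a0) -
   (F c q.+1 q' (x0, a0) * (m - x0) + F c q q'.+1 (x0, a0) * (a - a0))) +
   (F c q q' (x, a) - F c q q' (m, a) -
   (F c q.+1 q' (x0, a0) * (x - m) + F c q q'.+1 (x0, a0) * (a - a))) by ring.
apply: (le_trans (ler_normD _ _)); apply: (le_trans (lerD S1 S2)).
rewrite subrr normr0 addr0 distrC (ger0_norm (x := x0 - m)) ?subr_ge0 //.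
rewrite (ger0_norm (x := x - m)) ?subr_ge0 // -mulrDr.
rewrite -mulrA; apply: ler_wpM2l; first exact: ltW.
rewrite ler_pdivrMl; last by move: K0; lra_goal.
have : 0 <= K * `|x - x0| by rewrite mulr_ge0 // ltW.
have := normr_ge0 (x - x0); have := normr_ge0 (a - a0).
by move: lo0 lo1 Ka; lra_goal.
Qed.

(** Each level of the jet spends one derivative in either variable, so [k] levels fit if [k]
    derivatives are left in both. The witness in [a] is the next column of [F]. *)
Lemma F_Ck_jet c k q q' : (q + k <= r)%N -> (q' + k <= r')%N ->
  Ck_jet D k (fun j => F c (q + j)%N q').
Proof.
elim: k q q' => [|k IH] q q'; first by rewrite !addn0 => qr qr'; apply: F_cont; rewrite ?addn0.
rewrite -!addSnnS => qr qr'; exists (fun j => F c (q + j)%N q'.+1); split.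
- move=> j z jk Dz; rewrite addnS; apply: F_fr => //.
    by apply: leq_trans qr; rewrite addSn ltnS leq_add2l.
  by apply: leq_trans qr'; rewrite leq_addr.
- by apply: IH => //; apply: leq_trans qr; rewrite addSn.
- have := IH q.+1 q' qr; rewrite (leq_trans _ qr') ?addSn // => /(_ isT).
  by apply: Ck_jet_eq => j z _ _; rewrite addnS.
Qed.

(** A bootstrap: L' is made of first partials of [F] along u = 0 and u = L(a), so it is as regular
    as [L] as long as these partials are. *)
Lemma L_Ck_in k : (k.+1 <= r)%N -> (k <= r')%N -> Ck_in I k L.
Proof.
elim: k => [|k IH] kr kr'; first exact: L_cont.
exists L'; first exact: L_hd.
have {}IH := IH (ltnW kr) (ltnW kr').
have r0 c : Ck_jet D k (fun j => F c (1 + j)%N 0%N).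
  by apply: F_Ck_jet => //; [apply: ltnW|apply: ltnW].
have r1 c : Ck_jet D k (fun j => F c (0 + j)%N 1%N).
  by apply: F_Ck_jet => //; apply: ltnW; apply: ltnW.
apply: Ck_in_sum => c; apply: Ck_inM; last apply: Ck_inB.
- exact: (Ck_in_jet_comp D0 (Ck_in_cst I k 0) (r0 c)).
- exact: (Ck_in_jet_comp D0 (Ck_in_cst I k 0) (r1 c)).
- exact: (Ck_in_jet_comp DL IH (r1 c)).
Qed.

Lemma X_perz c q u a (j : int) : (q <= r)%N -> I a -> X c q (u + j%:~R * L a) a = X c q u a.
Proof.
move=> qr Ia; have P n v : X c q (v + n%:R * L a) a = X c q v a.
  elim: n v => [|n IH] v; first by rewrite mul0r addr0.
  by rewrite -natr1 mulrDl mul1r addrA X_per.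
case: j => n; first exact: P.
rewrite NegzE rmorphN /= mulNr; have := P n.+1 (u - n.+1%:R * L a).
by rewrite subrK => E; exact: esym E.
Qed.

Lemma piece_D (j : int) z : piece I L j z -> D (z.1 + (- j)%:~R * L z.2, z.2).
Proof.
move=> [Iz /andP[z1 z2]]; split=> //=; rewrite rmorphN /= mulNr.
by move: z2; rewrite rmorphD /= mulrDl mul1r => z2; apply/andP; split; lra.
Qed.

Lemma X_pieces c s k j : (s + k <= r)%N -> (k <= r')%N -> Ck_in I k L ->
  Ck_jet (piece I L j) k (fun q z => X c (s + q)%N z.1 z.2).
Proof.
move=> sk kr' Lk.
have H : Ck_jet D k (fun j => F c (s + j)%N 0%N) by exact: F_Ck_jet.
have SI z : D z -> I z.2 by case.
have Cj : Ck_in I k (fun a => (- j)%:~R * L a) by apply: Ck_inM => //; exact: Ck_in_cst.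
have := Ck_jet_translate SI Cj H.
move=> /(Ck_jet_sub (fun z => @piece_D j z)).
apply: Ck_jet_eq => q z qk pz; have [Iz _] := pz.
rewrite -(X_F c (z := (z.1 + (- j)%:~R * L z.2, z.2))).
- by rewrite /= X_perz //; apply: leq_trans sk; rewrite leq_add2l.
- by apply: leq_trans sk; rewrite leq_add2l.
- exact: piece_D.
Qed.

(** Order 0 is kept apart from [X_Ck_jet], as it must also hold over an interval reduced to one
    point, where the existence of a minimizer is claimed too. *)
Lemma X_cont c : cont (strip I) (fun z => X c 0%N z.1 z.2).
Proof.
apply: (cont_glue L_gt0 L_cont) => j.
by apply: (@X_pieces c 0 0 j) => //; exact: L_cont.
Qed.

Lemma X_Ck_jet c s k : (forall a, I a ->
    forall d, 0 < d -> exists y, [/\ I y, y != a & `|y - a| < d]) ->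
  (s <= 1)%N -> (k.+1 <= r)%N -> (k <= r')%N ->
  Ck_jet (strip I) k (fun q z => X c (s + q)%N z.1 z.2).
Proof.
move=> acc s1 kr kr'; apply: (Ck_jet_glue L_gt0 L_cont L_hd acc) => j.
apply: X_pieces => //; last exact: L_Ck_in.
by apply: leq_trans kr; rewrite -add1n leq_add2r.
Qed.

End Oval.

(** * Shortest loops through convex sets *)

Section Plane.
Context {R : realType}.
Implicit Types p q w x A B : 'rV[R]_2.

Definition dot p q : R := p 0 0 * q 0 0 + p 0 1 * q 0 1.

Lemma enorm_ge0 p : 0 <= enorm p. Proof. exact: sqrtr_ge0. Qed.

Lemma enorm_sqr p : enorm p ^+ 2 = dot p p.
Proof. by rewrite sqr_sqrtr ?addr_ge0 ?sqr_ge0 // /dot !expr2. Qed.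

Lemma rV2P p q : p 0 0 = q 0 0 -> p 0 1 = q 0 1 -> p = q.
Proof. by move=> h0 h1; apply/rowP => c; case: (I2P c) => ->. Qed.

Lemma enorm_eq0 p : enorm p = 0 -> p = 0.
Proof.
move=> h; have := enorm_sqr p; rewrite h expr0n /= /dot -!expr2 => /esym/eqP.
by rewrite paddr_eq0 ?sqr_ge0 // !sqrf_eq0 => /andP[/eqP h0 /eqP h1]; apply: rV2P; rewrite mxE.
Qed.

Lemma enorm_gt0 p : p != 0 -> 0 < enorm p.
Proof.
by move=> p0; rewrite lt_def enorm_ge0 andbT; apply: contra_neq p0; exact: enorm_eq0.
Qed.

Lemma enormZ (c : R) p : enorm (c *: p) = `|c| * enorm p.
Proof. by rewrite /enorm !mxE !exprMn -mulrDr sqrtrM ?sqr_ge0 // sqrtr_sqr. Qed.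

Lemma enormN p : enorm (- p) = enorm p.
Proof. by rewrite -scaleN1r enormZ normrN1 mul1r. Qed.

Lemma dot_le p q : dot p q <= enorm p * enorm q.
Proof.
have [h|/ltW h] := leP 0 (dot p q); last by apply: (le_trans h); rewrite mulr_ge0 ?enorm_ge0.
rewrite -(ler_pXn2r (n := 2)) ?nnegrE ?mulr_ge0 ?enorm_ge0 //.
rewrite exprMn !enorm_sqr /dot -subr_ge0.
have -> : (p 0 0 * p 0 0 + p 0 1 * p 0 1) * (q 0 0 * q 0 0 + q 0 1 * q 0 1) -
  (p 0 0 * q 0 0 + p 0 1 * q 0 1) ^+ 2 = (p 0 0 * q 0 1 - p 0 1 * q 0 0) ^+ 2 by ring.
exact: sqr_ge0.
Qed.

Lemma enormD_sqr p q : enorm (p + q) ^+ 2 = enorm p ^+ 2 + enorm q ^+ 2 + 2 * dot p q.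
Proof. by rewrite !enorm_sqr /dot !mxE; ring. Qed.

Lemma ler_enormD p q : enorm (p + q) <= enorm p + enorm q.
Proof.
rewrite -(ler_pXn2r (n := 2)) ?nnegrE ?addr_ge0 ?enorm_ge0 //.
rewrite enormD_sqr sqrrD; have := dot_le p q; rewrite -mulr_natl; lra.
Qed.

Lemma enorm_conv (t : R) p q : 0 <= t <= 1 ->
  enorm ((1 - t) *: p + t *: q) <= (1 - t) * enorm p + t * enorm q.
Proof.
move=> /andP[t0 t1]; apply: (le_trans (ler_enormD _ _)).
by rewrite !enormZ !ger0_norm // subr_ge0.
Qed.

(** Equality in the triangle inequality forces p.q = |p||q|, and the square of the norm of |q|p -
    |p|q is 2|p||q|(|p||q| - p.q). *)
Lemma parallel_of_enormD p q : enorm p + enorm q <= enorm (p + q) ->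
  enorm q *: p = enorm p *: q.
Proof.
move=> h; have {h} : (enorm p + enorm q) ^+ 2 <= enorm (p + q) ^+ 2.
  by rewrite ler_pXn2r // nnegrE ?addr_ge0 ?enorm_ge0.
rewrite enormD_sqr sqrrD => h; apply/eqP; rewrite -subr_eq0; apply/eqP/enorm_eq0.
apply/eqP; rewrite -sqrf_eq0 eq_le sqr_ge0 andbT.
rewrite enormD_sqr enormN !enormZ !ger0_norm ?enorm_ge0 //.
have -> : dot (enorm q *: p) (- (enorm p *: q)) = - (enorm p * enorm q) * dot p q.
  by rewrite /dot !mxE; ring.
have pq : 0 <= enorm p * enorm q by rewrite mulr_ge0 ?enorm_ge0.
have : enorm p * enorm q * (enorm p * enorm q) <= enorm p * enorm q * dot p q.
  by rewrite ler_wpM2l //; move: h; rewrite -mulr_natl; lra.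
by rewrite !exprMn; lra.
Qed.

Lemma parallel_segment A B x : enorm (B - x) *: (x - A) = enorm (x - A) *: (B - x) ->
  exists2 t : R, 0 <= t <= 1 & x = (1 - t) *: A + t *: B.
Proof.
set a := enorm (x - A); set b := enorm (B - x) => h.
have a0 : 0 <= a := enorm_ge0 _; have b0 : 0 <= b := enorm_ge0 _.
have [z|z] := eqVneq (a + b) 0.
  exists 0; first by rewrite lexx ler01.
  have : a = 0 by lra.
  by move=> /enorm_eq0/eqP; rewrite subr_eq0 subr0 scale1r scale0r addr0 => /eqP.
have ab : 0 < a + b by rewrite lt_def z addr_ge0.
exists (a / (a + b)).
  by rewrite divr_ge0 ?addr_ge0 //= ler_pdivrMr // mul1r lerDl.
have E c : (a + b) * x 0 c = b * A 0 c + a * B 0 c.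
  have := congr1 (fun M : 'rV[R]_2 => M 0 c) h; rewrite !mxE; lra.
apply: rV2P; rewrite !mxE; apply: (mulfI z); rewrite E; field; exact: z.
Qed.

Lemma sqrt_tangent (r s : R) : 0 < r -> 0 <= s -> Num.sqrt s <= r + (s - r ^+ 2) / (2 * r).
Proof.
move=> r0 s0; have -> : r + (s - r ^+ 2) / (2 * r) = (s + r ^+ 2) / (2 * r).
  by field; rewrite gt_eqF.
rewrite ler_pdivlMr ?mulr_gt0 // -{2}(sqr_sqrtr s0).
by have := sqr_ge0 (Num.sqrt s - r); rewrite sqrrB -mulr_natl; lra.
Qed.

(** The square root lies below its tangents. This gives a one-sided expansion of the norm with an
    explicit quadratic error, sufficient for testing a minimum. *)
Lemma enorm_tangent (P w : 'rV[R]_2) (t : R) : P != 0 ->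
  enorm (P + t *: w) <= enorm P + t * ((enorm P)^-1 * dot P w)
    + t ^+ 2 * (dot w w / (2 * enorm P)).
Proof.
move=> P0; have p0 := enorm_gt0 P0.
apply: (le_trans (sqrt_tangent p0 _)); first by rewrite addr_ge0 ?sqr_ge0.
rewrite le_eqVlt; apply/orP; left; apply/eqP.
rewrite enorm_sqr /dot !mxE; field; exact: lt0r_neq0.
Qed.

Lemma nonneg_slope (x C : R) : 0 <= C ->
  (forall t, 0 < t <= 1 -> 0 <= t * x + t ^+ 2 * C) -> 0 <= x.
Proof.
move=> C0 H; rewrite leNgt; apply/negP => x0.
(* This value of t is at most 1 and satisfies t C < - x, so that t x + t^2 C is negative. *)
have t0 : 0 < - x / (C + 1 - x) by rewrite divr_gt0 //; lra.
have t1 : - x / (C + 1 - x) <= 1 by rewrite ler_pdivrMr; lra.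
have := H _ (introT andP (conj t0 t1)); set t := _ / _ in t0 *.
rewrite expr2 -mulrA -mulrDr pmulr_rge0 // => h.
have : t * C < - x.
  by rewrite /t mulrAC ltr_pdivrMr; [|lra]; rewrite ltr_pM2l; lra.
lra.
Qed.

Lemma interior_shift (S : set 'rV[R]_2) x y : S° x ->
  exists2 t : R, 0 < t < 1 & S ((1 - t) *: x + t *: y).
Proof.
move=> /nbhs_ballP[d /= d0 H].
have N0 : 0 < `|x - y| + 1 by rewrite ltr_pwDr.
exists (Num.min (1 / 2) (d / 2 / (`|x - y| + 1))).
  rewrite lt_min gt_min; apply/andP; split; last by apply/orP; left; lra.
  by rewrite divr_gt0 //= divr_gt0 // divr_gt0.
set t := Num.min _ _.
have t0 : 0 < t by rewrite lt_min !divr_gt0.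
have tN : t * (`|x - y| + 1) <= d / 2.
  by rewrite -ler_pdivlMr // /t ge_min lexx orbT.
apply: H; rewrite -ball_normE /ball_ /=.
have -> : x - ((1 - t) *: x + t *: y) = t *: (x - y).
  by rewrite scalerBl scale1r scalerBr opprD opprB addrA addrCA subrr addr0.
rewrite normrZ gtr0_norm //.
have : t * `|x - y| <= t * (`|x - y| + 1) by rewrite ler_pM2l // lerDl.
lra.
Qed.

(** Entries may lie in any pointed topological space: in [shortest_exists] they are points of the
    plane. *)
Lemma coord_cvg (T : ptopologicalType) n (v : 'rV[T]_n) l :
  (fun w : 'rV[T]_n => w 0 l) @ v --> v 0 l.
Proof.
move=> A hA; exists (fun i j => [set x | j = l -> A x]) => [i j|w hw /=].
  have [->|jl] := eqVneq j l; last by apply: filterE => x jl'; rewrite jl' eqxx in jl.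
  by rewrite (ord1 i); apply: filterS hA => x Ax _.
exact: hw.
Qed.

End Plane.

(** * Shortest closed polygons with one vertex in each set *)

Section Configurations.
Context {R : realType}.
Variables (n : nat) (K : 'I_n -> set 'rV[R]_2).
Implicit Types (p q : 'I_n -> 'rV[R]_2) (j : 'I_n).
Hypothesis ordS_neq : forall j, ordS j != j.
Hypothesis K_compact : forall j, compact (K j).
Hypothesis K_convex : forall j, strictly_convex (K j).
Hypothesis K_nonempty : forall j, K j !=set0.
(** The only form in which disjointness and no eclipse enter: a loop has no vertex on the segment
    joining its two neighbours. In particular consecutive vertices differ. *)
Hypothesis K_avoid : forall j A B x t, K (ord_pred j) A -> K (ordS j) B -> K j x ->
  0 <= t <= 1 -> x <> (1 - t) *: A + t *: B.

Definition loop_length p := \sum_(j < n) enorm (p j - p (ord_pred j)).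

Lemma loop_length_cvg (T : Type) (F : set_system T) {FF : Filter F}
    (f : T -> 'I_n -> 'rV[R]_2) p :
  (forall l c, (fun t => f t l 0 c) @ F --> p l 0 c) ->
  (fun t => loop_length (f t)) @ F --> loop_length p.
Proof.
move=> H; apply: (cvg_big (op := +%R) (P := xpredT)); first exact: add_continuous.
move=> j _.
have hc : (fun t => (f t j - f t (ord_pred j)) 0 0 ^+ 2 + (f t j - f t (ord_pred j)) 0 1 ^+ 2)
    @ F --> (p j - p (ord_pred j)) 0 0 ^+ 2 + (p j - p (ord_pred j)) 0 1 ^+ 2.
  rewrite (_ : (fun t => _) = fun t =>
    (f t j 0 0 - f t (ord_pred j) 0 0) ^+ 2 + (f t j 0 1 - f t (ord_pred j) 0 1) ^+ 2);
    last by apply/funext => t; rewrite !mxE.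
  by rewrite !mxE; apply: cvgD; apply: cvgM; apply: cvgB; exact: H.
by apply: continuous_cvg hc; exact: sqrt_continuous.
Qed.

Definition upd p j y l := if l == j then y else p l.
Definition admissible_points p := forall j, K j (p j).
Definition shortest p := admissible_points p /\
  forall q, admissible_points q -> loop_length p <= loop_length q.

Lemma pred_neq j : ord_pred j != j.
Proof. by apply/eqP => h; have := ordS_neq (ord_pred j); rewrite ord_predK h eqxx. Qed.

Lemma loop_length_upd p j y : loop_length (upd p j y) - loop_length p =
  (enorm (y - p (ord_pred j)) + enorm (p (ordS j) - y)) -
  (enorm (p j - p (ord_pred j)) + enorm (p (ordS j) - p j)).
Proof.
have dec q : loop_length q = enorm (q j - q (ord_pred j)) + (enorm (q (ordS j) - q j) +
    \sum_(l < n | (l != j) && (l != ordS j)) enorm (q l - q (ord_pred l))).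
  rewrite /loop_length (bigD1 j) //=; congr (_ + _).
  by rewrite (bigD1 (ordS j)) ?ordS_neq //= ordSK.
rewrite !dec /upd eqxx (negbTE (pred_neq j)) (negbTE (ordS_neq j)).
set S := \sum_(l < n | _) _; set S' := \sum_(l < n | _) _.
have -> : S = S'.
  apply: eq_bigr => l /andP[lj lS]; rewrite (negbTE lj).
  by case: eqP => // h; move: lS; rewrite -h ord_predK eqxx.
ring.
Qed.

Lemma segment_in j x y (t : R) : K j x -> K j y -> 0 <= t <= 1 ->
  K j ((1 - t) *: x + t *: y).
Proof.
move=> Kx Ky /andP[t0 t1].
have [<-|xy] := eqVneq x y; first by rewrite -scalerDl subrK scale1r.
have [->|t0'] := eqVneq t 0; first by rewrite subr0 scale1r scale0r addr0.
have [->|t1'] := eqVneq t 1; first by rewrite subrr scale1r scale0r add0r.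
apply: interior_subset; apply: K_convex => //.
by rewrite !lt_def t0' t0 eq_sym t1' t1.
Qed.

Lemma admissible_upd p j y : admissible_points p -> K j y -> admissible_points (upd p j y).
Proof. by move=> hp Ky l; rewrite /upd; case: eqP => // ->. Qed.

Lemma in_neq_out p j : admissible_points p ->
  p j - p (ord_pred j) != 0 /\ p (ordS j) - p j != 0.
Proof.
move=> hp; have H t := @K_avoid j _ _ _ t (hp (ord_pred j)) (hp (ordS j)) (hp j).
rewrite !subr_eq0; split; apply/eqP => h.
  by apply: (H 0); rewrite ?lexx ?ler01 // subr0 scale1r scale0r addr0.
by apply: (H 1); rewrite ?lexx ?ler01 // subrr scale1r scale0r add0r.
Qed.

Lemma no_straight p j : admissible_points p ->
  enorm (p (ordS j) - p (ord_pred j)) < enorm (p j - p (ord_pred j)) + enorm (p (ordS j) - p j).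
Proof.
move=> hp; rewrite ltNge; apply/negP => h.
have : enorm (p j - p (ord_pred j)) + enorm (p (ordS j) - p j) <=
    enorm ((p j - p (ord_pred j)) + (p (ordS j) - p j)).
  by rewrite [X in _ <= enorm X]addrC subrKA.
move=> /parallel_of_enormD/parallel_segment[t t01].
by apply: K_avoid.
Qed.

(** An interior vertex can be moved slightly towards its predecessor. The two adjacent sides then
    total at most a convex combination of their old sum and of the direct distance between the
    neighbours, which is strictly smaller by [no_straight]. *)
Lemma shortest_not_interior p j : shortest p -> ~ (K j)° (p j).
Proof.
move=> [hp hmin] hint; set A := p (ord_pred j).
have [t /andP[t0 t1] Ky] := interior_shift A hint.
have := hmin _ (admissible_upd hp Ky); rewrite -subr_ge0 loop_length_upd.
have ns := no_straight j hp.
set y := (1 - t) *: p j + t *: A; rewrite -/A.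
have h1 : enorm (y - A) = (1 - t) * enorm (p j - A).
  have -> : y - A = (1 - t) *: (p j - A).
    by apply: rV2P; rewrite /y !mxE; ring.
  by rewrite enormZ ger0_norm // subr_ge0 ltW.
have h2 : enorm (p (ordS j) - y) <= (1 - t) * enorm (p (ordS j) - p j)
    + t * enorm (p (ordS j) - A).
  have -> : p (ordS j) - y = (1 - t) *: (p (ordS j) - p j) + t *: (p (ordS j) - A).
    by apply: rV2P; rewrite /y !mxE; ring.
  by apply: enorm_conv; rewrite !ltW.
move: ns; rewrite -/A => ns.
have : t * enorm (p (ordS j) - A) < t * (enorm (p j - A) + enorm (p (ordS j) - p j)).
  by rewrite ltr_pM2l.
rewrite h1; lra.
Qed.

Lemma shortest_unique p q : shortest p -> shortest q -> p =1 q.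
Proof.
move=> hp hq j; apply/eqP; apply: contraT => pq.
pose c l := (1 - 1 / 2) *: p l + (1 / 2) *: q l.
have h01 : 0 <= (1 / 2 : R) <= 1 by lra.
have ac : admissible_points c.
  by move=> l; apply: segment_in => //; [case: hp|case: hq].
have lc : loop_length c <= loop_length p.
  have lpq : loop_length p = loop_length q.
    by apply/eqP; rewrite eq_le hp.2 ?hq.2 //; [case: hp|case: hq].
  have -> : loop_length p = (1 - 1 / 2) * loop_length p + (1 / 2) * loop_length q.
    by rewrite -lpq; ring.
  rewrite /loop_length !mulr_sumr -big_split /=; apply: ler_sum => l _.
  rewrite (_ : c l - c (ord_pred l) =
    (1 - 1 / 2) *: (p l - p (ord_pred l)) + (1 / 2) *: (q l - q (ord_pred l))); last first.
    by apply: rV2P; rewrite !mxE; ring.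
  exact: enorm_conv.
have sc : shortest c by split=> // r hr; apply: (le_trans lc); exact: hp.2.
exfalso; apply: (shortest_not_interior (j := j) sc).
apply: K_convex => //; [by case: hp|by case: hq|lra].
Qed.

(** The gradient of the loop length in the j-th vertex: incoming minus outgoing unit direction. *)
Definition bend p j := (enorm (p j - p (ord_pred j)))^-1 *: (p j - p (ord_pred j))
  - (enorm (p (ordS j) - p j))^-1 *: (p (ordS j) - p j).

Lemma bend_neq0 p j : admissible_points p -> bend p j <> 0.
Proof.
move=> hp; have [P0 Q0] := in_neq_out j hp; rewrite /bend => /eqP.
set P := p j - _ in P0 *; set Q := _ - p j in Q0 *; rewrite subr_eq0 => /eqP h.
have p0 := enorm_gt0 P0; have q0 := enorm_gt0 Q0.
have : enorm Q *: P = enorm P *: Q.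
  have := congr1 (fun v => (enorm P * enorm Q) *: v) h.
  rewrite /= !scalerA mulrAC divff ?gt_eqF // mul1r => ->.
  by rewrite mulfK ?gt_eqF.
by move=> /parallel_segment[t t01]; apply: K_avoid.
Qed.

(** First-order condition for a minimum over a convex set: moving the vertex towards [y] by a
    fraction t changes the length by at most t times this scalar product plus a term in t^2. *)
Lemma bend_ge0 p j y : shortest p -> K j y -> 0 <= dot (bend p j) (y - p j).
Proof.
move=> [hp hmin] Ky; have [P0 Q0] := in_neq_out j hp; rewrite /bend.
set P := p j - _ in P0 *; set Q := _ - p j in Q0 *; set w := y - p j.
have p0 := enorm_gt0 P0; have q0 := enorm_gt0 Q0.
have w0 : 0 <= dot w w by rewrite -enorm_sqr sqr_ge0.
apply: (@nonneg_slope _ _ (dot w w / (2 * enorm P) + dot w w / (2 * enorm Q))).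
  by rewrite addr_ge0 // divr_ge0 // mulr_ge0 // ltW.
move=> t /andP[t0 t1].
have t01 : 0 <= t <= 1 by rewrite ltW.
have Kt := segment_in (hp j) Ky t01.
have := hmin _ (admissible_upd hp Kt); rewrite -subr_ge0 loop_length_upd.
set z := (1 - t) *: p j + t *: y.
have -> : z - p (ord_pred j) = P + t *: w by apply: rV2P; rewrite /z !mxE; ring.
have -> : p (ordS j) - z = Q + t *: (- w) by apply: rV2P; rewrite /z !mxE; ring.
have h1 := enorm_tangent w t P0; have h2 := enorm_tangent (- w) t Q0.
have E1 : dot Q (- w) = - dot Q w by rewrite /dot !mxE; ring.
have E2 : dot (- w) (- w) = dot w w by rewrite /dot !mxE; ring.
have E3 : dot ((enorm P)^-1 *: P - (enorm Q)^-1 *: Q) w =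
  (enorm P)^-1 * dot P w - (enorm Q)^-1 * dot Q w by rewrite /dot !mxE; ring.
rewrite E3 E1 E2 in h1 h2 *; rewrite -/P -/Q; move: h1 h2.
by rewrite mulrN mulrDr [t * (_ - _)]mulrBr; lra.
Qed.

Lemma shortest_exists : exists p, shortest p.
Proof.
pose f (v : 'rV['rV[R]_2]_n) := loop_length (fun j => v 0 j).
have cf : continuous f.
  move=> v; apply: (@loop_length_cvg _ (nbhs v) (nbhs_filter v)
    (fun w : 'rV['rV[R]_2]_n => fun j => w 0 j)) => l c.
  have c1 : (fun w : 'rV['rV[R]_2]_n => w 0 l) @ v --> v 0 l := @coord_cvg _ _ v l.
  have c2 : (fun w : 'rV[R]_2 => w 0 c) @ v 0 l --> v 0 l 0 c by exact: coord_continuous.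
  exact: (cvg_comp _ _ c1 c2).
have [k hk] := choice (fun j => K_nonempty j).
have ne : [set v : 'rV['rV[R]_2]_n | forall i, K i (v ord0 i)] !=set0.
  by exists (\row_i k i) => i; rewrite mxE.
have [v] := compact_EVT_min ne (rV_compact K_compact) (continuous_subspaceT cf).
rewrite inE /= => hv hmin; exists (fun j => v 0 j); split=> // q hq.
have <- : loop_length (fun j => (\row_i q i : 'rV_n) 0 j) = loop_length q.
  by apply: eq_bigr => j _; rewrite !mxE.
by apply: hmin; rewrite inE /= => i; rewrite mxE.
Qed.

End Configurations.

(** * Continuous lifts from the circle to the line *)

Section Lifting.
Context {R : realType}.

Lemma contE (S : set R) (f : R -> R) : cont S f <->
  forall a e, S a -> 0 < e -> exists2 h : R, 0 < h &
    forall b, `|b - a| <= h -> S b -> `|f b - f a| <= e.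
Proof.
split=> [cf a e Sa e0|H a Sa].
  have /cvgrPdist_le/(_ _ e0)/near1_ex [h h0 H] := cf a Sa.
  by exists h => // b hb Sb; rewrite distrC; exact: H.
apply/cvgrPdist_le => e e0; have [h h0 k] := H a e Sa e0.
by apply: (near1_of_ex h0) => b hb Sb; rewrite distrC; exact: k.
Qed.

(** Real induction: the supremum of the points reached from [u] has a local window, which starts
    before a reached point and extends past the supremum, so only [w] can stop the progress. *)
Lemma interval_ind (P : R -> R -> Prop) :
  (forall u v w, u <= v -> v <= w -> P u v -> P v w -> P u w) ->
  (forall a, exists2 h : R, 0 < h & forall u v, a - h <= u -> u <= v -> v <= a + h -> P u v) ->
  forall u v, u <= v -> P u v.
Proof.
move=> Ptr Ploc u w uw.
pose A := [set v | u <= v <= w /\ P u v].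
have Au : A u.
  split; first by rewrite lexx.
  by have [h h0 H] := Ploc u; apply: H => //; rewrite ?gerBl ?lerDl ltW.
have supA : has_sup A by split; [exists u|exists w => v [/andP[]]].
have [h h0 H] := Ploc (sup A).
have [v Av vs] := sup_adherent h0 supA.
have vle : v <= sup A by apply: ub_le_sup => //; case: supA.
have [/andP[uv vw] Puv] := Av.
have [wsh|shw] := leP w (sup A + h).
  by apply: Ptr Puv _ => //; apply: H => //; exact: ltW.
have Psh : A (sup A + h).
  split; first by apply/andP; split; lra.
  by apply: Ptr Puv _; [exact: uv|lra|apply: H; lra].
have : sup A + h <= sup A by apply: ub_le_sup => //; case: supA.
lra.
Qed.

Lemma int_small (k : int) : `|k%:~R : R| < 1 -> k = 0.
Proof.
rewrite -intr_norm => h; have {h} : (`|k| < 1)%R by rewrite -(ltr_int R).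
by case: k => [[|n]|n].
Qed.

(** The fibre of [Rel] over [a] is a coset of the integers, that is, a point of the circle R/Z;
    [Rel_loc] says that this point moves continuously. *)
Variable Rel : R -> R -> Prop.
Hypothesis Rel_ex : forall a, exists x, Rel a x.
Hypothesis Rel_diff : forall a x y, Rel a x -> Rel a y -> exists k : int, y = x + k%:~R.
Hypothesis Rel_shift : forall a x (k : int), Rel a x -> Rel a (x + k%:~R).
Hypothesis Rel_loc : forall a x e, Rel a x -> 0 < e -> exists2 h : R, 0 < h &
  forall b, `|b - a| <= h -> exists2 y, Rel b y & `|y - x| <= e.

Definition lift_on (u v : R) (f : R -> R) :=
  cont [set c | u <= c <= v] f /\ forall c, u <= c <= v -> Rel c (f c).

Lemma lift_glue u v w f g : u <= v -> v <= w -> lift_on u v f -> lift_on v w g ->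
  f v = g v -> lift_on u w (fun c => if c <= v then f c else g c).
Proof.
move=> uv vw [/contE cf Rf] [/contE cg Rg] fg; split; last first.
  move=> c /andP[uc cw]; have [cv|vc] := leP c v; first by apply: Rf; rewrite uc.
  by apply: Rg; rewrite (ltW vc).
apply/contE => a e /= /andP[ua aw] e0.
have [av|va|av] := ltgtP a v.
- have Sa : u <= a <= v by rewrite ua ltW.
  have [h h0 H] := cf a e Sa e0; exists (Num.min h (v - a)) => [|b].
    by rewrite lt_min h0 subr_gt0.
  rewrite le_min => /andP[bh bv] /andP[ub bw].
  have bv' : b <= v by have := ler_norm (b - a); lra.
  by rewrite bv'; apply: H => //; rewrite /= ub.
- have Sa : v <= a <= w by rewrite aw ltW.
  have [h h0 H] := cg a e Sa e0; exists (Num.min h ((a - v) / 2)) => [|b].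
    by rewrite lt_min h0 divr_gt0 // subr_gt0.
  rewrite le_min => /andP[bh bv] /andP[ub bw].
  have bv' : v < b by have := ler_norm (a - b); rewrite distrC; lra.
  have -> : (b <= v) = false by rewrite leNgt bv'.
  by apply: H => //; rewrite /= (ltW bv').
- subst a; have Sf : u <= v <= v by rewrite uv lexx.
  have Sg : v <= v <= w by rewrite vw lexx.
  have [h h0 H] := cf v e Sf e0; have [h' h'0 H'] := cg v e Sg e0.
  exists (Num.min h h') => [|b]; first by rewrite lt_min h0.
  rewrite le_min => /andP[bh bh'] /andP[ub bw].
  have [bv|vb] := leP b v; first by apply: H => //; rewrite /= ub.
  by rewrite fg; apply: H' => //; rewrite /= (ltW vb).
Qed.

Lemma lift_shift u v f (k : int) : lift_on u v f -> lift_on u v (fun c => f c + k%:~R).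
Proof.
move=> [cf Rf]; split=> [|c /Rf]; last exact: Rel_shift.
by move=> a Sa; apply: cvgD; [exact: cf|exact: cvg_cst].
Qed.

Lemma lift_at u v f c x : lift_on u v f -> u <= c <= v -> Rel c x ->
  exists k : int, f c + k%:~R = x.
Proof. by move=> [_ Rf] /Rf fc /(Rel_diff fc) [k ->]; exists k. Qed.

(** All values are taken within 1/4 of one value over [a]. If [y] over [c] is within 1/4 of the
    value chosen over [b], it is within 3/4 of the value chosen over [c]; they differ by an integer,
    hence coincide, and any such choice is continuous. *)
Lemma lift_local a : exists2 h : R, 0 < h &
  forall u v, a - h <= u -> u <= v -> v <= a + h -> exists f, lift_on u v f.
Proof.
have [x ax] := Rel_ex a.
have q0 : 0 < 1 / 4 :> R by lra.
have [h h0 H] := Rel_loc ax q0; exists h => // u v hu uv hv.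
have ha b : u <= b <= v -> `|b - a| <= h.
  by move=> /andP[? ?]; rewrite ler_norml; apply/andP; split; lra.
have : forall b, exists y, u <= b <= v -> Rel b y /\ `|y - x| <= 1 / 4.
  (* Outside [u, v] the value 0 is a dummy. *)
  move=> b; have [hb|hb] := boolP (u <= b <= v); last by exists 0.
  by have [y h1 h2] := H b (ha _ hb); exists y.
move=> /choice [f hf]; exists f; split=> [|c /hf []//].
apply/contE => b e Sb e0; have [Rb b1] := hf b Sb.
have e4 : 0 < Num.min e (1 / 4) by rewrite lt_min e0.
have [h' h'0 H'] := Rel_loc Rb e4; exists h' => // c hc Sc.
have [y Ry] := H' c hc; rewrite le_min => /andP[y1 y2].
have [Rc c1] := hf c Sc; have [k yk] := Rel_diff Rc Ry.
suff k0 : k = 0 by move: y1; rewrite yk k0 addr0.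
apply: int_small; have -> : k%:~R = y - f c :> R by rewrite yk addrC addKr.
by move: b1 c1 y2; rewrite !ler_norml ltr_norml => /andP[? ?] /andP[? ?] /andP[? ?];
  apply/andP; split; lra.
Qed.

Lemma lift_interval u v : u <= v -> exists f, lift_on u v f.
Proof.
move: u v; apply: interval_ind lift_local => u v w uv vw [f hf] [g hg].
have Rv : Rel v (f v) by case: hf => _; apply; rewrite uv lexx.
have [k hk] := lift_at hg (introT andP (conj (lexx v) vw)) Rv.
by eexists; apply: (lift_glue uv vw hf (lift_shift k hg)); rewrite hk.
Qed.

(** Lifts on the two added unit intervals are shifted by integers to match [f], which is itself left
    unchanged: the successive extensions stay consistent. *)
Lemma lift_extend (N : nat) f : lift_on (- N%:R) N%:R f ->
  exists g, lift_on (- N.+1%:R) N.+1%:R g /\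
    forall c, - N%:R <= c <= N%:R -> g c = f c.
Proof.
move=> hf; have N0 : 0 <= N%:R :> R by exact: ler0n.
have NS : N.+1%:R = N%:R + 1 :> R by rewrite -natr1.
have l1 : - N.+1%:R <= - N%:R :> R by rewrite NS; lra.
have l2 : N%:R <= N.+1%:R :> R by rewrite NS; lra.
have l3 : - N%:R <= N%:R :> R by lra.
have [g hg] := lift_interval l1; have [g' hg'] := lift_interval l2.
have R1 : Rel (- N%:R) (f (- N%:R)) by case: hf => _; apply; rewrite lexx.
have R2 : Rel N%:R (f N%:R) by case: hf => _; apply; rewrite lexx l3.
have [k hk] := lift_at hg (introT andP (conj l1 (lexx _))) R1.
have [k' hk'] := lift_at hg' (introT andP (conj (lexx _) l2)) R2.
have G1 := lift_glue l1 l3 (lift_shift k hg) hf hk.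
have l4 : - N.+1%:R <= N%:R :> R by exact: le_trans l3.
have E c : - N%:R <= c -> (if c <= - N%:R then g c + k%:~R else f c) = f c.
  rewrite le_eqVlt => /orP[/eqP <-|h]; first by rewrite lexx hk.
  by rewrite leNgt h.
have G2 := lift_glue l4 l2 G1 (lift_shift k' hg').
eexists; split; first by apply: G2; rewrite E ?hk'.
by move=> c /andP[c1 c2]; rewrite /= c2 E.
Qed.

Lemma lift_global : exists2 f, cont setT f & forall a, Rel a (f a).
Proof.
have [f0 hf0] : exists f, lift_on (- 0%:R) 0%:R f by apply: lift_interval; rewrite oppr0.
have : forall (Nf : nat * (R -> R)), exists g, lift_on (- Nf.1%:R) Nf.1%:R Nf.2 ->
    lift_on (- Nf.1.+1%:R) Nf.1.+1%:R g /\ forall c, - Nf.1%:R <= c <= Nf.1%:R -> g c = Nf.2 c.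
  move=> [N f]; have [hf|hf] := pselect (lift_on (- N%:R) N%:R f); last by exists f.
  by have [g hg] := lift_extend hf; exists g.
move=> /choice [ext hext].
pose F := fix F N := if N is N'.+1 then ext (N', F N') else f0.
have FL N : lift_on (- N%:R) N%:R (F N).
  by elim: N => // N IH; have [] := hext (N, F N) IH.
have FS N c : - N%:R <= c <= N%:R -> F N.+1 c = F N c.
  by have [_] := hext (N, F N) (FL N); exact.
have FM N M c : (N <= M)%N -> - N%:R <= c <= N%:R -> F M c = F N c.
  move=> /subnK <-; elim: (M - N)%N => [|k IH] // hc; rewrite addSn FS ?IH //.
  have : N%:R <= (k + N)%:R :> R by rewrite ler_nat leq_addl.
  by move: hc => /andP[? ?] ?; apply/andP; split; lra.
(* Strictly above |c|, so that the window of [c] is a neighbourhood of [c]. *)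
pose nn (c : R) := (Num.truncn `|c|).+1.
have nnP c : - (nn c)%:R < c < (nn c)%:R.
  by rewrite -ltr_norml /nn truncnS_gt.
exists (fun c => F (nn c) c); last first.
  move=> a; have [_] := FL (nn a); apply.
  by have /andP[? ?] := nnP a; rewrite !ltW.
apply/contE => a e _ e0.
have /andP[a1 a2] := nnP a; set N := nn a in a1 a2 *.
have [/contE cF _] := FL N.
have [|h h0 H] := cF a e _ e0; first by rewrite /= !ltW.
pose h' := Num.min h (Num.min (a + N%:R) (N%:R - a)).
exists h' => [|b]; first by rewrite /h' !lt_min h0 subr_gt0 a2 -ltrBlDr sub0r a1.
rewrite /h' !le_min => /and3P[bh b1 b2] _.
have hb : - N%:R <= b <= N%:R.
  by move: b1 b2; rewrite !ler_norml => /andP[? ?] /andP[? ?]; apply/andP; split; lra.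
have /andP[b3 b4] := nnP b.
have -> : F (nn b) b = F N b.
  case/orP: (leq_total N (nn b)) => le; first exact: FM.
  by rewrite (FM (nn b)) // !ltW.
exact: H.
Qed.

End Lifting.

Section LiftingOnInterval.
Context {R : realType}.

(** Clamping is 1-Lipschitz. It transports lifting problems over any closed interval, bounded or
    not, possibly a single point, to the whole line. *)
Lemma param_retraction (lo hi : \bar R) a0 : param_interval lo hi a0 ->
  exists rho : R -> R, [/\ forall x, param_interval lo hi (rho x),
    forall x, param_interval lo hi x -> rho x = x &
    forall x y, `|rho x - rho y| <= `|x - y|].
Proof.
have Lmax (b x y : R) : `|Num.max b x - Num.max b y| <= `|x - y|.
  have [?|?] := leP b x; have [?|?] := leP b y; rewrite ?subrr ?normr0 //.
    by rewrite ger0_norm; [apply: le_trans (ler_norm _)|]; lra.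
  by rewrite ler0_norm; [rewrite distrC; apply: le_trans (ler_norm _)|]; lra.
have Lmin (b x y : R) : `|Num.min b x - Num.min b y| <= `|x - y|.
  have [?|?] := leP b x; have [?|?] := leP b y; rewrite ?subrr ?normr0 //.
    by rewrite ger0_norm; [apply: le_trans (ler_norm _)|]; lra.
  by rewrite ler0_norm; [rewrite distrC; apply: le_trans (ler_norm _)|]; lra.
rewrite /param_interval; case: lo => [l| |] [/= h1 h2].
- case: hi h2 => [h| |] h2 //; rewrite ?lee_fin in h1 h2.
    exists (fun x => Num.max l (Num.min h x)); split=> [x|x|x y].
    + split=> /=; rewrite lee_fin; first by rewrite le_max lexx.
      by rewrite ge_max (le_trans h1) //= ge_min lexx.
    + by rewrite /= !lee_fin => -[x1 x2]; rewrite (min_r x2) (max_r x1).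
    + exact: le_trans (Lmax _ _ _) (Lmin _ _ _).
  exists (fun x => Num.max l x); split=> [x|x|x y] //=.
  + by split; rewrite ?leey // lee_fin le_max lexx.
  + by rewrite lee_fin => -[x1 _]; rewrite (max_r x1).
- by rewrite leye_eq in h1.
- case: hi h2 => [h| |] h2 //.
    exists (fun x => Num.min h x); split=> [x|x|x y] //=.
    + by split; rewrite ?leNye // lee_fin ge_min lexx.
    + by rewrite lee_fin => -[_ x1]; rewrite (min_r x1).
  by exists id; split=> // x; split; rewrite ?leNye ?leey.
Qed.

Lemma param_itv (lo hi : \bar R) a b s : param_interval lo hi a -> param_interval lo hi b ->
  a <= s <= b -> param_interval lo hi s.
Proof.
move=> [a1 _] [_ b2] /andP[as_ sb]; split.
  by apply: (le_trans a1); rewrite lee_fin.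
by apply: le_trans b2; rewrite lee_fin.
Qed.

Lemma lift_param (lo hi : \bar R) (Rel : R -> R -> Prop) :
  let I := param_interval lo hi in
  (forall a, I a -> exists x, Rel a x) ->
  (forall a x y, I a -> Rel a x -> Rel a y -> exists k : int, y = x + k%:~R) ->
  (forall a x (k : int), I a -> Rel a x -> Rel a (x + k%:~R)) ->
  (forall a x e, I a -> Rel a x -> 0 < e -> exists2 h : R, 0 < h &
    forall b, `|b - a| <= h -> I b -> exists2 y, Rel b y & `|y - x| <= e) ->
  exists2 f, cont I f & forall a, I a -> Rel a (f a).
Proof.
move=> I H1 H2 H3 H4.
have [[a0 Ia0]|nI] := pselect (exists a, I a); last first.
  by exists id => a Ia; exfalso; apply: nI; exists a.
have [rho [r1 r2 r3]] := param_retraction Ia0.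
have [||||f cf Rf] := @lift_global _ (fun a => Rel (rho a)).
- by move=> a; exact: (H1 _ (r1 a)).
- by move=> a x y; exact: (H2 _ _ _ (r1 a)).
- by move=> a x k; exact: (H3 _ _ _ (r1 a)).
- move=> a x e Rax e0; have [h h0 H] := H4 _ _ _ (r1 a) Rax e0.
  by exists h => // b hb; apply: H; [exact: (le_trans (r3 _ _) hb)|exact: r1].
exists f => [|a Ia]; first exact: cont_sub cf.
by have := Rf a; rewrite r2.
Qed.

End LiftingOnInterval.

(** * Existence of a continuous minimizer *)

Section BilliardData.
Context {R : realType}.
Variables (m r r' : nat) (lo hi : \bar R) (K : 'I_m -> R -> set 'rV[R]_2)
  (L : 'I_m -> R -> R) (phi : 'I_m -> R -> R -> 'rV[R]_2).
Local Notation I := (param_interval lo hi).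
Hypothesis r_ge2 : (2 <= r)%N.
Hypothesis r'_ge1 : (1 <= r')%N.
Hypothesis hK : billiard_deformation r r' I K L phi.
Implicit Types (i : 'I_m) (a : R).

Definition bdry_partial i (c : 'I_2) q u a : R := derive1n q (phi i ^~ a) u 0 c.
Local Notation X := bdry_partial.

Lemma derive1n_has_derive i a q u : I a -> (q < r)%N ->
  has_derive_within [set: R] (derive1n q (phi i ^~ a)) u (derive1n q.+1 (phi i ^~ a) u).
Proof.
move=> Ia qr; have [G [G0 G1 _]] := bd_boundary_Cr hK i Ia.
have E p : (p <= r)%N -> derive1n p (phi i ^~ a) = G p.
  elim: p => [|p IH] pr; first by apply/funext => v; rewrite G0.
  by rewrite derive1nS IH ?(ltnW pr) //; apply/funext => v; apply: has_derive_within_derive1; exact: G1.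
by rewrite !E // ?(ltnW qr) //; exact: G1.
Qed.

Lemma X_hd i c q u a : I a -> (q < r)%N ->
  deriv_in [set: R] (fun s => X i c q s a) u (X i c q.+1 u a).
Proof. by move=> Ia qr; apply: has_derive_within_coord; exact: derive1n_has_derive. Qed.

Lemma setT_acc (u d : R) : 0 < d -> exists y, [/\ [set: R] y, y != u & `|y - u| < d].
Proof.
move=> d0; exists (u + d / 2); split=> //.
  by rewrite -subr_eq0 addrAC subrr add0r gt_eqF // divr_gt0.
by rewrite addrAC subrr add0r gtr0_norm; lra.
Qed.

Lemma bdry_periodic i c q u a : (q <= r)%N -> I a -> X i c q (u + L i a) a = X i c q u a.
Proof.
move=> + Ia; elim: q u => [|q IH] u qr; first by rewrite /X /= (bd_periodic hK).
have h1 := X_hd i c (u + L i a) Ia qr; have h2 := X_hd i c u Ia qr.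
apply: (deriv_in_uniq (@setT_acc u) _ h2).
have hs : deriv_in [set: R] (fun y => X i c q (y + L i a) a) u (X i c q.+1 (u + L i a) a).
  have N0 (y : R) : 0 <= `|y - u| by [].
  have dy : expansion (within [set: R] (nbhs u)) (fun y => `|y - u|) (fun y => y + L i a)
      (u + L i a) (fun y => y - u).
    by apply: (expansion_eq (expansionD (expansion_id_within setT u) (expansion_cst N0 (L i a))))
      => // y; rewrite addr0.
  apply: (expansion_hd N0 (@near_dist_le _ setT u) h1 dy).
  by near=> y.
apply: deriv_in_eq hs => // y _; rewrite IH //; exact: ltnW.
Unshelve. all: by end_near. Qed.

Section Partials.
Variable F : 'I_m -> nat -> nat -> R * R -> 'rV[R]_2.
Local Notation D i := [set z : R * R | I z.2 /\ 0 <= z.1 <= L i z.2].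
Hypothesis hF : forall i, mixed_partials (D i) r r' (fun z => phi i z.1 z.2) (F i).
Let Fc i (c : 'I_2) q q' z : R := F i q q' z 0 c.

Lemma Fc_u i c q q' x a : (q < r)%N -> (q' <= r')%N -> D i (x, a) ->
  deriv_in [set s | D i (s, a)] (fun s => Fc i c q q' (s, a)) x (Fc i c q.+1 q' (x, a)).
Proof. by move=> qr qr' Dx; apply: has_derive_within_coord; have [_ H _ _] := hF i; exact: H. Qed.

Lemma Fc_a i c q q' x a : (q <= r)%N -> (q' < r')%N -> D i (x, a) ->
  deriv_in [set s | D i (x, s)] (fun s => Fc i c q q' (x, s)) a (Fc i c q q'.+1 (x, a)).
Proof. by move=> qr qr' Dx; apply: has_derive_within_coord; have [_ _ H _] := hF i; exact: H. Qed.

Lemma Fc_cont i c q q' : (q <= r)%N -> (q' <= r')%N -> cont (D i) (Fc i c q q').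
Proof.
move=> qr qr' z Dz; have [_ _ _ H] := hF i.
have /subspace_continuousP/(_ z Dz) h := H _ _ qr qr'.
have cc : (fun M : 'rV[R]_2 => M 0 c) @ F i q q' z --> F i q q' z 0 c.
  exact: coord_continuous.
exact: (cvg_comp _ _ h cc).
Qed.

(** On [0, L], an interval of positive length, a relative derivative is unique; the restriction of
    the derivative of the extension and the partial of [F] are both such derivatives. *)
Lemma X_Fc i c q z : (q <= r)%N -> D i z -> X i c q z.1 z.2 = Fc i c q 0%N z.
Proof.
case: z => u a; elim: q u => [|q IH] u qr Dz; have [Ia /= /andP[u0 uL]] := Dz.
  by have [H _ _ _] := hF i; rewrite /Fc H.
have L0 := bd_length_gt0 hK i Ia.
have acc : forall d : R, 0 < d -> exists y, [/\ [set s | D i (s, a)] y, y != u & `|y - u| < d].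
  move=> d d0; have h0 : 0 < Num.min (d / 2) (L i a / 2) by rewrite lt_min !divr_gt0.
  have hd_ : Num.min (d / 2) (L i a / 2) <= d / 2 by rewrite ge_min lexx.
  have hL : Num.min (d / 2) (L i a / 2) <= L i a / 2 by rewrite ge_min lexx orbT.
  move: (Num.min _ _) h0 hd_ hL => h h0 hd_ hL.
  (* The nearby point is taken on the side with more room. *)
  have [uh|uh] := leP u (L i a / 2).
    exists (u + h); split; first by split=> //=; apply/andP; split; lra.
      by rewrite -subr_eq0 addrAC subrr add0r gt_eqF.
    by rewrite addrAC subrr add0r gtr0_norm; lra.
  exists (u - h); split; first by split=> //=; apply/andP; split; lra.
    by rewrite -subr_eq0 addrAC subrr sub0r oppr_eq0 gt_eqF.
  by rewrite addrAC subrr sub0r normrN gtr0_norm; lra.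
apply: (deriv_in_uniq acc _ (Fc_u c qr (leq0n _) Dz)).
have h1 : deriv_in [set s | D i (s, a)] (fun s => X i c q s a) u (X i c q.+1 u a).
  by apply: deriv_in_sub (X_hd i c u Ia qr).
apply: deriv_in_eq h1 => // y Dy; apply: IH => //; exact: ltnW.
Qed.

End Partials.

Lemma phi_perz i u a (k : int) : I a -> phi i (u + k%:~R * L i a) a = phi i u a.
Proof.
move=> Ia; apply/rowP => c.
exact: (@X_perz R I (L i) r (X i) (fun c q u a qr => @bdry_periodic i c q u a qr)
  c 0%N u a k (leq0n r) Ia).
Qed.

Lemma phi_reduce i u a : I a -> exists2 v, 0 <= v < L i a &
  phi i v a = phi i u a /\ exists k : int, u = v + k%:~R * L i a.
Proof.
move=> Ia; have L0 := bd_length_gt0 hK i Ia.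
pose k := Num.floor (u / L i a); exists (u - k%:~R * L i a).
  rewrite subr_ge0 -ler_pdivlMr // floor_le /= ltrBlDl -[X in _ + X]mul1r -mulrDl.
  rewrite -ltr_pdivrMr //; have := floorD1_gt (u / L i a).
  by rewrite rmorphD.
split; last by exists k; rewrite subrK.
by rewrite -(phi_perz i _ k Ia) subrK.
Qed.

Lemma phi_eq i u v a : I a -> phi i u a = phi i v a -> exists k : int, v = u + k%:~R * L i a.
Proof.
move=> Ia uv; have [u' hu' [pu [k ->]]] := phi_reduce i u Ia.
have [v' hv' [pv [k' ->]]] := phi_reduce i v Ia.
have -> : v' = u' by apply: (bd_simple hK Ia hv' hu'); rewrite pu pv.
by exists (k' - k); rewrite rmorphB /=; ring.
Qed.

Lemma K_closed i a : I a -> closed (K i a).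
Proof. by move=> Ia; apply: compact_closed; [exact: norm_hausdorff|exact: (bd_compact hK)]. Qed.

Lemma phi_in_K i u a : I a -> K i a (phi i u a).
Proof.
move=> Ia; have [v /andP[v0 vL] [<- _]] := phi_reduce i u Ia.
have : topological_boundary (K i a) (phi i v a).
  by rewrite -(bd_image hK) //; exists v => //=; rewrite v0 ltW.
by move=> [+ _]; exact: K_closed.
Qed.

Lemma boundary_phi i a p : I a -> K i a p -> ~ (K i a)° p -> exists u, p = phi i u a.
Proof.
move=> Ia Kp np; have : topological_boundary (K i a) p.
  by split=> //; exact: subset_closure.
by rewrite -(bd_image hK) // => -[u _ <-]; exists u.
Qed.

Lemma bdry_unit i u a : I a -> X i 0 1%N u a ^+ 2 + X i 1 1%N u a ^+ 2 = 1.
Proof.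
move=> Ia; have := bd_arclength hK i u Ia; rewrite /X derive1n1 => h.
have h0 : 0 <= derive1 (phi i ^~ a) u 0 0 ^+ 2 + derive1 (phi i ^~ a) u 0 1 ^+ 2.
  by rewrite addr_ge0 ?sqr_ge0.
by rewrite -(sqr_sqrtr h0) -/(enorm _) h expr1n.
Qed.

Lemma bdry_simple i u v a : I a -> 0 <= u < L i a -> 0 <= v < L i a ->
  (forall c, X i c 0%N u a = X i c 0%N v a) -> u = v.
Proof.
by move=> Ia hu hv H; apply: (bd_simple hK Ia hu hv); apply/rowP => c; exact: H.
Qed.

Lemma bdry_ccw i u v a : I a ->
  0 <= X i 0 1%N u a * (X i 1 0%N v a - X i 1 0%N u a) -
       X i 1 1%N u a * (X i 0 0%N v a - X i 0 0%N u a).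
Proof.
move=> Ia; have := bd_counterclockwise hK u Ia (phi_in_K i v Ia).
by rewrite /cross !mxE /X derive1n1.
Qed.

Lemma length_cont i : cont I (L i).
Proof.
have [F [hF _]] := bd_smooth hK.
exact: (L_cont r_ge2 (fun a Ia => bd_length_gt0 hK i Ia) (@Fc_u F hF i) (@Fc_cont F hF i)
  (@X_Fc F hF i) (@bdry_periodic i) (@bdry_unit i) (@bdry_simple i) (@bdry_ccw i)).
Qed.

Lemma bdry_cont i c : cont (strip I) (fun z => X i c 0%N z.1 z.2).
Proof.
have [F [hF _]] := bd_smooth hK.
exact: (X_cont r_ge2 r'_ge1 (@param_itv R lo hi) (fun a Ia => bd_length_gt0 hK i Ia)
  (@Fc_u F hF i) (@Fc_a F hF i) (@Fc_cont F hF i)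
  (@X_Fc F hF i) (@bdry_periodic i) (@bdry_unit i) (@bdry_simple i) (@bdry_ccw i)).
Qed.

Lemma bdry_Ck_jet i c s k : (forall a, I a ->
    forall d, 0 < d -> exists y, [/\ I y, y != a & `|y - a| < d]) ->
  (s <= 1)%N -> (k.+1 <= r)%N -> (k <= r')%N ->
  Ck_jet (strip I) k (fun q z => X i c (s + q)%N z.1 z.2).
Proof.
have [F [hF _]] := bd_smooth hK.
exact: (X_Ck_jet r_ge2 r'_ge1 (@param_itv R lo hi) (fun a Ia => bd_length_gt0 hK i Ia)
  (@Fc_u F hF i) (@Fc_a F hF i) (@Fc_cont F hF i)
  (@X_Fc F hF i) (@bdry_periodic i) (@bdry_unit i) (@bdry_simple i) (@bdry_ccw i)).
Qed.

Section Itinerary.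
Variables (n : nat) (xi : 'I_n -> 'I_m).
Hypothesis hxi : admissible xi.
Let Kx a j := K (xi j) a.
Implicit Types (j : 'I_n).

Lemma xi_ordS_neq j : ordS j != j.
Proof. by apply: contra_neq (hxi j) => ->. Qed.

Lemma hull_segment a i k A B (t : R) : K i a A -> K k a B -> 0 <= t <= 1 ->
  convex_hull (K i a `|` K k a) ((1 - t) *: A + t *: B).
Proof.
move=> KA KB /andP[t0 t1] S [cS sub].
have SA : S A by apply: sub; left.
have SB : S B by apply: sub; right.
have := cS B A (Itv01 t0 t1) (mem_set SB) (mem_set SA).
by rewrite inE [X in S X -> _](_ : _ = (1 - t) *: A + t *: B) // addrC.
Qed.

(** If the two neighbours lie in the same obstacle, the segment stays in it by convexity and
    disjointness applies; otherwise this is the no-eclipse condition. *)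
Lemma Kx_avoid a : I a -> forall j A B x t, Kx a (ord_pred j) A -> Kx a (ordS j) B ->
  Kx a j x -> 0 <= t <= 1 -> x <> (1 - t) *: A + t *: B.
Proof.
move=> Ia j A B x t KA KB Kj t01 xE.
have pj : xi (ord_pred j) != xi j by have := hxi (ord_pred j); rewrite ord_predK.
have [same|diff] := eqVneq (xi (ord_pred j)) (xi (ordS j)).
  have : K (xi (ord_pred j)) a x.
    rewrite xE; move: KB; rewrite /Kx -same => KB.
    exact: (@segment_in R n (Kx a) (fun l => bd_strictly_convex hK (i := xi l) Ia)
      (ord_pred j) A B t KA KB t01).
  move=> Kp; have := bd_disjoint hK Ia pj.
  by move=> /seteqP[/(_ x) H _]; apply: H; split.
have := bd_no_eclipse hK Ia diff _ pj; rewrite eq_sym => /(_ (hxi j)).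
move=> /seteqP[/(_ x) H _]; apply: H; split=> //.
by rewrite xE; exact: hull_segment.
Qed.

Lemma Kx_compact a : I a -> forall j, compact (Kx a j).
Proof. by move=> Ia j; exact: (bd_compact hK). Qed.

Lemma Kx_convex a : I a -> forall j, strictly_convex (Kx a j).
Proof. by move=> Ia j; exact: (bd_strictly_convex hK). Qed.

Lemma Kx_nonempty a : I a -> forall j, Kx a j !=set0.
Proof. by move=> Ia j; exists (phi (xi j) 0 a); exact: phi_in_K. Qed.

Definition bounce (v : 'I_n -> R) a j := phi (xi j) (v j) a.

Lemma bounce_admissible v a : I a -> admissible_points (Kx a) (bounce v a).
Proof. by move=> Ia j; exact: phi_in_K. Qed.

(** A shortest loop through the filled obstacles has no interior vertex, so it is a loop of boundary
    points and has parameters. *)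
Lemma shortest_bounce a : I a -> exists v, shortest (Kx a) (bounce v a).
Proof.
move=> Ia; have [p hp] := shortest_exists (Kx_compact Ia) (Kx_nonempty Ia).
have : forall j, exists v, p j = phi (xi j) v a.
  move=> j; apply: boundary_phi => //; first by case: hp => hp _; exact: (hp j).
  exact: (shortest_not_interior xi_ordS_neq (Kx_avoid Ia)).
move=> /choice [v hv]; exists v.
by rewrite (_ : bounce v a = p) //; apply/funext => j; rewrite /bounce hv.
Qed.

Lemma minimizer_shortest a v : I a ->
  (forall w, length_function phi xi v a <= length_function phi xi w a) <->
  shortest (Kx a) (bounce v a).
Proof.
move=> Ia; split=> [H|[_ H] w]; last by apply: H; exact: bounce_admissible.
have [w [hw1 hw2]] := shortest_bounce Ia; split; first exact: bounce_admissible.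
by move=> q hq; apply: (le_trans (H w)); exact: hw2.
Qed.

Lemma shortest_bounce_eq a v w : I a -> shortest (Kx a) (bounce v a) ->
  shortest (Kx a) (bounce w a) -> forall j, phi (xi j) (v j) a = phi (xi j) (w j) a.
Proof.
move=> Ia hv hw j.
exact: (shortest_unique xi_ordS_neq (Kx_convex Ia) (Kx_avoid Ia) hv hw j).
Qed.

(* [x] is a coordinate of the j-th reflection point in units of the perimeter. *)
Let Rel j a x := exists2 v, shortest (Kx a) (bounce v a) & v j = x * L (xi j) a.

(** The points of a minimizer are unique, so one coordinate can be replaced by another
    representative while the others are kept. *)
Lemma Rel_iff j a x v : I a -> shortest (Kx a) (bounce v a) ->
  Rel j a x <-> phi (xi j) (x * L (xi j) a) a = phi (xi j) (v j) a.
Proof.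
move=> Ia hv; split=> [[w hw <-]|E]; first exact: shortest_bounce_eq.
exists (fun l => if l == j then x * L (xi j) a else v l); last by rewrite eqxx.
rewrite (_ : bounce _ a = bounce v a) //; apply/funext => l; rewrite /bounce.
by case: eqP => // ->.
Qed.

Lemma phi_scaled_cvg (T : Type) (G : set_system T) {FG : Filter G} i c
    (f g : T -> R) (x0 a0 : R) : I a0 -> f @ G --> x0 -> g @ G --> a0 ->
  (\forall s \near G, I (g s)) ->
  (fun s => phi i (f s * L i (g s)) (g s) 0 c) @ G --> phi i (x0 * L i a0) a0 0 c.
Proof.
move=> Ia0 hf hg hI.
have gI : g @ G --> within I (nbhs a0).
  move=> A; rewrite /within /= => /hg /= hA.
  by apply: filterS2 hA hI => s; apply.
have hL : (fun s => L i (g s)) @ G --> L i a0.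
  exact: (cvg_comp _ _ gI (@length_cont i a0 Ia0)).
have h2 : (fun s => (f s * L i (g s), g s)) @ G --> (x0 * L i a0, a0).
  by apply: (cvg_pair (G := nbhs (x0 * L i a0)) (H := nbhs a0)) => //; exact: cvgM.
have hs : (fun s => (f s * L i (g s), g s)) @ G --> within (strip I) (nbhs (x0 * L i a0, a0)).
  move=> A; rewrite /within /= => /h2 /= hA.
  by apply: filterS2 hA hI => s; apply.
exact: (cvg_comp _ _ hs (@bdry_cont i c (x0 * L i a0, a0) Ia0)).
Qed.

(** Representatives can be confined to a box of side 1 around [y0], which is compact. A point [w] of
    the box that is shortest at [a0] has j-th coordinate [x0], as it agrees with it modulo 1 and
    within 1/2. Any other [w] is longer than the minimum by a gap that persists near (w, a0), so
    nothing near it is shortest. *)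
Lemma Rel_loc j (a0 x0 e : R) : I a0 -> Rel j a0 x0 -> 0 < e -> exists2 h : R, 0 < h &
  forall a, `|a - a0| <= h -> I a -> exists2 x, Rel j a x & `|x - x0| <= e.
Proof.
move=> Ia0 [v hv vj] e0.
have Lp i a : I a -> 0 < L i a by move=> Ia; exact: (bd_length_gt0 hK).
pose y0 l := v l / L (xi l) a0.
have y0j : y0 j = x0 by rewrite /y0 vj mulfK // gt_eqF // Lp.
have y0v l : y0 l * L (xi l) a0 = v l by rewrite /y0 divfK // gt_eqF // Lp.
pose B : set 'rV[R]_n := [set w | forall l, `[y0 l - 1 / 2, y0 l + 1 / 2]%classic (w ord0 l)].
have cB : compact B.
  exact: (@rV_compact R n (fun l => `[y0 l - 1 / 2, y0 l + 1 / 2]%classic)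
    (fun l => @segment_compact R _ _)).
pose scaled (w : 'rV[R]_n) a l := w 0 l * L (xi l) a.
have near_box : \forall a \near within I (nbhs a0), B `<=` (fun w =>
    I a -> shortest (Kx a) (bounce (scaled w a) a) -> `|w 0 j - x0| <= e).
  apply: (proj1 (compact_near_coveringP _) cB R (within I (nbhs a0))) => w Bw.
  pose G := filter_prod (nbhs w) (within I (nbhs a0)).
  have c1 : (fun s : 'rV[R]_n * R => s.1) @ G --> w by exact: cvg_fst.
  have c1l l : (fun s : 'rV[R]_n * R => s.1 0 l) @ G --> w 0 l.
    exact: (cvg_comp _ _ c1 (@coord_continuous _ _ _ 0 l w)).
  have c2' : (fun s : 'rV[R]_n * R => s.2) @ G --> within I (nbhs a0) by exact: cvg_snd.
  have c2 : (fun s : 'rV[R]_n * R => s.2) @ G --> a0.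
    exact: (cvg_trans c2' (cvg_within _)).
  have nI : \forall s \near G, I s.2 by apply: c2'; exact: withinT.
  have [sw|nsw] := pselect (shortest (Kx a0) (bounce (scaled w a0) a0)).
    have wx : w 0 j = x0.
      have := shortest_bounce_eq Ia0 hv sw j; rewrite vj => /(phi_eq Ia0) [k].
      rewrite /scaled -mulrDl => /(mulIf (lt0r_neq0 (Lp _ _ Ia0))) wk.
      have := Bw j; rewrite /= in_itv /= y0j wk => /andP[k1 k2].
      rewrite (@int_small R k) ?addr0 // ltr_norml; apply/andP; split; lra.
    suff : \forall s \near G, `|(s : 'rV[R]_n * R).1 0 j - x0| <= e.
      by apply: filterS => s ? _ _.
    have /cvgrPdist_le/(_ _ e0) := c1l j; rewrite wx; apply: filterS => s.
    by rewrite distrC.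
  have lt : loop_length (bounce v a0) < loop_length (bounce (scaled w a0) a0).
    rewrite ltNge; apply/negP => le; apply: nsw; split; first exact: bounce_admissible.
    by move=> q hq; apply: (le_trans le); apply: hv.2.
  have cw : (fun s => loop_length (bounce (scaled s.1 s.2) s.2)) @ G -->
      loop_length (bounce (scaled w a0) a0).
    by apply: loop_length_cvg => l c; exact: phi_scaled_cvg.
  have cv : (fun s => loop_length (bounce (fun l => y0 l * L (xi l) s.2) s.2)) @ G -->
      loop_length (bounce v a0).
    apply: loop_length_cvg => l c; rewrite {2}/bounce -y0v.
    by apply: phi_scaled_cvg => //; exact: cvg_cst.
  (* A level halfway in the gap: near (w, a0) the competitor with fixed coordinates [y0] stays below
     it and the configuration near [w] stays above. *)
  pose M := (loop_length (bounce v a0) + loop_length (bounce (scaled w a0) a0)) / 2.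
  have M1 : loop_length (bounce v a0) < M by rewrite /M; lra.
  have M2 : M < loop_length (bounce (scaled w a0) a0) by rewrite /M; lra.
  have n1 : \forall s \near G, loop_length (bounce (fun l => y0 l * L (xi l) s.2) s.2) < M.
    exact: (cvgr_lt _ cv _ M1).
  have n2 : \forall s \near G, M < loop_length (bounce (scaled s.1 s.2) s.2).
    exact: (cvgr_gt _ cw _ M2).
  suff : \forall s \near G, loop_length (bounce (fun l => y0 l * L (xi l) s.2) s.2) <
      loop_length (bounce (scaled s.1 s.2) s.2).
    apply: filterS => -[w' a] /= k Ia [_ min]; exfalso.
    have := min _ (bounce_admissible (fun l => y0 l * L (xi l) a) Ia).
    by rewrite leNgt k.
  near=> s; apply: (@lt_trans _ _ M); near: s; [exact: n1|exact: n2].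
have [h h0 H] := near1_ex near_box.
exists h => // a ha Ia.
have [p hp] := shortest_bounce Ia.
have : forall l, exists x, [/\ y0 l - 1 / 2 <= x, x <= y0 l + 1 / 2 &
    phi (xi l) (x * L (xi l) a) a = phi (xi l) (p l) a].
  move=> l; pose s := p l / L (xi l) a.
  (* The integer shift that brings [s] into the box, of width exactly one period. *)
  pose k := Num.floor (y0 l + 1 / 2 - s).
  have k1 : k%:~R <= y0 l + 1 / 2 - s by exact: floor_le.
  have k2 : y0 l + 1 / 2 - s < (k + 1)%:~R by exact: floorD1_gt.
  rewrite rmorphD /= in k2.
  exists (s + k%:~R); split; [lra|lra|].
  by rewrite mulrDl phi_perz // /s divfK // gt_eqF // Lp.
move=> /choice [x hx].
have sx : shortest (Kx a) (bounce (scaled (\row_l x l) a) a).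
  rewrite (_ : bounce _ a = bounce p a) //; apply/funext => l.
  by rewrite /bounce /scaled mxE; have [_ _] := hx l.
have := H a ha Ia (\row_l x l) _ Ia sx; rewrite mxE => Hj.
exists (x j); first by exists (scaled (\row_l x l) a) => //; rewrite /scaled mxE.
by apply: Hj => l; rewrite /= mxE in_itv /=; have [-> ->] := hx l.
Unshelve. all: by end_near. Qed.

Lemma continuous_minimizer_exists : exists u, continuous_minimizer I phi xi u.
Proof.
have : forall j, exists f, cont I f /\ forall a, I a -> Rel j a (f a).
  move=> j; have [||||f cf Rf] := @lift_param R lo hi (Rel j).
  - move=> a Ia; have [v hv] := shortest_bounce Ia.
    exists (v j / L (xi j) a); exists v => //.
    by rewrite divfK // gt_eqF // (bd_length_gt0 hK).
  - move=> a x y Ia [v hv vx] [w hw wy].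
    have := shortest_bounce_eq Ia hv hw j; rewrite vx wy => /(phi_eq Ia) [k].
    have L0 := bd_length_gt0 hK (xi j) Ia.
    by rewrite -mulrDl => /(mulIf (lt0r_neq0 L0)) ->; exists k.
  - move=> a x k Ia Rx; have [v hv] := shortest_bounce Ia.
    apply/(Rel_iff _ _ Ia hv); rewrite mulrDl phi_perz //.
    exact/(Rel_iff _ _ Ia hv).
  - by move=> a x e; exact: Rel_loc.
  by exists f.
(* The lifts were chosen separately for each [j]; uniqueness of the points makes them coordinates of
   one minimizer. *)
move=> /choice [f hf]; exists (fun j a => f j a * L (xi j) a); split=> [a Ia|j].
  apply/minimizer_shortest => //; have [v hv] := shortest_bounce Ia.
  rewrite (_ : bounce _ a = bounce v a) //; apply/funext => j; rewrite /bounce.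
  by have [_ Rf] := hf j; apply/(Rel_iff _ _ Ia hv); exact: Rf.
apply/contP; apply: contM; last exact: length_cont.
by have [] := hf j.
Qed.

End Itinerary.
End BilliardData.

(** * Regularity of critical points of the length function *)

(* The differential of a unit vector (a, b) / d turns it by the angle
   (a db - b da) / d^2. *)
Lemma unit_tangent_differential (R : fieldType) (d a b da db s t : R) :
  d != 0 -> 2%:R != 0 :> R -> d ^+ 2 = a ^+ 2 + b ^+ 2 ->
  s * (da * d^-1 + a * (- d ^- 2 * ((2 * d)^-1 * (2 * (a * da + b * db))))) +
  t * (db * d^-1 + b * (- d ^- 2 * ((2 * d)^-1 * (2 * (a * da + b * db))))) =
  (a * t - b * s) * (a * db - b * da) * (d ^+ 3)^-1.
Proof.
move=> d0 two0 dE; apply: (mulIf (expf_neq0 3 d0)); rewrite mulfVK ?expf_neq0 //.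
have -> : (a * t - b * s) * (a * db - b * da) =
  (s * da + t * db) * (a ^+ 2 + b ^+ 2) - (s * a + t * b) * (a * da + b * db) by ring.
rewrite -dE; field; exact/andP.
Qed.

Section Regularity.
Context {R : realType}.
Variables (I : set R) (n k : nat).
(** Coordinates of the boundary point of obstacle [j] ([x]), its first and second derivatives in u
    ([t], [w]), and the derivatives in [a] of the point ([al]) and of the tangent ([be]). *)
Variables (x t w al be : 'I_n -> 'I_2 -> R * R -> R) (u : 'I_n -> R -> R).
Implicit Types (j l : 'I_n) (c : 'I_2) (y : 'I_n -> R).

Hypothesis x_fr : forall j c z, strip I z -> frechet_in (strip I) (x j c) z (t j c z) (al j c z).
Hypothesis t_fr : forall j c z, strip I z -> frechet_in (strip I) (t j c) z (w j c z) (be j c z).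
Hypothesis smooth_along : forall i j c, (i <= k)%N -> Ck_in I i (u j) ->
  [/\ Ck_in I i (fun a => x j c (u j a, a)), Ck_in I i (fun a => t j c (u j a, a)),
      Ck_in I i (fun a => w j c (u j a, a)), Ck_in I i (fun a => al j c (u j a, a))
    & Ck_in I i (fun a => be j c (u j a, a))].
Hypothesis u_cont : forall j, cont I (u j).

Definition chord c j (a : R) : R := x j c (u j a, a) - x (ord_pred j) c (u (ord_pred j) a, a).
Definition chord_sqr j a := chord 0 j a ^+ 2 + chord 1 j a ^+ 2.
Definition chord_dir c j a := chord c j a * (Num.sqrt (chord_sqr j a))^-1.
Definition turn c j a := chord_dir c j a - chord_dir c (ordS j) a.
Definition along (f : 'I_n -> 'I_2 -> R * R -> R) c j a := f j c (u j a, a).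
(** The partial derivative of the length function in [u j]: the tangent against the gradient of the
    length in the j-th point. *)
Definition critical j a := along t 0 j a * turn 0 j a + along t 1 j a * turn 1 j a.

Hypothesis chord_gt0 : forall j a, I a -> 0 < chord_sqr j a.
Hypothesis critical_eq0 : forall j a, I a -> critical j a = 0.
Hypothesis curved : forall j a, I a ->
  0 < along w 0 j a * turn 0 j a + along w 1 j a * turn 1 j a.

(** The cube is that of [unit_tangent_differential]. The next three are cross products of chord [j]:
    with the tangent at its end, with the tangent at its start, and with its own partial derivative
    in [a]. *)
Definition wgt j a := (Num.sqrt (chord_sqr j a) ^+ 3)^-1.
Definition cr_out j a := chord 0 j a * along t 1 j a - chord 1 j a * along t 0 j a.
Definition cr_in j a :=
  chord 0 j a * along t 1 (ord_pred j) a - chord 1 j a * along t 0 (ord_pred j) a.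
Definition cr_al j a :=
  chord 0 j a * (along al 1 j a - along al 1 (ord_pred j) a) -
  chord 1 j a * (along al 0 j a - along al 0 (ord_pred j) a).
Definition kappa j a := along w 0 j a * turn 0 j a + along w 1 j a * turn 1 j a.

(* The Hessian of the length function in the parameters [u j], applied to [y],
   and the derivative in the deformation parameter of its gradient. *)
Definition twist y j a := cr_out j a * y j - cr_in j a * y (ord_pred j).
Definition hess y j a := kappa j a * y j + wgt j a * cr_out j a * twist y j a
  - wgt (ordS j) a * cr_in (ordS j) a * twist y (ordS j) a.
Definition mixed j a := along be 0 j a * turn 0 j a + along be 1 j a * turn 1 j a
  + wgt j a * cr_out j a * cr_al j a
  - wgt (ordS j) a * cr_in (ordS j) a * cr_al (ordS j) a.

Lemma hess_pos y a : I a -> (exists j, y j != 0) -> 0 < \sum_j y j * hess y j a.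
Proof.
move=> Ia [j0 y0].
have -> : \sum_j y j * hess y j a =
    \sum_j kappa j a * y j ^+ 2 + \sum_j wgt j a * twist y j a ^+ 2.
  have -> : \sum_j wgt j a * twist y j a ^+ 2 =
      \sum_j wgt j a * cr_out j a * twist y j a * y j -
      \sum_j wgt (ordS j) a * cr_in (ordS j) a * twist y (ordS j) a * y j.
    (* A cyclic shift of the index brings the contributions of both ends of chord [j] together,
       where they factor as the square of its twist. *)
    have -> : \sum_j wgt (ordS j) a * cr_in (ordS j) a * twist y (ordS j) a * y j =
        \sum_j wgt j a * cr_in j a * twist y j a * y (ord_pred j).
      rewrite [RHS](reindex_inj (can_inj (@ordSK n))) /=.
      by apply: eq_bigr => j _; rewrite ordSK.
    by rewrite -sumrB; apply: eq_bigr => j _; rewrite /twist; ring.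
  rewrite -sumrB -big_split /=; apply: eq_bigr => j _; rewrite /hess; ring.
apply: ltr_pwDl; last first.
  apply: sumr_ge0 => j _; apply: mulr_ge0; last exact: sqr_ge0.
  by rewrite /wgt invr_ge0 exprn_ge0 // sqrtr_ge0.
rewrite (bigD1 j0) //=; apply: ltr_pwDl.
  by rewrite mulr_gt0 ?curved // lt_def sqr_ge0 sqrf_eq0 y0.
by apply: sumr_ge0 => j _; rewrite mulr_ge0 ?sqr_ge0 // ltW // curved.
Qed.

(** Columns are images of basis vectors rather than a cyclic tridiagonal pattern: for n = 2 the
    neighbours j - 1 and j + 1 coincide and their entries add up. *)
Definition hess_mx a : 'M[R]_n := \matrix_(j, l) hess (fun i => (i == l)%:R) j a.

Lemma hess_mxE y j a : \sum_l hess_mx a j l * y l = hess y j a.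
Proof.
have S (i : 'I_n) : \sum_l (i == l)%:R * y l = y i.
  rewrite (bigD1 i) //= eqxx mul1r big1 ?addr0 // => l.
  by rewrite eq_sym => /negbTE ->; rewrite mul0r.
rewrite (eq_bigr (fun l =>
    (kappa j a + wgt j a * cr_out j a * cr_out j a
     + wgt (ordS j) a * cr_in (ordS j) a * cr_in (ordS j) a) * ((j == l)%:R * y l) +
    (- (wgt j a * cr_out j a * cr_in j a) * ((ord_pred j == l)%:R * y l) +
     - (wgt (ordS j) a * cr_in (ordS j) a * cr_out (ordS j) a) * ((ordS j == l)%:R * y l)))).
  by rewrite !big_split /= -!mulr_sumr !S /hess /twist ordSK; ring.
by move=> l _; rewrite mxE /hess /twist ordSK; ring.
Qed.

Lemma hess_unit a : I a -> hess_mx a \in unitmx.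
Proof.
move=> Ia; rewrite unitmxE unitfE; apply/negP => /det0P [v v0 vH].
have : exists j, v 0 j != 0.
  apply/existsP; apply: contraNT v0; rewrite negb_exists => /forallP h.
  by apply/eqP/rowP => j; have := h j; rewrite negbK mxE => /eqP.
move=> /(hess_pos Ia); suff -> : \sum_j v 0 j * hess (fun i => v 0 i) j a = 0 by rewrite ltxx.
have E : \sum_l (v *m hess_mx a) 0 l * v 0 l = 0.
  by rewrite vH big1 // => l _; rewrite mxE mul0r.
rewrite -[RHS]E; under [RHS]eq_bigr do rewrite mxE mulr_suml.
rewrite exchange_big /=; apply: eq_bigr => j _.
by rewrite -hess_mxE mulr_sumr; apply: eq_bigr => l _; rewrite mulrA.
Qed.

Definition velocity l a := - \sum_j invmx (hess_mx a) l j * mixed j a.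

Section AtPoint.
Variable a0 : R.
Hypothesis Ia0 : I a0.

Let Fl := within I (nbhs a0).
(** The rate at which the [u j] vary is not known yet, so their own increments are part of the
    gauge. *)
Let N a := \sum_j `|u j a - u j a0| + `|a - a0|.
Let du j a := u j a - u j a0.
Let da a := a - a0.

Let N_ge0 a : 0 <= N a.
Proof. by rewrite addr_ge0 // sumr_ge0. Qed.

Let N_to0 : forall e, 0 < e -> \forall a \near Fl, N a <= e.
Proof.
move=> e e0.
suff H : N @ Fl --> (0 : R).
  have /cvgrPdist_le/(_ _ e0) := H; apply: filterS => a.
  by rewrite sub0r normrN ger0_norm.
have -> : 0 = \sum_j `|u j a0 - u j a0| + `|a0 - a0| :> R.
  by rewrite subrr normr0 addr0 big1 // => j _; rewrite subrr normr0.
apply: cvgD; last first.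
  by apply: cvg_norm; apply: cvgB; [exact: cvg_within|exact: cvg_cst].
apply: (cvg_big (op := +%R) (P := xpredT)); first exact: add_continuous.
by move=> j _; apply: cvg_norm; apply: cvgB; [exact: u_cont|exact: cvg_cst].
Qed.

Let expansion_u j : expansion Fl N (u j) (u j a0) (du j).
Proof.
split.
  exists 1; near=> a; rewrite mul1r /N (bigD1 j) //= -addrA lerDl.
  by rewrite addr_ge0 // sumr_ge0.
by move=> e e0; near=> a; rewrite /du subrr normr0 mulr_ge0 // ltW.
Unshelve. all: by end_near. Qed.

Let expansion_a : expansion Fl N id a0 da.
Proof.
split; first by exists 1; near=> a; rewrite mul1r /N lerDr sumr_ge0.
by move=> e e0; near=> a; rewrite /da subrr normr0 mulr_ge0 // ltW.
Unshelve. all: by end_near. Qed.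

Let near_strip j : \forall a \near Fl, strip I (u j a, a).
Proof. by rewrite /Fl near_withinE; near=> a. Unshelve. all: by end_near. Qed.

Let expansion_x j c : expansion Fl N (along x c j) (along x c j a0)
  (fun a => along t c j a0 * du j a + along al c j a0 * da a).
Proof.
exact: (expansion_fr N_ge0 N_to0 (x_fr j c (z := (u j a0, a0)) Ia0)
  (expansion_u j) expansion_a (near_strip j)).
Qed.

Let expansion_t j c : expansion Fl N (along t c j) (along t c j a0)
  (fun a => along w c j a0 * du j a + along be c j a0 * da a).
Proof.
exact: (expansion_fr N_ge0 N_to0 (t_fr j c (z := (u j a0, a0)) Ia0)
  (expansion_u j) expansion_a (near_strip j)).
Qed.

Let dchord c j a := (along t c j a0 * du j a + along al c j a0 * da a) -
  (along t c (ord_pred j) a0 * du (ord_pred j) a + along al c (ord_pred j) a0 * da a).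

Let expansion_chord c j : expansion Fl N (chord c j) (chord c j a0) (dchord c j).
Proof. exact: expansionB (expansion_x j c) (expansion_x (ord_pred j) c). Qed.

Let ddir c j a := let d := Num.sqrt (chord_sqr j a0) in
  dchord c j a * d^-1 + chord c j a0 * (- d ^- 2 * ((2 * d)^-1 *
    (2 * (chord 0 j a0 * dchord 0 j a + chord 1 j a0 * dchord 1 j a)))).

Let d_neq0 j a : I a -> Num.sqrt (chord_sqr j a) != 0.
Proof. by move=> Ia; rewrite gt_eqF // sqrtr_gt0 chord_gt0. Qed.

Let expansion_dir c j : expansion Fl N (chord_dir c j) (chord_dir c j a0) (ddir c j).
Proof.
have h2 c' : expansion Fl N (fun a => chord c' j a * chord c' j a) (chord c' j a0 * chord c' j a0)
    (fun a => dchord c' j a * chord c' j a0 + chord c' j a0 * dchord c' j a).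
  exact: (expansionM N_ge0 N_to0 (expansion_chord c' j) (expansion_chord c' j)).
have hs : expansion Fl N (chord_sqr j) (chord_sqr j a0) (fun a =>
    2 * (chord 0 j a0 * dchord 0 j a + chord 1 j a0 * dchord 1 j a)).
  by apply: (expansion_eq (expansionD (h2 0) (h2 1))) => [a||a]; rewrite /chord_sqr; ring.
exact: (expansionM N_ge0 N_to0 (expansion_chord c j)
  (expansionV N_ge0 N_to0 (d_neq0 j Ia0) (expansion_sqrt N_ge0 N_to0 (chord_gt0 j Ia0) hs))).
Qed.

Let expansion_turn c j : expansion Fl N (turn c j) (turn c j a0) (fun a => ddir c j a - ddir c (ordS j) a).
Proof. exact: expansionB (expansion_dir c j) (expansion_dir c (ordS j)). Qed.

Let expansion_critical j : expansion Fl N (critical j) (critical j a0)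
  (fun a => hess (fun l => du l a) j a0 + mixed j a0 * da a).
Proof.
have h c : expansion Fl N (fun a => along t c j a * turn c j a) (along t c j a0 * turn c j a0)
    (fun a => (along w c j a0 * du j a + along be c j a0 * da a) * turn c j a0
       + along t c j a0 * (ddir c j a - ddir c (ordS j) a)).
  exact: (expansionM N_ge0 N_to0 (expansion_t j c) (expansion_turn c j)).
apply: (expansion_eq (expansionD (h 0) (h 1))) => // a.
(* By [unit_tangent_differential] only the cross product of a chord with its increment matters; here
   it is written in terms of the Hessian. *)
have tw l : chord 0 l a0 * dchord 1 l a - chord 1 l a0 * dchord 0 l a =
    twist (fun l => du l a) l a0 + cr_al l a0 * da a.
  by rewrite /twist /cr_out /cr_in /cr_al /dchord; ring.
have two0 : 2%:R != 0 :> R by rewrite pnatr_eq0.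
have U l s0 s1 : s0 * ddir 0 l a + s1 * ddir 1 l a =
    (chord 0 l a0 * s1 - chord 1 l a0 * s0) * (twist (fun l => du l a) l a0 + cr_al l a0 * da a)
    * wgt l a0.
  rewrite -tw /ddir /wgt; apply: unit_tangent_differential => //; first exact: d_neq0.
  by rewrite sqr_sqrtr // ltW // chord_gt0.
have U1 := U j (along t 0 j a0) (along t 1 j a0).
have U2 := U (ordS j) (along t 0 j a0) (along t 1 j a0).
rewrite -/(cr_out j a0) in U1.
have E : chord 0 (ordS j) a0 * along t 1 j a0 - chord 1 (ordS j) a0 * along t 0 j a0 =
  cr_in (ordS j) a0 by rewrite /cr_in ordSK.
rewrite E in U2; rewrite /hess /mixed /kappa.
move: U1 U2; set A0 := ddir 0 j a; set A1 := ddir 1 j a.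
set B0 := ddir 0 (ordS j) a; set B1 := ddir 1 (ordS j) a => U1 U2.
transitivity ((along w 0 j a0 * turn 0 j a0 + along w 1 j a0 * turn 1 j a0) * du j a
  + (along be 0 j a0 * turn 0 j a0 + along be 1 j a0 * turn 1 j a0) * da a
  + (along t 0 j a0 * A0 + along t 1 j a0 * A1)
  - (along t 0 j a0 * B0 + along t 1 j a0 * B1)); first by ring.
by rewrite U1 U2; ring.
Qed.

Let small_critical j : small Fl N (fun a => hess (fun l => du l a) j a0 + mixed j a0 * da a).
Proof.
have [_ s] := expansion_critical j; move=> e e0; near=> a.
have Ia : I a by near: a; exact: withinT.
have : `|critical j a - critical j a0 - (hess (fun l => du l a) j a0 + mixed j a0 * da a)|
  <= e * N a by near: a; exact: s.
by rewrite !critical_eq0 // subrr sub0r normrN.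
Unshelve. all: by end_near. Qed.

Let residual l a := du l a - velocity l a0 * da a.

Let small_residual l : small Fl N (residual l).
Proof.
have S (r : seq 'I_n) : small Fl N (fun a => \sum_(j <- r) invmx (hess_mx a0) l j *
    (hess (fun i => du i a) j a0 + mixed j a0 * da a)).
  elim: r => [|j r IH].
    by move=> e e0; near=> a; rewrite big_nil normr0 mulr_ge0 // ltW.
  rewrite (_ : (fun a => _) = fun a => invmx (hess_mx a0) l j *
      (hess (fun i => du i a) j a0 + mixed j a0 * da a) +
      \sum_(j <- r) invmx (hess_mx a0) l j *
      (hess (fun i => du i a) j a0 + mixed j a0 * da a)).
    exact: (smallD (smallZ (invmx (hess_mx a0) l j) (small_critical j)) IH).
  by apply/funext => a; rewrite big_cons.
suff <- : (fun a => \sum_j invmx (hess_mx a0) l j *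
    (hess (fun i => du i a) j a0 + mixed j a0 * da a)) = residual l by exact: S.
apply/funext => a.
have E : \sum_j invmx (hess_mx a0) l j * hess (fun i => du i a) j a0 = du l a.
  transitivity ((invmx (hess_mx a0) *m (hess_mx a0 *m \col_i du i a)) l 0).
    rewrite mxE; apply: eq_bigr => j _; congr (_ * _); rewrite -hess_mxE mxE.
    by apply: eq_bigr => i _; rewrite [X in _ = _ * X]mxE.
  by rewrite mulKmx ?hess_unit // mxE.
under eq_bigr do rewrite mulrDr; rewrite big_split /= E /residual /velocity.
rewrite mulNr opprK mulr_suml; congr (_ + _).
by apply: eq_bigr => j _; rewrite mulrA.
Unshelve. all: by end_near. Qed.

(** The gauge is absorbed: the residuals sum to at most half of it, so N <= 2 W |a - a0|, and an
    error small relative to [N] is small relative to |a - a0|. *)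
Lemma u_hd l : deriv_in I (u l) a0 (velocity l a0).
Proof.
apply/deriv_inP => e e0.
pose W := \sum_j `|velocity j a0| + 1.
have W0 : 0 < W by rewrite ltr_pwDr // sumr_ge0.
(* With n residuals of size N / (2M), the sum is at most N / 2. *)
pose M : R := n%:R + 1; have M0 : 0 < M by rewrite ltr_pwDr.
have m0 : 0 < (2 * M)^-1 by rewrite invr_gt0 mulr_gt0.
have e1 : 0 < e / (2 * W) by rewrite divr_gt0 // mulr_gt0.
have all_small : \forall a \near Fl, forall j, `|residual j a| <= (2 * M)^-1 * N a.
  by apply: filter_forall => j; exact: small_residual.
near=> a.
have Ra : forall j, `|residual j a| <= (2 * M)^-1 * N a by near: a.
have Rl : `|residual l a| <= e / (2 * W) * N a by near: a; exact: small_residual.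
have NW : N a <= 2 * W * `|a - a0|.
  have h1 : \sum_j `|du j a| <= \sum_j ((2 * M)^-1 * N a + `|velocity j a0| * `|da a|).
    apply: ler_sum => j _; rewrite -[du j a](subrK (velocity j a0 * da a)).
    apply: (le_trans (ler_normD _ _)); apply: lerD; first exact: Ra.
    by rewrite normrM.
  rewrite big_split /= sumr_const card_ord -mulr_suml in h1.
  have h2 : ((2 * M)^-1 * N a) *+ n <= 1 / 2 * N a.
    have -> : ((2 * M)^-1 * N a) *+ n = (n%:R / M) * (1 / 2 * N a).
      by rewrite -mulr_natl; field; rewrite gt_eqF.
    rewrite -[leRHS]mul1r ler_wpM2r //; first by rewrite mulr_ge0.
    by rewrite ler_pdivrMr // mul1r lerDl.
  move: h1 h2; rewrite /W /N /du /da mulrDr mulrDl; lra.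
apply: (le_trans Rl); rewrite -[leRHS]mul1r.
have -> : 1 * (e * `|a - a0|) = e / (2 * W) * (2 * W * `|a - a0|).
  by field; rewrite gt_eqF.
by rewrite ler_wpM2l // ltW.
Unshelve. all: by end_near. Qed.

End AtPoint.

Lemma velocity_Ck_in i l : (i <= k)%N -> (forall j, Ck_in I i (u j)) -> Ck_in I i (velocity l).
Proof.
move=> ik hu.
have [Hx Ht Hw Ha Hb] : [/\ forall c j, Ck_in I i (along x c j), forall c j, Ck_in I i (along t c j),
   forall c j, Ck_in I i (along w c j), forall c j, Ck_in I i (along al c j)
   & forall c j, Ck_in I i (along be c j)].
  by split=> c j; have [] := smooth_along c ik (hu j).
have Hc c j : Ck_in I i (chord c j) by apply: Ck_inB; exact: Hx.
have Hs j : Ck_in I i (chord_sqr j) by apply: Ck_inD; apply: Ck_inM; exact: Hc.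
have Hr j : Ck_in I i (fun a => Num.sqrt (chord_sqr j a)).
  by apply: Ck_in_sqrt => // a Ia; exact: chord_gt0.
have d0 j a : I a -> Num.sqrt (chord_sqr j a) != 0.
  by move=> Ia; rewrite gt_eqF // sqrtr_gt0 chord_gt0.
have Hd c j : Ck_in I i (chord_dir c j).
  by apply: Ck_inM => //; apply: Ck_inV => // a Ia; exact: d0.
have Htn c j : Ck_in I i (turn c j) by apply: Ck_inB; exact: Hd.
have Hwg j : Ck_in I i (wgt j).
  apply: Ck_inV => [a Ia|]; first by rewrite expf_neq0 // d0.
  by apply: Ck_inM => //; apply: Ck_inM.
have Ho j : Ck_in I i (cr_out j) by apply: Ck_inB; apply: Ck_inM.
have Hi j : Ck_in I i (cr_in j) by apply: Ck_inB; apply: Ck_inM => //; exact: Ht.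
have Hal j : Ck_in I i (cr_al j) by apply: Ck_inB; apply: Ck_inM => //; apply: Ck_inB; exact: Ha.
have Hk j : Ck_in I i (kappa j) by apply: Ck_inD; apply: Ck_inM.
have Htw y j : Ck_in I i (twist y j).
  by apply: Ck_inB; apply: Ck_inM => //; exact: Ck_in_cst.
have Hh y j : Ck_in I i (hess y j).
  apply: Ck_inB; last by apply: Ck_inM => //; exact: Ck_inM.
  by apply: Ck_inD; [apply: Ck_inM => //; exact: Ck_in_cst|apply: Ck_inM => //; exact: Ck_inM].
have Hm j : Ck_in I i (mixed j).
  apply: Ck_inB; last by apply: Ck_inM => //; exact: Ck_inM.
  by apply: Ck_inD; [apply: Ck_inD; apply: Ck_inM|apply: Ck_inM => //; exact: Ck_inM].
have Hmx p q : Ck_in I i (fun a => hess_mx a p q).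
  by apply: Ck_in_eq (Hh (fun i => (i == q)%:R) p) => a _; rewrite mxE.
have Hinv p q : Ck_in I i (fun a => invmx (hess_mx a) p q).
  (* Cramer's rule: the entries of the inverse are polynomial in those of the matrix, up to division
     by the determinant. *)
  apply: (@Ck_in_eq _ _ _ (fun a => (\det (hess_mx a))^-1 * cofactor (hess_mx a) q p)).
    by move=> a Ia; rewrite /invmx hess_unit // !mxE.
  apply: Ck_inM.
    apply: Ck_inV; last exact: Ck_in_det.
    by move=> a Ia; have := hess_unit Ia; rewrite unitmxE unitfE.
  apply: Ck_inM; first exact: Ck_in_cst.
  by apply: Ck_in_det => r s; apply: Ck_in_eq (Hmx (lift q r) (lift p s)) => a _; rewrite !mxE.
by apply: Ck_inN; apply: Ck_in_sum => j; apply: Ck_inM.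
Qed.

Lemma u_Ck_in i j : (i <= k.+1)%N -> Ck_in I i (u j).
Proof.
elim: i j => [|i IH] j ik; first exact: u_cont.
exists (velocity j); first by move=> a Ia; exact: u_hd.
by apply: velocity_Ck_in => // l; apply: IH; exact: ltnW.
Qed.

End Regularity.

(** * Conclusion *)

Lemma deriv_in_min (R : realType) (f : R -> R) u l :
  deriv_in [set: R] f u l -> (forall y, f u <= f y) -> l = 0.
Proof.
move=> /deriv_inP H min; apply/eqP; apply: contraT => l0.
have e0 : 0 < `|l| / 2 by rewrite divr_gt0 // normr_gt0.
have [h h0 k] := near1_ex (H _ e0).
(* A step against the slope lowers [f] by at least |l| h / 2. *)
pose s := - Num.sg l * h.
have sh : `|s| = h by rewrite /s normrM normrN normr_sg l0 mul1r gtr0_norm.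
have := k (u + s); rewrite addrAC subrr add0r sh lexx => /(_ isT I).
have -> : l * s = - (`|l| * h) by rewrite /s mulrA mulrN mulNr [l * _]mulrC -normrEsg.
rewrite opprK => /ler_normlP [_]; have := min (u + s).
have : 0 < `|l| * h by rewrite mulr_gt0 // normr_gt0.
have -> : `|l| / 2 * h = `|l| * h / 2 by ring.
lra.
Qed.

Lemma Ck_jet_le (R : realType) (S : set (R * R)) k l h : (k <= l)%N -> Ck_jet S l h -> Ck_jet S k h.
Proof.
elim: l => [|l IH]; first by rewrite leqn0 => /eqP->.
by rewrite leq_eqVlt => /orP[/eqP->//|]; rewrite ltnS => /IH H /Ck_jetS.
Qed.

(** This settles parameter intervals with at most one point, where the gluing of jets has no
    accumulation point to rely on. *)
Lemma Ck_in_subsingleton (R : realType) (D : set R) k f :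
  (forall x y, D x -> D y -> x = y) -> Ck_in D k f.
Proof.
move=> D1; have near_eq x : D x -> \forall y \near within D (nbhs x), y = x.
  by move=> Dx; rewrite near_withinE; near=> y => Dy; exact: D1.
elim: k f => [|k IH] f.
  move=> x Dx; apply/cvgrPdist_le => e e0; have := near_eq x Dx.
  by apply: filterS => y ->; rewrite subrr normr0 ltW.
exists (fun=> 0); last exact: IH.
move=> x Dx; apply/deriv_inP => e e0; have := near_eq x Dx.
by apply: filterS => y ->; rewrite !subrr mulr0 subr0 normr0 mulr0.
Unshelve. all: by end_near. Qed.

Lemma param_no_isolated_point (R : realType) (lo hi : \bar R) (b b' : R) :
  let I := param_interval lo hi in I b -> I b' -> b != b' ->
  forall a, I a -> forall d, 0 < d -> exists y, [/\ I y, y != a & `|y - a| < d].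
Proof.
move=> I Ib Ib' bb' a Ia d d0.
have [c Ic ca] : exists2 c, I c & c != a.
  have [ab|ab] := eqVneq b a; last by exists b.
  by exists b' => //; rewrite -ab eq_sym.
have ca0 : 0 < `|c - a| by rewrite normr_gt0 subr_eq0.
(* The point sought lies on the way from [a] to [c]: s <= 1 keeps it in the interval, and s |c - a|
   <= d / 2 keeps it close to [a]. *)
pose s := Num.min 1 (d / (2 * `|c - a|)).
have s0 : 0 < s by rewrite lt_min ltr01 divr_gt0 // mulr_gt0.
have s1 : s <= 1 by rewrite ge_min lexx.
have sd : s * `|c - a| <= d / 2.
  rewrite -ler_pdivlMr // (_ : d / 2 / `|c - a| = d / (2 * `|c - a|)).
    by rewrite /s ge_min lexx orbT.
  by rewrite invfM mulrA.
exists (a + s * (c - a)); split.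
- have [ac|ac] := leP a c.
    apply: (param_itv Ia Ic); have : 0 <= (1 - s) * (c - a) by rewrite mulr_ge0 ?subr_ge0.
    have : 0 <= s * (c - a) by rewrite mulr_ge0 ?subr_ge0 // ltW.
    lra.
  apply: (param_itv Ic Ia); have : 0 <= (1 - s) * (a - c).
    by rewrite mulr_ge0 ?subr_ge0 // ltW.
  have : 0 <= s * (a - c) by rewrite mulr_ge0 ?subr_ge0 // ltW.
  lra.
- by rewrite -subr_eq0 addrAC subrr add0r mulf_neq0 ?subr_eq0 // gt_eqF.
- by rewrite addrAC subrr add0r normrM gtr0_norm //; lra.
Qed.

Section MinimizerRegularity.
Context {R : realType}.
Variables (m r r' : nat) (lo hi : \bar R) (K : 'I_m -> R -> set 'rV[R]_2)
  (L : 'I_m -> R -> R) (phi : 'I_m -> R -> R -> 'rV[R]_2).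
Local Notation I := (param_interval lo hi).
Hypothesis r_ge2 : (2 <= r)%N.
Hypothesis r'_ge1 : (1 <= r')%N.
Hypothesis hK : billiard_deformation r r' I K L phi.
Variables (n : nat) (xi : 'I_n -> 'I_m).
Hypothesis hxi : admissible xi.
Local Notation X := (bdry_partial phi).

(** Used with s = 0 for the point and with s = 1 for its tangent; the latter is why [k.+2]
    derivatives in u are requested. *)
Lemma bdry_expansion k i c s : (forall a, I a ->
    forall d, 0 < d -> exists y, [/\ I y, y != a & `|y - a| < d]) ->
  (k.+2 <= r)%N -> (k.+1 <= r')%N -> (s <= 1)%N ->
  exists g, [/\ forall z, strip I z -> frechet_in (strip I) (fun z => X i c s z.1 z.2) z
       (X i c s.+1 z.1 z.2) (g z),
    exists2 h, Ck_jet (strip I) k h & h 0%N = g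
    & exists2 h, Ck_jet (strip I) k h & h 0%N = (fun z => X i c s.+1 z.1 z.2)].
Proof.
move=> acc kr kr' s1; have [g [H Hg Hs]] := bdry_Ck_jet r_ge2 r'_ge1 hK i c acc s1 kr kr'.
exists (g 0%N); split; last 2 first.
- by exists g.
- by exists (fun q z => X i c (s + q.+1)%N z.1 z.2) => //; rewrite addn1.
- move=> z Iz; have := H 0%N z (leq0n _) Iz; rewrite addn1.
  by congr frechet_in; apply/funext => w; rewrite addn0.
Qed.

Variable u : 'I_n -> R -> R.
Hypothesis hu : continuous_minimizer I phi xi u.
Let x j c (z : R * R) := X (xi j) c 0%N z.1 z.2.
Let p a := bounce phi xi (u ^~ a) a.
Let Kx a j := K (xi j) a.

Lemma minimizer_points_shortest a : I a -> shortest (Kx a) (p a).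
Proof. by move=> Ia; apply/(minimizer_shortest hK hxi) => //; exact: hu.1. Qed.

Lemma chordE c j a : chord x u c j a = (p a j - p a (ord_pred j)) 0 c.
Proof. by rewrite !mxE. Qed.

Lemma sqrt_chordE j a : Num.sqrt (chord_sqr x u j a) = enorm (p a j - p a (ord_pred j)).
Proof. by rewrite /chord_sqr !chordE. Qed.

Lemma turnE c j a : turn x u c j a = bend (p a) j 0 c.
Proof.
by rewrite /turn /chord_dir !sqrt_chordE !chordE ordSK /bend !mxE; ring.
Qed.

Lemma bend_support j a s : I a ->
  0 <= turn x u 0 j a * (X (xi j) 0 0%N s a - X (xi j) 0 0%N (u j a) a) +
       turn x u 1 j a * (X (xi j) 1 0%N s a - X (xi j) 1 0%N (u j a) a).
Proof.
move=> Ia; rewrite !turnE.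
have := bend_ge0 (xi_ordS_neq hxi) (fun l => bd_strictly_convex hK (i := xi l) Ia)
  (Kx_avoid hK hxi Ia) (minimizer_points_shortest Ia)
  (phi_in_K hK (xi j) s Ia : Kx a j (phi (xi j) s a)).
by rewrite /dot [X in _ * X + _]mxE [X in _ + _ * X]mxE !mxE.
Qed.

(** The law of reflection: by [bend_support] the scalar product of the boundary point with the bend
    is minimal at [u j], so its derivative vanishes there. *)
Lemma bend_tangent j a : I a ->
  X (xi j) 0 1%N (u j a) a * turn x u 0 j a + X (xi j) 1 1%N (u j a) a * turn x u 1 j a = 0.
Proof.
move=> Ia; have r1 : (0 < r)%N := ltnW r_ge2.
have h c := X_hd hK (xi j) c (u j a) Ia r1.
apply: (@deriv_in_min _ (fun s => turn x u 0 j a * X (xi j) 0 0%N s a +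
  turn x u 1 j a * X (xi j) 1 0%N s a) (u j a)).
  apply: (expansion_eq (expansionD (expansionZ (turn x u 0 j a) (h 0))
    (expansionZ (turn x u 1 j a) (h 1)))) => // y.
  ring.
by move=> s; have := bend_support j s Ia; lra.
Qed.

(** Orthogonal to the unit tangent, the bend is [l] times the left normal, and the claimed quantity
    is [l] times the curvature. By [bend_neq0], [l] is nonzero; it is not negative, since both the
    bend and the normal support the obstacle. *)
Lemma bend_curved j a : I a ->
  0 < X (xi j) 0 2%N (u j a) a * turn x u 0 j a + X (xi j) 1 2%N (u j a) a * turn x u 1 j a.
Proof.
move=> Ia; have r1 : (0 < r)%N := ltnW r_ge2.
set i := xi j; set s0 := u j a.
have k0 : 0 < X i 0 1%N s0 a * X i 1 2%N s0 a - X i 1 1%N s0 a * X i 0 2%N s0 a.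
  by have := bd_curvature_gt0 hK i s0 Ia; rewrite /cross /bdry_partial derive1n1.
have uu := bdry_unit hK i s0 Ia.
have tt := bend_tangent j Ia; rewrite -/i -/s0 in tt.
pose v0 := turn x u 0 j a; pose v1 := turn x u 1 j a.
pose l := X i 0 1%N s0 a * v1 - X i 1 1%N s0 a * v0.
rewrite -/v0 -/v1 in tt *.
have E0 : v0 = - (l * X i 1 1%N s0 a).
  rewrite -[LHS]mul1r -uu /l; move: tt.
  move: (X i 0 1%N s0 a) (X i 1 1%N s0 a) => t0 t1 tt.
  have -> : (t0 ^+ 2 + t1 ^+ 2) * v0 = t0 * (t0 * v0 + t1 * v1) - t1 * (t0 * v1 - t1 * v0) by ring.
  by rewrite tt; ring.
have E1 : v1 = l * X i 0 1%N s0 a.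
  rewrite -[LHS]mul1r -uu /l; move: tt.
  move: (X i 0 1%N s0 a) (X i 1 1%N s0 a) => t0 t1 tt.
  have -> : (t0 ^+ 2 + t1 ^+ 2) * v1 = t1 * (t0 * v0 + t1 * v1) + t0 * (t0 * v1 - t1 * v0) by ring.
  by rewrite tt; ring.
have -> : X i 0 2%N s0 a * v0 + X i 1 2%N s0 a * v1 =
    l * (X i 0 1%N s0 a * X i 1 2%N s0 a - X i 1 1%N s0 a * X i 0 2%N s0 a).
  by rewrite {1}E0 {1}E1; ring.
rewrite pmulr_lgt0 //; rewrite lt_def; apply/andP; split.
  apply/eqP => l0; apply: (bend_neq0 (Kx_avoid hK hxi Ia) (j := j)
    (bounce_admissible hK xi (u ^~ a) Ia)).
  apply: rV2P; rewrite -turnE [RHS]mxE.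
    by rewrite -/v0 E0 l0 mul0r oppr0.
  by rewrite -/v1 E1 l0 mul0r.
rewrite leNgt; apply/negP => l_lt0.
(* Otherwise the whole boundary curve would lie on one tangent line. *)
pose line s := X i 0 1%N s0 a * (X i 1 0%N s a - X i 1 0%N s0 a) -
  X i 1 1%N s0 a * (X i 0 0%N s a - X i 0 0%N s0 a).
have line0 s : line s = 0.
  apply/eqP; rewrite eq_le (bdry_ccw hK) // andbT.
  have := bend_support j s Ia; rewrite -/v0 -/v1 -/i -/s0 {1}E0 {1}E1.
  have -> : - (l * X i 1 1%N s0 a) * (X i 0 0%N s a - X i 0 0%N s0 a) +
    l * X i 0 1%N s0 a * (X i 1 0%N s a - X i 1 0%N s0 a) = l * line s by rewrite /line; ring.
  by rewrite nmulr_rge0.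
have deriv0 s : deriv_in [set: R] (fun=> 0) s (0 : R).
  by apply/deriv_inP => e e0; near=> y; rewrite mul0r !subr0 normr0 mulr_ge0 // ltW.
have slope0 s : X i 0 1%N s0 a * X i 1 1%N s a - X i 1 1%N s0 a * X i 0 1%N s a = 0.
  have h c := X_hd hK i c s Ia r1.
  have N0 (y : R) : 0 <= `|y - s| by [].
  apply: (deriv_in_uniq (@setT_acc R s) _ (deriv0 s)).
  apply: (deriv_in_eq (f := line)) => //.
  apply: (expansion_eq (expansionB
    (expansionZ (X i 0 1%N s0 a) (expansionB (h 1) (expansion_cst N0 (X i 1 0%N s0 a))))
    (expansionZ (X i 1 1%N s0 a) (expansionB (h 0) (expansion_cst N0 (X i 0 0%N s0 a)))))) => // y.
  ring.
have h c := X_hd hK i c s0 Ia r_ge2.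
have : X i 0 1%N s0 a * X i 1 2%N s0 a - X i 1 1%N s0 a * X i 0 2%N s0 a = 0.
  apply: (deriv_in_uniq (@setT_acc R s0) _ (deriv0 s0)).
  apply: (deriv_in_eq (f := fun s => X i 0 1%N s0 a * X i 1 1%N s a -
     X i 1 1%N s0 a * X i 0 1%N s a)) => //.
  apply: (expansion_eq (expansionB (expansionZ (X i 0 1%N s0 a) (h 1))
    (expansionZ (X i 1 1%N s0 a) (h 0)))) => // y.
  ring.
by move=> z; rewrite z ltxx in k0.
Unshelve. all: by end_near. Qed.

Lemma minimizer_Ck_in j : Ck_in I (minn (r - 1) r') (u j).
Proof.
have ucont l : cont I (u l) by apply/contP; exact: hu.2.
have [[b [b' [Ib Ib' bb']]]|sub] := pselect (exists b b', [/\ I b, I b' & b != b']); last first.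
  apply: Ck_in_subsingleton => b b' Ib Ib'; apply/eqP; apply: contraT => bb'.
  by exfalso; apply: sub; exists b, b'.
have acc := param_no_isolated_point Ib Ib' bb'.
(* [u_Ck_in] reaches one order more than the data; the minimum is at least 1 as r >= 2 and r' >=
   1. *)
pose k := (minn (r - 1) r').-1.
have kS : k.+1 = minn (r - 1) r' by rewrite prednK // leq_min subn_gt0 r_ge2.
have kr : (k.+2 <= r)%N by rewrite -(prednK (ltnW r_ge2)) ltnS -subn1 kS geq_minl.
have kr' : (k.+1 <= r')%N by rewrite kS geq_minr.
have /choice [G0 HG0] : forall ic : 'I_n * 'I_2, exists g, _ :=
  fun ic => @bdry_expansion k (xi ic.1) ic.2 0 acc kr kr' (leq0n _).
have /choice [G1 HG1] : forall ic : 'I_n * 'I_2, exists g, _ :=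
  fun ic => @bdry_expansion k (xi ic.1) ic.2 1 acc kr kr' (leqnn _).
rewrite -kS.
apply: (@u_Ck_in R I n k x (fun l c z => X (xi l) c 1%N z.1 z.2)
  (fun l c z => X (xi l) c 2%N z.1 z.2)
  (fun l c => G0 (l, c)) (fun l c => G1 (l, c)) u) => //.
- by move=> l c z Iz; have [H _ _] := HG0 (l, c); exact: H.
- by move=> l c z Iz; have [H _ _] := HG1 (l, c); exact: H.
- move=> e l c ek ul.
  have comp f : (exists2 h, Ck_jet (strip I) k h & h 0%N = f) -> Ck_in I e (fun a => f (u l a, a)).
    move=> [h H <-]; apply: (Ck_in_jet_comp (S := strip I)) => //.
    exact: Ck_jet_le ek H.
  have [_ A0 A1] := HG0 (l, c); have [_ B0 B1] := HG1 (l, c).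
  split; [|exact: (comp _ A1)|exact: (comp _ B1)|exact: (comp _ A0)|exact: (comp _ B0)].
  apply: (comp (x l c)); exists (fun q z => X (xi l) c (0 + q)%N z.1 z.2) => //.
  apply: (bdry_Ck_jet r_ge2 r'_ge1 hK) => //; [exact: ltnW|exact: ltnW].
- move=> l a Ia; have [P0 _] := in_neq_out (Kx_avoid hK hxi Ia) l
    (bounce_admissible hK xi (u ^~ a) Ia).
  by rewrite -sqrtr_gt0 sqrt_chordE enorm_gt0.
- by move=> l a Ia; exact: bend_tangent.
- by move=> l a Ia; exact: bend_curved.
Qed.

End MinimizerRegularity.

Theorem theorem3p1 (R : realType) (m r r' : nat) (lo hi : \bar R)
    (K : 'I_m -> R -> set 'rV[R]_2) (L : 'I_m -> R -> R)
    (phi : 'I_m -> R -> R -> 'rV[R]_2)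
    (hm : (3 <= m)%N) (hr : (2 <= r)%N) (hr' : (1 <= r')%N)
    (hK : billiard_deformation r r' (param_interval lo hi) K L phi)
    (n : nat) (xi : 'I_n -> 'I_m) (hxi : admissible xi) :
  (exists u : 'I_n -> R -> R,
     continuous_minimizer (param_interval lo hi) phi xi u) /\
  (forall u : 'I_n -> R -> R,
     continuous_minimizer (param_interval lo hi) phi xi u ->
     forall j : 'I_n, Ck_on (param_interval lo hi) (minn (r - 1) r') (u j)).
Proof.
split; first exact: (continuous_minimizer_exists hr hr' hK hxi).
by move=> u hu j; apply: Ck_in_Ck_on; exact: (minimizer_Ck_in hr hr' hK hxi hu j).
Qed.
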